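(* Let $\lambda>0$. Then the perturbed system $$\frac{dx}{dt}=\partial_y H(x,y;\lambda)+F(x,y,t),\qquad \frac{dy}{dt}=-\partial_x H(x,y;\lambda)+G(x,y,t)$$ has two different solutions $x_\ast(t),y_\ast(t)$, one for each choice of sign $\sigma=\pm\sqrt\lambda$, with asymptotic expansion of the form $$x_\ast(t)=\sigma+\sum_{k=1}^{\infty}t^{-\frac kq}x_k,\qquad y_\ast(t)=\sum_{k=1}^{\infty}t^{-\frac kq}y_k,\qquad t\to\infty,$$ with constant real coefficients $x_k,y_k$.
   Context: Standing setting. The functions $H(x,y;\lambda)$, $F(x,y,t)$, $G(x,y,t)$ are smooth for all $(x,y)\in\mathbb R^2$, $t>0$, $\lambda\in\mathbb R$. The Hamiltonian of the limiting system is $H(x,y;\lambda)=\frac{y^2}{2}+V(x;\lambda)$ with $\partial_xV(x;\lambda)=(x^2-\lambda)w(x)$, where, for some $d_0>0$, $w(x)>0$ for all $(x,\lambda)\in\{|x|<\sqrt\lambda+d_0,\ \lambda\ge 0\}\cup\{|x|<d_0,\ \lambda<0\}$. The perturbations satisfy $F(x,y,t)\to0$ and $G(x,y,t)\to0$ as $t\to\infty$ for $(x,y)$ in any compact subset of $\mathbb R^2$, and have power-law asymptotics $$F(x,y,t)=\sum_{k=1}^\infty t^{-\frac kq}F_k(x,y),\qquad G(x,y,t)=\sum_{k=1}^\infty t^{-\frac kq}G_k(x,y),\qquad t\to\infty,$$ where $q$ is a positive integer and $F_k,G_k$ are smooth functions on $\mathbb R^2$. Infinite series followed by ''$t\to\infty$''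 are understood as asymptotic expansions. The coefficients $x_k,y_k$ of the solutions' expansions are obtained by substituting the series into the system and equating the coefficients of equal powers of $t$. *)

(* Defs.v *)
From Stdlib Require Import Reals List.
From Coquelicot Require Import Coquelicot.
Open Scope R_scope.

Definition compact_set {T : UniformSpace} (K : T -> Prop) : Prop :=
  forall (I : Type) (U : I -> T -> Prop),
    (forall i, open (U i)) ->
    (forall p, K p -> exists i, U i p) ->
    exists l : list I, forall p, K p -> exists i, In i l /\ U i p.

Definition smooth2 (f : R -> R -> R) : Prop :=
  forall n x y, ex_diff_n f n x y.

(** Three-variable counterpart of Coquelicot's [ex_diff_n], on a domain [D]
    which is meant to be open: the values of [Derive] outside [D] are junk but
    do not affect continuity or differentiability at points of [D]. *)
Fixpoint Cn3 (D : R -> R -> R -> Prop) (n : nat) (f : R -> R -> R -> R) : Prop :=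
  (forall x y z, D x y z ->
     continuous (fun p : R * R * R => f (fst (fst p)) (snd (fst p)) (snd p))
       (x, y, z)) /\
  match n with
  | O => True
  | S m =>
      (forall x y z, D x y z ->
         ex_derive (fun u => f u y z) x /\
         ex_derive (fun u => f x u z) y /\
         ex_derive (fun u => f x y u) z) /\
      Cn3 D m (fun x y z => Derive (fun u => f u y z) x) /\
      Cn3 D m (fun x y z => Derive (fun u => f x u z) y) /\
      Cn3 D m (fun x y z => Derive (fun u => f x y u) z)
  end.

Definition smooth3 (D : R -> R -> R -> Prop) (f : R -> R -> R -> R) : Prop :=
  forall n, Cn3 D n f.

Definition vanishes_on_compacts (f : R -> R -> R -> R) : Prop :=
  forall K : R * R -> Prop, compact_set K ->
  forall eps : posreal,
    Rbar_locally p_infty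
      (fun t => forall x y, K (x, y) -> Rabs (f x y t) <= eps).

(** [t ^ (- k / q)], meaningful for [t > 0] and [q > 0]. *)
Definition tpow (q k : nat) (t : R) : R := Rpower t (- (INR k / INR q)).

(** [f t = sum_(k >= 1) t ^ (- k / q) * c k] as an asymptotic expansion: the
    remainder after [N] terms is [o(t ^ (- N / q))]; [sum_n_m] is [0] for
    [N = 0], and [c 0] is never used. *)
Definition expansion (q : nat) (f : R -> R) (c : nat -> R) : Prop :=
  forall N : nat,
    is_domin (Rbar_locally p_infty) (tpow q N)
      (fun t => f t - sum_n_m (fun k => tpow q k t * c k) 1 N).

(** The same for a function depending on a point of the plane, the remainder
    estimate being uniform on compact sets. *)
Definition expansion_on_compacts (q : nat)
    (f : R -> R -> R -> R) (c : nat -> R -> R -> R) : Prop :=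
  forall K : R * R -> Prop, compact_set K ->
  forall (N : nat) (eps : posreal),
    Rbar_locally p_infty
      (fun t => forall x y, K (x, y) ->
         Rabs (f x y t - sum_n_m (fun k => tpow q k t * c k x y) 1 N)
           <= eps * tpow q N t).

Definition is_solution (H F G : R -> R -> R -> R) (lambda t0 : R)
    (x y : R -> R) : Prop :=
  forall t, t0 < t ->
    is_derive x t (Derive (fun v => H (x t) v lambda) (y t) + F (x t) (y t) t) /\
    is_derive y t (- Derive (fun u => H u (y t) lambda) (x t) + G (x t) (y t) t).

(* Main.v *)
Require Import Defs.
From Stdlib Require Import Reals Lra Lia Psatz List Classical ClassicalEpsilon.
From Coquelicot Require Import Coquelicot.
Open Scope R_scope.

(** The unperturbed system has an equilibrium at [(sg, 0)] for [sg] either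
    square root of [lambda], with Jacobian matrix [[0 1; - kappa 0]] and
    [kappa = 2 sg w(sg)]: a center for the positive root, a saddle for the
    negative one. In both cases the matrix is invertible. All asymptotics are
    expressed in [s = t ^ (-1/q)], called [tau q t], so that [s ^ q = 1/t].

    Invertibility determines a formal solution: the residual of the [M]-th
    partial sum has an expansion in powers of [s], and its first coefficient
    is cancelled by solving a linear system for the next pair of coefficients
    ([next_coefficients], [formal_solution]). The difference [u] between a
    solution and the [M]-th partial sum then satisfies
    [u' = A(s) u + O(s^(q+1) |u| + s^(M+1))] as long as [|u| <= s^(q+1)], with a
    polynomial matrix [A] that does not depend on [M] ([remainder_equation]).

    A genuine solution cannot be obtained from a contraction argument on
    [[t0, +oo)]: the expansion of [F] and [G] says nothing about their
    derivatives, so the Lipschitz constants are only bounded on bounded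
    intervals of time. Instead one exhibits a tube [|u| <= s^p] in which, for
    every [n], some orbit stays during [[t0, t0 + n]]; a cluster point of the
    initial values gives an orbit that stays forever ([trapped_forever]).

    Near a center, a quadratic form invariant under the trace-free part of
    [A] has logarithmic derivative equal to the trace of [A], up to
    [O(s^(q+1))] ([energy_derivative]). Modulo [s^q = 1/t] the trace is a
    polynomial in [s] without constant term, so either it is at least [-C/t]
    or it is eventually below [-B/t] for every [B] ([trace_dichotomy]). In the
    first case a tube that shrinks fast enough is crossed outward only, and
    orbits are followed backward from time [t0 + n]; in the second it is
    crossed inward only ([center_trapped]). Near a saddle the orbit is found
    by shooting along the unstable direction ([saddle_shooting]).

    Finally, an orbit staying in one such tube has the whole expansion: the
    same differential inequalities, now read as comparison principles, improve
    the bound on the energy, or on the two components of [u], by one power of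
    [s] at a time, up to an order that grows with [M] ([center_decay],
    [saddle_decay]). *)

(** * Orders of magnitude and expansions in one small variable *)


Ltac nonneg :=
  repeat first
    [ apply Rplus_le_le_0_compat | apply Rmult_le_pos | apply Rabs_pos | apply pow2_ge_0
    | apply pow_le | apply pos_INR | apply Rlt_le, exp_pos
    | apply Rlt_le, Rinv_0_lt_compat ];
  try lra; auto with real.

Lemma at_right0_iff (P : R -> Prop) :
  at_right 0 P <-> exists d, 0 < d /\ forall s, 0 < s < d -> P s.
Proof.
  split.
  - intros [e He]. exists e. split; [apply cond_pos|].
    intros s Hs. apply He; [|lra].
    change (Rabs (s - 0) < e). rewrite Rabs_pos_eq; lra.
  - intros [d [Hd HP]]. exists (mkposreal d Hd). intros s Hs Hs0. apply HP.
    change (Rabs (s - 0) < d) in Hs. apply Rabs_def2 in Hs. lra.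
Qed.

Lemma at_right0_lt (d : R) : 0 < d -> at_right 0 (fun s => 0 < s < d).
Proof. intros Hd. apply at_right0_iff. exists d. auto. Qed.

(** The variable [s -> 0+] stands for [t ^ (-1/q)]: natural exponents suffice for all
    the orders that occur. *)
Definition bigO (n : nat) (h : R -> R) : Prop :=
  exists K, 0 <= K /\ at_right 0 (fun s => Rabs (h s) <= K * s ^ n).

Lemma bigO_ext (n : nat) (g h : R -> R) :
  at_right 0 (fun s => g s = h s) -> bigO n g -> bigO n h.
Proof.
  intros Hgh [K [HK Hg]]. exists K. split; [exact HK|].
  generalize (filter_and _ _ Hgh Hg). apply filter_imp. intros s [-> Hs]. exact Hs.
Qed.

Lemma bigO_ext_all (n : nat) (g h : R -> R) :
  (forall s, g s = h s) -> bigO n g -> bigO n h.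
Proof. intros Hgh. apply bigO_ext. apply filter_forall. exact Hgh. Qed.

Lemma bigO_dom (n : nat) (K : R) (g h : R -> R) :
  at_right 0 (fun s => Rabs (h s) <= K * Rabs (g s)) -> bigO n g -> bigO n h.
Proof.
  intros Hgh [C [HC Hg]]. exists (Rabs K * C).
  split; [apply Rmult_le_pos; [apply Rabs_pos|exact HC]|].
  generalize (filter_and _ _ Hgh Hg). apply filter_imp. intros s [H1 H2].
  apply Rle_trans with (1 := H1). rewrite Rmult_assoc.
  apply Rle_trans with (Rabs K * Rabs (g s)).
  - apply Rmult_le_compat_r; [apply Rabs_pos|apply Rle_abs].
  - apply Rmult_le_compat_l; [apply Rabs_pos|exact H2].
Qed.

Lemma bigO_plus (n : nat) (g h : R -> R) :
  bigO n g -> bigO n h -> bigO n (fun s => g s + h s).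
Proof.
  intros [K [HK Hg]] [L [HL Hh]]. exists (K + L). split; [lra|].
  generalize (filter_and _ _ Hg Hh). apply filter_imp. intros s [H1 H2].
  generalize (Rabs_triang (g s) (h s)). lra.
Qed.

Lemma bigO_scal (n : nat) (c : R) (h : R -> R) :
  bigO n h -> bigO n (fun s => c * h s).
Proof.
  apply bigO_dom with (K := Rabs c). apply filter_forall. intros s.
  rewrite Rabs_mult. lra.
Qed.

Lemma bigO_minus (n : nat) (g h : R -> R) :
  bigO n g -> bigO n h -> bigO n (fun s => g s - h s).
Proof.
  intros Hg Hh. apply bigO_ext_all with (fun s => g s + (-1) * h s).
  - intros s. ring.
  - apply bigO_plus; [exact Hg|]. apply bigO_scal, Hh.
Qed.

Lemma bigO_mult (m n : nat) (g h : R -> R) :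
  bigO m g -> bigO n h -> bigO (m + n) (fun s => g s * h s).
Proof.
  intros [K [HK Hg]] [L [HL Hh]]. exists (K * L). split; [apply Rmult_le_pos; assumption|].
  generalize (filter_and _ _ Hg Hh). apply filter_imp. intros s [H1 H2].
  rewrite Rabs_mult, pow_add.
  replace (K * L * (s ^ m * s ^ n)) with ((K * s ^ m) * (L * s ^ n)) by ring.
  apply Rmult_le_compat; try apply Rabs_pos; assumption.
Qed.

Lemma pow_le_pow_lt1 (s : R) (m n : nat) :
  0 <= s <= 1 -> (n <= m)%nat -> s ^ m <= s ^ n.
Proof.
  intros Hs Hmn. replace m with (n + (m - n))%nat by lia. rewrite pow_add.
  rewrite <- (Rmult_1_r (s ^ n)) at 2.
  apply Rmult_le_compat_l; [apply pow_le; lra|].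
  rewrite <- (pow1 (m - n)). apply pow_incr. lra.
Qed.

Lemma bigO_le (m n : nat) (h : R -> R) :
  (n <= m)%nat -> bigO m h -> bigO n h.
Proof.
  intros Hnm [K [HK Hh]]. exists K. split; [exact HK|].
  generalize (filter_and _ _ Hh (at_right0_lt 1 Rlt_0_1)). apply filter_imp.
  intros s [H1 H2]. apply Rle_trans with (1 := H1).
  apply Rmult_le_compat_l; [exact HK|]. apply pow_le_pow_lt1; [lra|exact Hnm].
Qed.

Lemma bigO_pow (n : nat) : bigO n (fun s => s ^ n).
Proof.
  exists 1. split; [lra|]. generalize (at_right0_lt 1 Rlt_0_1). apply filter_imp.
  intros s Hs. rewrite Rabs_pos_eq; [lra|]. apply pow_le. lra.
Qed.

Lemma bigO_const (c : R) : bigO 0 (fun _ => c).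
Proof.
  exists (Rabs c). split; [apply Rabs_pos|]. apply filter_forall. intros s. simpl. lra.
Qed.

Lemma bigO_zero (n : nat) : bigO n (fun _ => 0).
Proof.
  exists 0. split; [lra|]. apply filter_forall. intros s. rewrite Rabs_R0. lra.
Qed.

Lemma bigO_id : bigO 1 (fun s => s).
Proof. apply bigO_ext_all with (2 := bigO_pow 1). intros s. ring. Qed.

(** A Taylor polynomial of degree [N - 1] with remainder [O(s ^ N)], peeled off
    one coefficient at a time: closure under sums and products is then a plain
    induction, without derivatives or convolutions. *)
Fixpoint expandable (N : nat) (h : R -> R) : Prop :=
  match N with
  | O => bigO 0 h
  | S N => exists c g, at_right 0 (fun s => h s = c + s * g s) /\ expandable N g
  end.

Lemma expandable_ext (N : nat) (g h : R -> R) :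
  at_right 0 (fun s => g s = h s) -> expandable N g -> expandable N h.
Proof.
  destruct N as [|N]; simpl.
  - apply bigO_ext.
  - intros Hgh [c [g1 [H1 H2]]]. exists c, g1. split; [|exact H2].
    generalize (filter_and _ _ Hgh H1). apply filter_imp. intros s [<- Hs]. exact Hs.
Qed.

Lemma expandable_ext_all (N : nat) (g h : R -> R) :
  (forall s, g s = h s) -> expandable N g -> expandable N h.
Proof. intros Hgh. apply expandable_ext. apply filter_forall. exact Hgh. Qed.

Lemma expandable_pred (N : nat) (h : R -> R) : expandable (S N) h -> expandable N h.
Proof.
  revert h. induction N as [|N IH]; intros h [c [g [H1 H2]]].
  - simpl in *. apply bigO_ext with (fun s => c + s * g s).
    + revert H1. apply filter_imp. intros s ->. reflexivity.
    + apply bigO_plus; [apply bigO_const|].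
      apply bigO_le with 1%nat; [lia|]. exact (bigO_mult 1 0 _ _ bigO_id H2).
  - exists c, g. split; [exact H1|]. apply IH, H2.
Qed.

Lemma expandable_bigO0 (N : nat) (h : R -> R) : expandable N h -> bigO 0 h.
Proof. revert h; induction N as [|N IH]; intros h H; [exact H|apply IH, expandable_pred, H]. Qed.

Lemma expandable_of_bigO (N : nat) (h : R -> R) : bigO N h -> expandable N h.
Proof.
  revert h. induction N as [|N IH]; intros h Hh; [exact Hh|].
  exists 0, (fun s => / s * h s). split.
  - generalize (at_right0_lt 1 Rlt_0_1). apply filter_imp. intros s Hs. field. lra.
  - apply IH. destruct Hh as [K [HK Hh]]. exists K. split; [exact HK|].
    generalize (filter_and _ _ Hh (at_right0_lt 1 Rlt_0_1)). apply filter_imp.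
    intros s [H1 H2]. rewrite Rabs_mult, (Rabs_pos_eq (/ s));
      [|apply Rlt_le, Rinv_0_lt_compat; lra].
    apply Rmult_le_reg_l with s; [lra|]. rewrite <- Rmult_assoc, Rinv_r by lra.
    simpl in H1. lra.
Qed.

Lemma expandable_plus (N : nat) (g h : R -> R) :
  expandable N g -> expandable N h -> expandable N (fun s => g s + h s).
Proof.
  revert g h. induction N as [|N IH]; intros g h Hg Hh; [apply bigO_plus; assumption|].
  destruct Hg as [c [g1 [Hg1 Hg2]]], Hh as [d [h1 [Hh1 Hh2]]].
  exists (c + d), (fun s => g1 s + h1 s). split; [|apply IH; assumption].
  generalize (filter_and _ _ Hg1 Hh1). apply filter_imp. intros s [-> ->]. ring.
Qed.

Lemma expandable_scal (N : nat) (c : R) (h : R -> R) :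
  expandable N h -> expandable N (fun s => c * h s).
Proof.
  revert h. induction N as [|N IH]; intros h Hh; [apply bigO_scal; assumption|].
  destruct Hh as [d [h1 [Hh1 Hh2]]].
  exists (c * d), (fun s => c * h1 s). split; [|apply IH; assumption].
  revert Hh1. apply filter_imp. intros s ->. ring.
Qed.

Lemma expandable_minus (N : nat) (g h : R -> R) :
  expandable N g -> expandable N h -> expandable N (fun s => g s - h s).
Proof.
  intros Hg Hh. apply expandable_ext_all with (fun s => g s + (-1) * h s).
  - intros s. ring.
  - apply expandable_plus; [exact Hg|]. apply expandable_scal, Hh.
Qed.

Lemma expandable_const (N : nat) (c : R) : expandable N (fun _ => c).
Proof.
  revert c. induction N as [|N IH]; intros c; [apply bigO_const|].
  exists c, (fun _ => 0). split; [|apply IH]. apply filter_forall. intros s. ring.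
Qed.

Lemma expandable_shift (N : nat) (h : R -> R) :
  expandable N h -> expandable (S N) (fun s => s * h s).
Proof.
  intros Hh. exists 0, h. split; [|exact Hh]. apply filter_forall. intros s. ring.
Qed.

Lemma expandable_mult (N : nat) (g h : R -> R) :
  expandable N g -> expandable N h -> expandable N (fun s => g s * h s).
Proof.
  revert g h. induction N as [|N IH]; intros g h Hg Hh.
  - exact (bigO_mult 0 0 _ _ Hg Hh).
  - pose proof (expandable_pred _ _ Hh) as Hh0.
    destruct Hg as [c [g1 [Hg1 Hg2]]], Hh as [d [h1 [Hh1 Hh2]]].
    exists (c * d), (fun s => c * h1 s + g1 s * h s). split.
    + generalize (filter_and _ _ Hg1 Hh1). apply filter_imp. intros s [-> E].
      rewrite E. ring.
    + apply expandable_plus; [apply expandable_scal, Hh2|]. apply IH; assumption.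
Qed.

Lemma expandable_id (N : nat) : expandable N (fun s => s).
Proof.
  apply expandable_pred.
  apply expandable_ext_all with (2 := expandable_shift N _ (expandable_const N 1)).
  intros s. ring.
Qed.

Lemma expandable_pow (N n : nat) (h : R -> R) :
  expandable N h -> expandable N (fun s => h s ^ n).
Proof.
  intros Hh. induction n as [|n IH]; simpl.
  - apply expandable_const.
  - apply expandable_mult; assumption.
Qed.

Lemma expandable_sum (N M : nat) (h : nat -> R -> R) :
  (forall k, (k <= M)%nat -> expandable N (h k)) ->
  expandable N (fun s => sum_f_R0 (fun k => h k s) M).
Proof.
  induction M as [|M IH]; intros H; simpl.
  - apply H. lia.
  - apply expandable_plus; [apply IH; intros k Hk; apply H; lia|apply H; lia].
Qed.

Lemma bigO1_const_zero (c : R) (g : R -> R) :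
  bigO 0 g -> bigO 1 (fun s => c + s * g s) -> c = 0.
Proof.
  intros Hg H.
  assert (Hc : bigO 1 (fun _ => c)).
  { apply bigO_ext_all with (fun s => (c + s * g s) - s * g s); [intros; ring|].
    apply bigO_minus; [exact H|]. exact (bigO_mult 1 0 _ _ bigO_id Hg). }
  destruct Hc as [K [HK Hc]]. apply at_right0_iff in Hc. destruct Hc as [d [Hd Hc]].
  apply Rabs_eq_0. apply Rle_antisym; [|apply Rabs_pos].
  apply Rnot_lt_le. intros Hpos.
  set (s := Rmin (d / 2) (Rabs c / (2 * (K + 1)))).
  assert (0 < Rabs c / (2 * (K + 1))) by (apply Rdiv_lt_0_compat; lra).
  assert (Hs : 0 < s < d).
  { unfold s. split; [apply Rmin_glb_lt; lra|].
    apply Rle_lt_trans with (1 := Rmin_l _ _). lra. }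
  specialize (Hc s Hs). rewrite pow_1 in Hc.
  assert (Hs2 : s <= Rabs c / (2 * (K + 1))) by apply Rmin_r.
  assert ((K + 1) * s <= Rabs c / 2).
  { apply Rle_trans with ((K + 1) * (Rabs c / (2 * (K + 1)))).
    - apply Rmult_le_compat_l; lra.
    - right. field. lra. }
  nra.
Qed.

(** The coefficients below [N] vanish because [h] is already [O(s ^ N)]. *)
Lemma expandable_leading (N : nat) (h : R -> R) :
  expandable (S N) h -> bigO N h -> exists c, bigO (S N) (fun s => h s - c * s ^ N).
Proof.
  revert h. induction N as [|N IH]; intros h [c [g [H1 H2]]] Hh.
  - exists c. apply bigO_ext with (fun s => s * g s).
    + revert H1. apply filter_imp. intros s ->. simpl. ring.
    + exact (bigO_mult 1 0 _ _ bigO_id H2).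
  - assert (c = 0).
    { apply bigO1_const_zero with g.
      - apply expandable_bigO0 with (1 := H2).
      - apply bigO_ext with h; [exact H1|]. apply bigO_le with (S N); [lia|exact Hh]. }
    subst c.
    destruct (IH g H2) as [c Hc].
    { destruct Hh as [K [HK Hh]]. exists K. split; [exact HK|].
      generalize (filter_and _ _ (at_right0_lt 1 Rlt_0_1) (filter_and _ _ H1 Hh)).
      apply filter_imp. intros s [Hs [E Hb]]. rewrite E in Hb.
      rewrite Rplus_0_l, Rabs_mult, (Rabs_pos_eq s) in Hb by lra.
      simpl in Hb. apply Rmult_le_reg_l with s; [lra|]. lra. }
    exists c. apply bigO_ext with (fun s => s * (g s - c * s ^ N)).
    + revert H1. apply filter_imp. intros s ->. simpl. ring.
    + exact (bigO_mult 1 (S N) _ _ bigO_id Hc).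
Qed.

Definition horner (l : list R) (s : R) : R := fold_right (fun c acc => c + s * acc) 0 l.

Lemma expandable_poly (N : nat) (h : R -> R) :
  expandable N h -> exists l, bigO N (fun s => h s - horner l s).
Proof.
  revert h. induction N as [|N IH]; intros h Hh.
  - exists nil. apply bigO_ext_all with h; [|exact Hh]. intros s. simpl. ring.
  - destruct Hh as [c [g [H1 H2]]]. destruct (IH g H2) as [l Hl].
    exists (c :: l). apply bigO_ext with (fun s => s * (g s - horner l s)).
    + revert H1. apply filter_imp. intros s ->. simpl. ring.
    + exact (bigO_mult 1 N _ _ bigO_id Hl).
Qed.

Lemma horner_bounded (l : list R) : exists K, forall s, 0 <= s <= 1 -> Rabs (horner l s) <= K.
Proof.
  induction l as [|c l [K IH]]; simpl.
  - exists 0. intros s _. rewrite Rabs_R0. lra.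
  - exists (Rabs c + K). intros s Hs. specialize (IH s Hs).
    apply Rle_trans with (1 := Rabs_triang _ _). apply Rplus_le_compat_l.
    rewrite Rabs_mult, (Rabs_pos_eq s) by lra.
    generalize (Rabs_pos (horner l s)). nra.
Qed.

(** Rates of change of coefficient functions are needed below, and an expansion
    carries no information on derivatives; polynomials do. *)
Lemma horner_derive (l : list R) :
  exists dl, (forall s, is_derive (horner l) s (dl s)) /\
    exists K, forall s, 0 <= s <= 1 -> Rabs (dl s) <= K.
Proof.
  induction l as [|c l [dl [H1 [K H2]]]].
  - exists (fun _ => 0). split.
    + intros s. apply is_derive_ext with (fun _ => 0); [reflexivity|]. apply @is_derive_const.
    + exists 0. intros s _. rewrite Rabs_R0. lra.
  - exists (fun s => horner l s + s * dl s). split.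
    + intros s. apply is_derive_ext with (fun s => c + s * horner l s); [reflexivity|].
      specialize (H1 s). auto_derive.
      * exists (dl s). exact H1.
      * replace (Derive (fun x => horner l x) s) with (dl s)
          by (symmetry; apply is_derive_unique, H1). ring.
    + destruct (horner_bounded l) as [L HL]. exists (L + K). intros s Hs.
      specialize (H2 s Hs). specialize (HL s Hs).
      apply Rle_trans with (1 := Rabs_triang _ _). apply Rplus_le_compat; [exact HL|].
      rewrite Rabs_mult, (Rabs_pos_eq s) by lra.
      generalize (Rabs_pos (dl s)). nra.
Qed.

Lemma horner_0 (l : list R) : bigO 1 (fun s => horner l s - horner l 0).
Proof.
  destruct l as [|c l].
  - apply bigO_ext_all with (2 := bigO_zero 1). intros s. simpl. ring.
  - apply bigO_ext_all with (fun s => s * horner l s).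
    + intros s. simpl. ring.
    + apply (bigO_mult 1 0); [apply bigO_id|].
      destruct (horner_bounded l) as [K HK]. exists (Rabs K). split; [apply Rabs_pos|].
      generalize (at_right0_lt 1 Rlt_0_1). apply filter_imp. intros s Hs.
      simpl. rewrite Rmult_1_r. apply Rle_trans with (2 := Rle_abs _). apply HK. lra.
Qed.

(** A nonzero coefficient of degree below [N] decides the sign for small [s] and
    beats every multiple of [s ^ N]; without one, [h] itself is [O(s ^ N)]. *)
Lemma expandable_dichotomy (N : nat) (h : R -> R) :
  expandable N h ->
  (exists C, 0 <= C /\ at_right 0 (fun s => - C * s ^ N <= h s)) \/
  (forall B, at_right 0 (fun s => h s <= - B * s ^ N)).
Proof.
  revert h. induction N as [|N IH]; intros h Hh.
  - left. destruct Hh as [K [HK Hh]]. exists K. split; [exact HK|].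
    revert Hh. apply filter_imp. intros s Hs. apply Rabs_le_between in Hs. lra.
  - destruct Hh as [c [g [H1 H2]]].
    destruct (expandable_bigO0 _ _ H2) as [K [HK Hg]].
    destruct (Rtotal_order c 0) as [Hc|[Hc|Hc]].
    + right. intros B.
      assert (Hd : 0 < - c / (K + Rabs B + 1)).
      { apply Rdiv_lt_0_compat; [lra|]. generalize (Rabs_pos B). lra. }
      generalize (filter_and _ _ (filter_and _ _ H1 Hg)
        (filter_and _ _ (at_right0_lt 1 Rlt_0_1) (at_right0_lt _ Hd))).
      apply filter_imp. intros s [[-> Hb] [Hs1 [Hs2 Hs3]]].
      apply Rabs_le_between in Hb. rewrite pow_O, Rmult_1_r in Hb.
      assert (s * (K + Rabs B + 1) <= - c).
      { apply Rle_trans with (- c / (K + Rabs B + 1) * (K + Rabs B + 1)).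
        - apply Rmult_le_compat_r; [generalize (Rabs_pos B); lra|lra].
        - right. field. generalize (Rabs_pos B). lra. }
      assert (0 <= s ^ S N <= s).
      { split; [apply pow_le; lra|]. rewrite <- (pow_1 s) at 2.
        apply pow_le_pow_lt1; [lra|lia]. }
      generalize (Rle_abs B) (Rabs_pos B); intros. nra.
    + subst c. destruct (IH g H2) as [[C [HC HL]]|HS].
      * left. exists C. split; [exact HC|].
        generalize (filter_and _ _ (at_right0_lt 1 Rlt_0_1) (filter_and _ _ H1 HL)).
        apply filter_imp. intros s [Hs [-> Hb]]. simpl. nra.
      * right. intros B.
        generalize (filter_and _ _ (at_right0_lt 1 Rlt_0_1) (filter_and _ _ H1 (HS B))).
        apply filter_imp. intros s [Hs [-> Hb]]. simpl. nra.
    + left. exists 0. split; [lra|].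
      assert (Hd : 0 < c / (K + 1)) by (apply Rdiv_lt_0_compat; lra).
      generalize (filter_and _ _ (filter_and _ _ H1 Hg) (at_right0_lt _ Hd)).
      apply filter_imp. intros s [[-> Hb] [Hs2 Hs3]].
      apply Rabs_le_between in Hb. rewrite pow_O, Rmult_1_r in Hb.
      assert (s * (K + 1) <= c).
      { apply Rle_trans with (c / (K + 1) * (K + 1)).
        - apply Rmult_le_compat_r; lra.
        - right. field. lra. }
      nra.
Qed.

(** * Smooth functions near a point *)


Lemma mean_value (f df : R -> R) (a b : R) :
  (forall c, Rmin a b <= c <= Rmax a b -> is_derive f c (df c)) ->
  exists c, Rmin a b <= c <= Rmax a b /\ f b - f a = df c * (b - a).
Proof.
  intros H. apply MVT_gen.
  - intros c Hc. apply H. lra.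
  - intros c Hc. apply continuity_pt_filterlim.
    apply (ex_derive_continuous f c). exists (df c). apply H, Hc.
Qed.

Lemma mean_value_2d (f : R -> R -> R) (x1 y1 x2 y2 : R) :
  (forall x y, ex_derive (fun z => f z y) x) ->
  (forall x y, ex_derive (fun z => f x z) y) ->
  exists c1 c2, Rmin x1 x2 <= c1 <= Rmax x1 x2 /\ Rmin y1 y2 <= c2 <= Rmax y1 y2 /\
    f x2 y2 - f x1 y1 =
      Derive (fun z => f z y1) c1 * (x2 - x1) + Derive (fun z => f x2 z) c2 * (y2 - y1).
Proof.
  intros Hx Hy.
  destruct (mean_value (fun z => f z y1) (Derive (fun z => f z y1)) x1 x2) as [c1 [H1 E1]].
  { intros c _. apply Derive_correct, Hx. }
  destruct (mean_value (fun z => f x2 z) (Derive (fun z => f x2 z)) y1 y2) as [c2 [H2 E2]].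
  { intros c _. apply Derive_correct, Hy. }
  exists c1, c2. split; [exact H1|split; [exact H2|]]. simpl in E1, E2. lra.
Qed.

Definition pd1 (f : R -> R -> R) (x y : R) : R := Derive (fun z => f z y) x.
Definition pd2 (f : R -> R -> R) (x y : R) : R := Derive (fun z => f x z) y.

Lemma smooth2_pd1 (f : R -> R -> R) : smooth2 f -> smooth2 (pd1 f).
Proof. intros Hf n x y. exact (proj1 (proj2 (proj2 (proj2 (Hf (S n) x y))))). Qed.

Lemma smooth2_pd2 (f : R -> R -> R) : smooth2 f -> smooth2 (pd2 f).
Proof. intros Hf n x y. exact (proj2 (proj2 (proj2 (proj2 (Hf (S n) x y))))). Qed.

Lemma smooth2_ex1 (f : R -> R -> R) (x y : R) : smooth2 f -> ex_derive (fun z => f z y) x.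
Proof. intros Hf. exact (proj1 (proj2 (Hf 1%nat x y))). Qed.

Lemma smooth2_ex2 (f : R -> R -> R) (x y : R) : smooth2 f -> ex_derive (fun z => f x z) y.
Proof. intros Hf. exact (proj1 (proj2 (proj2 (Hf 1%nat x y)))). Qed.

Definition near (a b r x y : R) : Prop := Rabs (x - a) < r /\ Rabs (y - b) < r.

Lemma between_near (a r x1 x2 c : R) :
  Rabs (x1 - a) < r -> Rabs (x2 - a) < r -> Rmin x1 x2 <= c <= Rmax x1 x2 ->
  Rabs (c - a) < r.
Proof.
  intros H1 H2 Hc. apply Rabs_def2 in H1. apply Rabs_def2 in H2.
  revert Hc. unfold Rmin, Rmax. destruct (Rle_dec x1 x2); intros Hc; apply Rabs_def1; lra.
Qed.

Lemma between_dist (x0 x1 x2 c : R) :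
  Rmin x1 x2 <= c <= Rmax x1 x2 -> Rabs (c - x0) <= Rabs (x1 - x0) + Rabs (x2 - x0).
Proof.
  unfold Rmin, Rmax, Rabs. intros Hc.
  destruct (Rle_dec x1 x2), (Rcase_abs (c - x0)), (Rcase_abs (x1 - x0)), (Rcase_abs (x2 - x0)); lra.
Qed.

Lemma smooth2_bounded (f : R -> R -> R) (a b : R) :
  smooth2 f -> exists r K, 0 < r /\ 0 <= K /\ forall x y, near a b r x y -> Rabs (f x y) <= K.
Proof.
  intros Hf. destruct (Hf O a b) as [Hc _].
  destruct (Hc (mkposreal 1 Rlt_0_1)) as [r Hr]. simpl in Hr.
  exists r, (Rabs (f a b) + 1). split; [apply cond_pos|]. split; [generalize (Rabs_pos (f a b)); lra|].
  intros x y [Hx Hy]. specialize (Hr x y Hx Hy).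
  replace (f x y) with (f a b + (f x y - f a b)) by ring.
  apply Rle_trans with (1 := Rabs_triang _ _). lra.
Qed.

Lemma smooth2_lipschitz (f : R -> R -> R) (a b : R) :
  smooth2 f -> exists r K, 0 < r /\ 0 <= K /\ forall x1 y1 x2 y2,
    near a b r x1 y1 -> near a b r x2 y2 ->
    Rabs (f x2 y2 - f x1 y1) <= K * (Rabs (x2 - x1) + Rabs (y2 - y1)).
Proof.
  intros Hf.
  destruct (smooth2_bounded _ a b (smooth2_pd1 _ Hf)) as [r1 [K1 [Hr1 [HK1 H1]]]].
  destruct (smooth2_bounded _ a b (smooth2_pd2 _ Hf)) as [r2 [K2 [Hr2 [HK2 H2]]]].
  exists (Rmin r1 r2), (K1 + K2). split; [apply Rmin_glb_lt; assumption|]. split; [lra|].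
  intros x1 y1 x2 y2 [A1 A2] [B1 B2].
  assert (M1 := Rmin_l r1 r2). assert (M2 := Rmin_r r1 r2).
  destruct (mean_value_2d f x1 y1 x2 y2) as [c1 [c2 [C1 [C2 E]]]].
  { intros; apply smooth2_ex1, Hf. } { intros; apply smooth2_ex2, Hf. }
  rewrite E. apply Rle_trans with (1 := Rabs_triang _ _). rewrite !Rabs_mult.
  assert (Rabs (Derive (fun z => f z y1) c1) <= K1).
  { apply H1. split; [apply between_near with x1 x2; lra|lra]. }
  assert (Rabs (Derive (fun z => f x2 z) c2) <= K2).
  { apply H2. split; [lra|apply between_near with y1 y2; lra]. }
  generalize (Rabs_pos (x2 - x1)) (Rabs_pos (y2 - y1)). intros. nra.
Qed.

(** The point [(x0, y0)] at which the linear part is taken need not be an end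
    of the segment: along a family of solutions it is a fixed approximate one. *)
Lemma smooth2_linear (f : R -> R -> R) (a b : R) :
  smooth2 f -> exists r K, 0 < r /\ 0 <= K /\ forall x0 y0 x1 y1 x2 y2,
    near a b r x0 y0 -> near a b r x1 y1 -> near a b r x2 y2 ->
    Rabs (f x2 y2 - f x1 y1 - pd1 f x0 y0 * (x2 - x1) - pd2 f x0 y0 * (y2 - y1)) <=
      K * (Rabs (x1 - x0) + Rabs (y1 - y0) + Rabs (x2 - x0) + Rabs (y2 - y0)) *
      (Rabs (x2 - x1) + Rabs (y2 - y1)).
Proof.
  intros Hf.
  destruct (smooth2_lipschitz _ a b (smooth2_pd1 _ Hf)) as [r1 [K1 [Hr1 [HK1 H1]]]].
  destruct (smooth2_lipschitz _ a b (smooth2_pd2 _ Hf)) as [r2 [K2 [Hr2 [HK2 H2]]]].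
  exists (Rmin r1 r2), (K1 + K2). split; [apply Rmin_glb_lt; assumption|]. split; [lra|].
  intros x0 y0 x1 y1 x2 y2 [Z1 Z2] [A1 A2] [B1 B2].
  assert (M1 := Rmin_l r1 r2). assert (M2 := Rmin_r r1 r2).
  destruct (mean_value_2d f x1 y1 x2 y2) as [c1 [c2 [C1 [C2 E]]]].
  { intros; apply smooth2_ex1, Hf. } { intros; apply smooth2_ex2, Hf. }
  rewrite E.
  change (Derive (fun z => f z y1) c1) with (pd1 f c1 y1).
  change (Derive (fun z => f x2 z) c2) with (pd2 f x2 c2).
  replace (pd1 f c1 y1 * (x2 - x1) + pd2 f x2 c2 * (y2 - y1) - pd1 f x0 y0 * (x2 - x1) -
      pd2 f x0 y0 * (y2 - y1)) with
    ((pd1 f c1 y1 - pd1 f x0 y0) * (x2 - x1) + (pd2 f x2 c2 - pd2 f x0 y0) * (y2 - y1)) by ring.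
  apply Rle_trans with (1 := Rabs_triang _ _). rewrite !Rabs_mult.
  assert (E1 : Rabs (pd1 f c1 y1 - pd1 f x0 y0) <= K1 * (Rabs (c1 - x0) + Rabs (y1 - y0))).
  { apply H1; split; try lra. apply between_near with x1 x2; lra. }
  assert (E2 : Rabs (pd2 f x2 c2 - pd2 f x0 y0) <= K2 * (Rabs (x2 - x0) + Rabs (c2 - y0))).
  { apply H2; split; try lra. apply between_near with y1 y2; lra. }
  generalize (between_dist x0 _ _ _ C1) (between_dist y0 _ _ _ C2). intros D1 D2.
  set (S := Rabs (x1 - x0) + Rabs (y1 - y0) + Rabs (x2 - x0) + Rabs (y2 - y0)).
  assert (P1 := Rabs_pos (x1 - x0)). assert (P2 := Rabs_pos (y1 - y0)).
  assert (P3 := Rabs_pos (x2 - x0)). assert (P4 := Rabs_pos (y2 - y0)).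
  assert (F1 : Rabs (pd1 f c1 y1 - pd1 f x0 y0) <= K1 * S).
  { apply Rle_trans with (1 := E1). apply Rmult_le_compat_l; [exact HK1|]. unfold S. lra. }
  assert (F2 : Rabs (pd2 f x2 c2 - pd2 f x0 y0) <= K2 * S).
  { apply Rle_trans with (1 := E2). apply Rmult_le_compat_l; [exact HK2|]. unfold S. lra. }
  assert (0 <= S) by nonneg.
  assert (0 <= K1 * S) by nonneg.
  assert (0 <= K2 * S) by nonneg.
  generalize (Rabs_pos (x2 - x1)) (Rabs_pos (y2 - y1)). intros Q1 Q2.
  apply Rle_trans with (K1 * S * Rabs (x2 - x1) + K2 * S * Rabs (y2 - y1)).
  - apply Rplus_le_compat; apply Rmult_le_compat_r; assumption.
  - assert (0 <= K2 * S * Rabs (x2 - x1)) by nonneg.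
    assert (0 <= K1 * S * Rabs (y2 - y1)) by nonneg. lra.
Qed.

Lemma bigO1_near (a b r : R) (X Y : R -> R) :
  0 < r -> bigO 1 (fun s => X s - a) -> bigO 1 (fun s => Y s - b) ->
  at_right 0 (fun s => near a b r (X s) (Y s)).
Proof.
  intros Hr [K [HK HX]] [L [HL HY]].
  assert (Hd : 0 < r / (K + L + 1)) by (apply Rdiv_lt_0_compat; lra).
  generalize (filter_and _ _ (filter_and _ _ HX HY) (at_right0_lt _ Hd)).
  apply filter_imp. intros s [[H1 H2] [H3 H4]]. rewrite pow_1 in *.
  assert (s * (K + L + 1) < r).
  { apply Rlt_le_trans with (r / (K + L + 1) * (K + L + 1)).
    - apply Rmult_lt_compat_r; lra.
    - right. field. lra. }
  split; nra.
Qed.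

Lemma smooth2_bigO (f : R -> R -> R) (a b : R) (n : nat) (X Y X' Y' : R -> R) :
  smooth2 f ->
  bigO 1 (fun s => X s - a) -> bigO 1 (fun s => Y s - b) ->
  bigO 1 (fun s => X' s - a) -> bigO 1 (fun s => Y' s - b) ->
  bigO n (fun s => X' s - X s) -> bigO n (fun s => Y' s - Y s) ->
  bigO n (fun s => f (X' s) (Y' s) - f (X s) (Y s)).
Proof.
  intros Hf HX HY HX' HY' [K1 [HK1 H1]] [K2 [HK2 H2]].
  destruct (smooth2_lipschitz f a b Hf) as [r [K [Hr [HK HL]]]].
  exists (K * (K1 + K2)). split; [apply Rmult_le_pos; lra|].
  generalize (filter_and _ _ (filter_and _ _ H1 H2)
    (filter_and _ _ (bigO1_near _ _ _ _ _ Hr HX HY) (bigO1_near _ _ _ _ _ Hr HX' HY'))).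
  apply filter_imp. intros s [[E1 E2] [N1 N2]].
  apply Rle_trans with (1 := HL _ _ _ _ N1 N2).
  rewrite Rmult_assoc. apply Rmult_le_compat_l; lra.
Qed.

(** Taylor's formula in two variables reduces the claim to polynomials in [X - a]
    and [Y - b]; its remainder is [O(s ^ (N + 1))] because both are [O(s)]. *)
Lemma expandable_comp (f : R -> R -> R) (a b : R) (N : nat) (X Y : R -> R) :
  smooth2 f ->
  bigO 1 (fun s => X s - a) -> bigO 1 (fun s => Y s - b) ->
  expandable N X -> expandable N Y -> expandable N (fun s => f (X s) (Y s)).
Proof.
  intros Hf HX HY EX EY.
  destruct (Taylor_Lagrange_2d f N a b) as [D HD].
  { exists (mkposreal 1 Rlt_0_1). intros. apply Hf. }
  apply expandable_ext_all with (fun s => DL_pol N f a b (X s - a) (Y s - b) +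
    (f (X s) (Y s) - DL_pol N f a b (X s - a) (Y s - b))); [intros; ring|].
  apply expandable_plus.
  - unfold DL_pol. apply expandable_sum. intros p _.
    apply expandable_ext_all with (fun s =>
      / INR (Factorial.fact p) * differential p f a b (X s - a) (Y s - b)).
    { intros s. field. apply INR_fact_neq_0. }
    apply expandable_scal. unfold differential. apply expandable_sum. intros m _.
    apply expandable_mult; [apply expandable_mult; [apply expandable_const|]|];
      apply expandable_pow; apply expandable_minus; try assumption; apply expandable_const.
  - apply expandable_of_bigO. destruct HD as [r HD].
    assert (HXY : bigO 1 (fun s => Rmax (Rabs (X s - a)) (Rabs (Y s - b)))).
    { destruct HX as [K [HK HX1]], HY as [L [HL HY1]]. exists (K + L). split; [lra|].
      generalize (filter_and _ _ (at_right0_lt 1 Rlt_0_1) (filter_and _ _ HX1 HY1)).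
      apply filter_imp. intros s [Hs [E1 E2]]. rewrite pow_1 in *.
      rewrite Rabs_pos_eq; [|apply Rle_trans with (2 := Rmax_l _ _), Rabs_pos].
      apply Rmax_lub; nra. }
    assert (HP : forall n, bigO n (fun s => Rmax (Rabs (X s - a)) (Rabs (Y s - b)) ^ n)).
    { intros n. induction n as [|n IH]; [exact (bigO_const 1)|exact (bigO_mult 1 n _ _ HXY IH)]. }
    apply bigO_le with (S N); [lia|].
    apply bigO_dom with (K := Rabs D) (2 := HP (S N)).
    generalize (bigO1_near a b r X Y (cond_pos r) HX HY). apply filter_imp.
    intros s [N1 N2]. apply Rle_trans with (1 := HD _ _ N1 N2).
    apply Rle_trans with (1 := Rle_abs _). rewrite Rabs_mult. lra.
Qed.

Lemma smooth2_of_fun1 (h : R -> R) :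
  (forall n x, ex_derive_n h n x) -> smooth2 (fun x _ => h x).
Proof.
  intros Hh n. revert h Hh.
  assert (H0 : forall n x y, ex_diff_n (fun _ _ => 0) n x y).
  { clear n. induction n as [|n IH]; intros x y; simpl.
    - split; [apply continuity_2d_pt_const|exact I].
    - split; [apply continuity_2d_pt_const|]. split; [apply ex_derive_const|].
      split; [apply ex_derive_const|].
      split; (apply ex_diff_n_ext_loc with (2 := IH x y);
        exists (mkposreal 1 Rlt_0_1); intros; symmetry; apply Derive_const). }
  assert (Hc : forall h, (forall n x, ex_derive_n h n x) -> forall x y,
    continuity_2d_pt (fun x _ => h x) x y).
  { intros h Hh x y.
    apply (continuity_1d_2d_pt_comp h (fun u _ => u)); [|apply continuity_2d_pt_id1].
    apply continuity_pt_filterlim. apply (ex_derive_continuous h x). exact (Hh 1%nat x). }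
  induction n as [|n IH]; intros h Hh x y; simpl.
  - split; [apply Hc, Hh|exact I].
  - split; [apply Hc, Hh|]. split; [exact (Hh 1%nat x)|]. split; [apply ex_derive_const|].
    split.
    + apply (IH (Derive h)). intros m z. destruct m as [|m]; [exact I|].
      generalize (Hh (S (S m)) z). apply ex_derive_ext. intros u.
      generalize (Derive_n_comp h m 1 u). simpl. intros E. symmetry.
      replace (Derive_n (Derive h) m u) with (Derive_n (Derive_n h 1) m u) by reflexivity.
      rewrite Derive_n_comp. replace (m + 1)%nat with (S m) by lia. reflexivity.
    + apply ex_diff_n_ext_loc with (2 := H0 n x y).
      exists (mkposreal 1 Rlt_0_1). intros. symmetry. apply Derive_const.
Qed.

Lemma smooth2_snd : smooth2 (fun _ y => y).
Proof.
  assert (H0 : forall c n x y, ex_diff_n (fun _ _ => c) n x y).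
  { intros c n x y. apply (smooth2_of_fun1 (fun _ => c)). clear. intros n x.
    destruct n as [|n]; [exact I|]. simpl. apply ex_derive_ext with (fun _ => Derive_n (fun _ => c) n 0).
    - intros t. destruct n; [reflexivity|]. rewrite !Derive_n_const. reflexivity.
    - apply ex_derive_const. }
  intros [|n] x y; simpl.
  - split; [apply continuity_2d_pt_id2|exact I].
  - split; [apply continuity_2d_pt_id2|]. split; [apply ex_derive_const|].
    split; [apply ex_derive_id|]. split.
    + apply ex_diff_n_ext_loc with (2 := H0 0 n x y).
      exists (mkposreal 1 Rlt_0_1). intros. symmetry. apply Derive_const.
    + apply ex_diff_n_ext_loc with (2 := H0 1 n x y).
      exists (mkposreal 1 Rlt_0_1). intros. symmetry. apply Derive_id.
Qed.

(** * The formal series solution *)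


Definition psum (a : nat -> R) (M : nat) (s : R) : R := sum_n_m (fun k => s ^ k * a k) 1 M.

(** The time derivative of [psum a M] at [s = t ^ (-1/q)]: differentiation in [t]
    costs [q] powers of [s]. *)
Definition dsum (q : nat) (a : nat -> R) (M : nat) (s : R) : R :=
  sum_n_m (fun k => - (INR k / INR q) * s ^ (k + q) * a k) 1 M.

Definition truncation (Phi : nat -> R -> R -> R) (M : nat) (x y s : R) : R :=
  sum_f_R0 (fun k => s ^ k * Phi k x y) M.

Lemma sum_n_m_1_0 (u : nat -> R) : sum_n_m u 1 0 = 0.
Proof. exact (@sum_n_m_zero R_AbelianMonoid u 1 0 ltac:(lia)). Qed.

Lemma sum_n_m_1_S (u : nat -> R) (M : nat) : sum_n_m u 1 (S M) = sum_n_m u 1 M + u (S M).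
Proof. rewrite sum_n_Sm by lia. reflexivity. Qed.

Lemma sum_n_m_1_ext (u v : nat -> R) (M : nat) :
  (forall k, (1 <= k <= M)%nat -> u k = v k) -> sum_n_m u 1 M = sum_n_m v 1 M.
Proof.
  induction M as [|M IH]; intros H; [rewrite !sum_n_m_1_0; reflexivity|].
  rewrite !sum_n_m_1_S, IH, H; [reflexivity|lia|intros; apply H; lia].
Qed.

Lemma expandable_psum (N M : nat) (a : nat -> R) : expandable N (psum a M).
Proof.
  unfold psum. induction M as [|M IH].
  - apply expandable_ext_all with (fun _ => 0); [|apply expandable_const].
    intros s. rewrite sum_n_m_1_0. reflexivity.
  - apply expandable_ext_all with
      (fun s => sum_n_m (fun k => s ^ k * a k) 1 M + s ^ S M * a (S M)).
    + intros s. rewrite sum_n_m_1_S. reflexivity.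
    + apply expandable_plus; [exact IH|]. apply expandable_mult; [|apply expandable_const].
      apply expandable_pow with (h := fun s => s), expandable_id.
Qed.

Lemma expandable_dsum (q N M : nat) (a : nat -> R) : expandable N (dsum q a M).
Proof.
  unfold dsum. induction M as [|M IH].
  - apply expandable_ext_all with (fun _ => 0); [|apply expandable_const].
    intros s. rewrite sum_n_m_1_0. reflexivity.
  - apply expandable_ext_all with
      (fun s => sum_n_m (fun k => - (INR k / INR q) * s ^ (k + q) * a k) 1 M +
        - (INR (S M) / INR q) * s ^ (S M + q) * a (S M)).
    + intros s. rewrite sum_n_m_1_S. reflexivity.
    + apply expandable_plus; [exact IH|]. apply expandable_mult; [|apply expandable_const].
      apply expandable_scal. apply expandable_pow with (h := fun s => s), expandable_id.
Qed.

Lemma psum_tail (a : nat -> R) (M N : nat) :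
  (M <= N)%nat -> bigO (S M) (fun s => psum a N s - psum a M s).
Proof.
  induction 1 as [|N HN IH].
  - apply bigO_ext_all with (2 := bigO_zero _). intros s. ring.
  - apply bigO_ext_all with (fun s => (psum a N s - psum a M s) + a (S N) * s ^ S N).
    + intros s. unfold psum. rewrite (sum_n_m_1_S _ N). ring.
    + apply bigO_plus; [exact IH|]. apply bigO_scal. apply bigO_le with (S N); [lia|apply bigO_pow].
Qed.

Lemma psum_bigO1 (a : nat -> R) (M : nat) : bigO 1 (psum a M).
Proof.
  apply bigO_ext_all with (fun s => psum a M s - psum a 0 s).
  - intros s. unfold psum at 2. rewrite sum_n_m_1_0. ring.
  - apply psum_tail. lia.
Qed.

Lemma expandable_truncation (Phi : nat -> R -> R -> R) (a b : R) (N M : nat) (X Y : R -> R) :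
  (forall k, smooth2 (Phi k)) ->
  bigO 1 (fun s => X s - a) -> bigO 1 (fun s => Y s - b) ->
  expandable N X -> expandable N Y ->
  expandable N (fun s => truncation Phi M (X s) (Y s) s).
Proof.
  intros HPhi HX HY EX EY. unfold truncation.
  apply (expandable_sum N M (fun k s => s ^ k * Phi k (X s) (Y s))).
  intros k _. apply expandable_mult.
  - apply expandable_pow with (h := fun s => s), expandable_id.
  - apply expandable_comp with a b; auto.
Qed.

(** Only the leading field contributes to first order, since the [k]-th correction
    carries a factor [s ^ k]. *)
Lemma truncation_diff (Phi : nat -> R -> R -> R) (a b : R) (n M : nat) (X Y X' Y' : R -> R) :
  (forall k, smooth2 (Phi k)) ->
  bigO 1 (fun s => X s - a) -> bigO 1 (fun s => Y s - b) ->
  bigO 1 (fun s => X' s - a) -> bigO 1 (fun s => Y' s - b) ->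
  bigO n (fun s => X' s - X s) -> bigO n (fun s => Y' s - Y s) ->
  bigO (S n) (fun s => truncation Phi M (X' s) (Y' s) s - truncation Phi M (X s) (Y s) s -
    pd1 (Phi O) a b * (X' s - X s) - pd2 (Phi O) a b * (Y' s - Y s)).
Proof.
  intros HPhi HX HY HX' HY' HdX HdY. induction M as [|M IH].
  - apply bigO_ext_all with (fun s => Phi O (X' s) (Y' s) - Phi O (X s) (Y s) -
      pd1 (Phi O) a b * (X' s - X s) - pd2 (Phi O) a b * (Y' s - Y s)).
    { intros s. unfold truncation. simpl. ring. }
    destruct (smooth2_linear (Phi O) a b (HPhi O)) as [r [K [Hr [HK HL]]]].
    generalize (bigO1_near a b r X Y Hr HX HY) (bigO1_near a b r X' Y' Hr HX' HY').
    intros N1 N2.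
    assert (HA : forall k (h : R -> R), bigO k h -> bigO k (fun s => Rabs (h s))).
    { intros k h. apply bigO_dom with (K := 1). apply filter_forall. intros s.
      rewrite Rabs_Rabsolu. lra. }
    apply bigO_dom with (K := 1) (g := fun s =>
      K * ((Rabs (X s - a) + Rabs (Y s - b) + Rabs (X' s - a) + Rabs (Y' s - b)) *
      (Rabs (X' s - X s) + Rabs (Y' s - Y s)))).
    + generalize (filter_and _ _ N1 N2). apply filter_imp. intros s [E1 E2].
      assert (E0 : near a b r a b).
      { split; rewrite Rminus_diag, Rabs_R0; exact Hr. }
      apply Rle_trans with (1 := HL _ _ _ _ _ _ E0 E1 E2).
      rewrite Rmult_1_l. apply Rle_trans with (2 := Rle_abs _). lra.
    + apply bigO_scal. apply (bigO_mult 1 n); repeat apply bigO_plus; apply HA; assumption.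
  - apply bigO_ext_all with (fun s => (truncation Phi M (X' s) (Y' s) s -
      truncation Phi M (X s) (Y s) s -
      pd1 (Phi O) a b * (X' s - X s) - pd2 (Phi O) a b * (Y' s - Y s)) +
      s ^ S M * (Phi (S M) (X' s) (Y' s) - Phi (S M) (X s) (Y s))).
    { intros s. unfold truncation. rewrite !tech5. ring. }
    apply bigO_plus; [exact IH|]. apply bigO_le with (S M + n)%nat; [lia|].
    apply bigO_mult; [apply bigO_pow|]. apply smooth2_bigO with a b; auto.
Qed.

Lemma bigO1_shift (a : R) (X d : R -> R) :
  bigO 1 (fun s => X s - a) -> bigO 1 d -> bigO 1 (fun s => X s + d s - a).
Proof.
  intros HX Hd. apply bigO_ext_all with (fun s => (X s - a) + d s); [intros; ring|].
  apply bigO_plus; assumption.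
Qed.

(** One more coefficient of the formal solution: the coefficient of
    [s ^ (S M)] in the residuals is an affine function of the new pair, with
    linear part, up to sign, the Jacobian matrix at the equilibrium. *)
Lemma next_coefficients (Phi Gam : nat -> R -> R -> R) (a b kappa : R) (M : nat)
    (X Y DX DY : R -> R) :
  (forall k, smooth2 (Phi k)) -> (forall k, smooth2 (Gam k)) ->
  pd1 (Phi O) a b = 0 -> pd2 (Phi O) a b = 1 ->
  pd1 (Gam O) a b = - kappa -> pd2 (Gam O) a b = 0 -> kappa <> 0 ->
  bigO 1 (fun s => X s - a) -> bigO 1 (fun s => Y s - b) ->
  (forall N, expandable N X) -> (forall N, expandable N Y) ->
  (forall N, expandable N DX) -> (forall N, expandable N DY) ->
  bigO (S M) (fun s => DX s - truncation Phi M (X s) (Y s) s) ->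
  bigO (S M) (fun s => DY s - truncation Gam M (X s) (Y s) s) ->
  exists c d, forall DX' DY' : R -> R,
    bigO (S (S M)) (fun s => DX' s - DX s) -> bigO (S (S M)) (fun s => DY' s - DY s) ->
    bigO (S (S M)) (fun s => DX' s -
      truncation Phi (S M) (X s + s ^ S M * c) (Y s + s ^ S M * d) s) /\
    bigO (S (S M)) (fun s => DY' s -
      truncation Gam (S M) (X s + s ^ S M * c) (Y s + s ^ S M * d) s).
Proof.
  intros HPhi HGam J11 J12 J21 J22 Hk HX HY EX EY EDX EDY R1 R2.
  assert (Hlead : forall (Psi : nat -> R -> R -> R) (D : R -> R),
    (forall k, smooth2 (Psi k)) -> (forall N, expandable N D) ->
    bigO (S M) (fun s => D s - truncation Psi M (X s) (Y s) s) ->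
    exists c, bigO (S (S M)) (fun s =>
      D s - truncation Psi (S M) (X s) (Y s) s - c * s ^ S M)).
  { intros Psi D HPsi ED HR. apply expandable_leading.
    - apply expandable_minus; [apply ED|].
      apply expandable_truncation with a b; auto.
    - apply bigO_ext_all with (fun s => (D s - truncation Psi M (X s) (Y s) s) -
        s ^ S M * Psi (S M) (X s) (Y s)).
      { intros s. unfold truncation. rewrite tech5. ring. }
      apply bigO_minus; [exact HR|].
      apply bigO_le with (S M + 0)%nat; [lia|]. apply bigO_mult; [apply bigO_pow|].
      apply expandable_bigO0 with O. apply expandable_comp with a b; auto. }
  destruct (Hlead Phi DX HPhi EDX R1) as [c1 H1].
  destruct (Hlead Gam DY HGam EDY R2) as [c2 H2].
  assert (Hpow : forall e, bigO (S M) (fun s => s ^ S M * e)).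
  { intros e. apply bigO_ext_all with (fun s => e * s ^ S M); [intros; ring|].
    apply bigO_scal, bigO_pow. }
  assert (Hpow1 : forall e, bigO 1 (fun s => s ^ S M * e)).
  { intros e. apply bigO_le with (S M); [lia|apply Hpow]. }
  exists (- c2 / kappa), c1. intros DX' DY' HDX HDY.
  assert (Hdiff : forall Psi : nat -> R -> R -> R, (forall k, smooth2 (Psi k)) ->
    bigO (S (S M)) (fun s =>
      truncation Psi (S M) (X s + s ^ S M * (- c2 / kappa)) (Y s + s ^ S M * c1) s -
      truncation Psi (S M) (X s) (Y s) s -
      pd1 (Psi O) a b * (X s + s ^ S M * (- c2 / kappa) - X s) -
      pd2 (Psi O) a b * (Y s + s ^ S M * c1 - Y s))).
  { intros Psi HPsi.
    apply (truncation_diff Psi a b (S M) (S M) X Y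
      (fun s => X s + s ^ S M * (- c2 / kappa)) (fun s => Y s + s ^ S M * c1));
      try assumption; try (apply bigO1_shift; [assumption|apply Hpow1]).
    - apply bigO_ext_all with (2 := Hpow (- c2 / kappa)). intros s. ring.
    - apply bigO_ext_all with (2 := Hpow c1). intros s. ring. }
  split.
  - eapply bigO_ext_all; [|apply bigO_minus; [apply (bigO_plus _ _ _ HDX H1)|apply (Hdiff Phi HPhi)]].
    intros s. simpl. rewrite J11, J12. ring.
  - eapply bigO_ext_all; [|apply bigO_minus; [apply (bigO_plus _ _ _ HDY H2)|apply (Hdiff Gam HGam)]].
    intros s. simpl. rewrite J21, J22. field. exact Hk.
Qed.

Definition residual_bound (q : nat) (Phi Gam : nat -> R -> R -> R) (sg : R)
    (a b : nat -> R) (M : nat) : Prop :=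
  bigO (S M) (fun s => dsum q a M s - truncation Phi M (sg + psum a M s) (psum b M s) s) /\
  bigO (S M) (fun s => dsum q b M s - truncation Gam M (sg + psum a M s) (psum b M s) s).

Definition update (a : nat -> R) (n : nat) (c : R) (k : nat) : R :=
  if Nat.eqb k n then c else a k.

Lemma residual_step (q : nat) (Phi Gam : nat -> R -> R -> R) (sg kappa : R)
    (a b : nat -> R) (M : nat) :
  (0 < q)%nat ->
  (forall k, smooth2 (Phi k)) -> (forall k, smooth2 (Gam k)) ->
  pd1 (Phi O) sg 0 = 0 -> pd2 (Phi O) sg 0 = 1 ->
  pd1 (Gam O) sg 0 = - kappa -> pd2 (Gam O) sg 0 = 0 -> kappa <> 0 ->
  residual_bound q Phi Gam sg a b M ->
  exists p : R * R, residual_bound q Phi Gam sg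
    (update a (S M) (fst p)) (update b (S M) (snd p)) (S M).
Proof.
  intros Hq HPhi HGam J11 J12 J21 J22 Hk [R1 R2].
  destruct (next_coefficients Phi Gam sg 0 kappa M
    (fun s => sg + psum a M s) (psum b M) (dsum q a M) (dsum q b M)) as [c [d H]];
    try assumption.
  - apply bigO_ext_all with (2 := psum_bigO1 a M). intros s. ring.
  - apply bigO_ext_all with (2 := psum_bigO1 b M). intros s. ring.
  - intros N. apply expandable_plus; [apply expandable_const|apply expandable_psum].
  - intros N. apply expandable_psum.
  - intros N. apply expandable_dsum.
  - intros N. apply expandable_dsum.
  - exists (c, d). simpl.
    assert (Ep : forall (u : nat -> R) e s, psum (update u (S M) e) (S M) s = psum u M s + s ^ S M * e).
    { intros u e s. unfold psum. rewrite sum_n_m_1_S. f_equal.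
      - apply sum_n_m_1_ext. intros k Hk1. unfold update.
        replace (Nat.eqb k (S M)) with false; [reflexivity|]. symmetry. apply Nat.eqb_neq. lia.
      - unfold update. rewrite Nat.eqb_refl. reflexivity. }
    assert (Ed : forall (u : nat -> R) e s, dsum q (update u (S M) e) (S M) s - dsum q u M s =
      (- (INR (S M) / INR q) * e) * s ^ (S M + q)).
    { intros u e s. unfold dsum. rewrite sum_n_m_1_S.
      rewrite (sum_n_m_1_ext _ (fun k => - (INR k / INR q) * s ^ (k + q) * u k)).
      - unfold update. rewrite Nat.eqb_refl. ring.
      - intros k Hk1. unfold update.
        replace (Nat.eqb k (S M)) with false; [reflexivity|]. symmetry. apply Nat.eqb_neq. lia. }
    assert (Hd : forall (u : nat -> R) e,
      bigO (S (S M)) (fun s => dsum q (update u (S M) e) (S M) s - dsum q u M s)).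
    { intros u e. apply bigO_ext_all with (fun s => (- (INR (S M) / INR q) * e) * s ^ (S M + q)).
      - intros s. symmetry. apply Ed.
      - apply bigO_scal. apply bigO_le with (S M + q)%nat; [lia|apply bigO_pow]. }
    destruct (H _ _ (Hd a c) (Hd b d)) as [H1 H2]. split.
    + apply bigO_ext_all with (2 := H1). intros s. rewrite !Ep. rewrite Rplus_assoc. reflexivity.
    + apply bigO_ext_all with (2 := H2). intros s. rewrite !Ep. rewrite Rplus_assoc. reflexivity.
Qed.

(** Coefficients are chosen recursively and never revised, so all the partial sums
    come from one series. *)
Lemma formal_solution (q : nat) (Phi Gam : nat -> R -> R -> R) (sg kappa : R) :
  (0 < q)%nat ->
  (forall k, smooth2 (Phi k)) -> (forall k, smooth2 (Gam k)) ->
  Phi O sg 0 = 0 -> Gam O sg 0 = 0 ->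
  pd1 (Phi O) sg 0 = 0 -> pd2 (Phi O) sg 0 = 1 ->
  pd1 (Gam O) sg 0 = - kappa -> pd2 (Gam O) sg 0 = 0 -> kappa <> 0 ->
  exists a b, forall M, residual_bound q Phi Gam sg a b M.
Proof.
  intros Hq HPhi HGam Z1 Z2 J11 J12 J21 J22 Hk.
  set (P := fun M (u : (nat -> R) * (nat -> R)) => residual_bound q Phi Gam sg (fst u) (snd u) M).
  assert (Hstep : forall M u, exists p : R * R, P M u ->
    P (S M) (update (fst u) (S M) (fst p), update (snd u) (S M) (snd p))).
  { intros M u. destruct (classic (P M u)) as [H|H].
    - destruct (residual_step q Phi Gam sg kappa (fst u) (snd u) M) as [p Hp]; try assumption.
      exists p. intros _. exact Hp.
    - exists (0, 0). intros H1. contradiction. }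
  set (nxt := fun M u => proj1_sig (constructive_indefinite_description _ (Hstep M u))).
  set (st := fix st M := match M with
    | O => (fun _ => 0, fun _ => 0)
    | S M => (update (fst (st M)) (S M) (fst (nxt M (st M))),
              update (snd (st M)) (S M) (snd (nxt M (st M)))) end).
  assert (Hst : forall M, P M (st M)).
  { induction M as [|M IH].
    - split; apply bigO_ext_all with (2 := bigO_zero 1); intros s;
        unfold dsum, truncation, psum; rewrite !sum_n_m_1_0, Rplus_0_r; simpl;
        rewrite ?Z1, ?Z2; ring.
    - exact (proj2_sig (constructive_indefinite_description _ (Hstep M (st M))) IH). }
  assert (Heq : forall M k, (k <= M)%nat ->
    fst (st M) k = fst (st k) k /\ snd (st M) k = snd (st k) k).
  { induction M as [|M IH]; intros k Hk1.
    - replace k with O by lia. split; reflexivity.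
    - destruct (Nat.eq_dec k (S M)) as [->|Hne]; [split; reflexivity|].
      rewrite <- (proj1 (IH k ltac:(lia))), <- (proj2 (IH k ltac:(lia))).
      simpl. unfold update. rewrite (proj2 (Nat.eqb_neq k (S M)) Hne). split; reflexivity. }
  exists (fun k => fst (st k) k), (fun k => snd (st k) k). intros M.
  destruct (Hst M) as [H1 H2].
  assert (E1 : forall s, psum (fst (st M)) M s = psum (fun k => fst (st k) k) M s).
  { intros s. apply sum_n_m_1_ext. intros k Hk1. rewrite (proj1 (Heq M k ltac:(lia))). reflexivity. }
  assert (E2 : forall s, psum (snd (st M)) M s = psum (fun k => snd (st k) k) M s).
  { intros s. apply sum_n_m_1_ext. intros k Hk1. rewrite (proj2 (Heq M k ltac:(lia))). reflexivity. }
  split.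
  - apply bigO_ext_all with (2 := H1). intros s. rewrite E1, E2. f_equal.
    apply sum_n_m_1_ext. intros k Hk1. rewrite (proj1 (Heq M k ltac:(lia))). reflexivity.
  - apply bigO_ext_all with (2 := H2). intros s. rewrite E1, E2. f_equal.
    apply sum_n_m_1_ext. intros k Hk1. rewrite (proj2 (Heq M k ltac:(lia))). reflexivity.
Qed.

(** * The equation of the remainder *)


(** The radius may shrink as the order [M] grows, which is harmless along curves
    converging to [(a, b)]. *)
Definition local_expansion (f : R -> R -> R -> R) (Psi : nat -> R -> R -> R) (a b : R) : Prop :=
  forall M, exists r K, 0 < r /\ 0 <= K /\
    at_right 0 (fun s => forall x y, near a b r x y ->
      Rabs (f x y s - truncation Psi M x y s) <= K * s ^ S M).

Lemma truncation_base (Psi : nat -> R -> R -> R) (a b : R) (M : nat) (X Y : R -> R) :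
  (forall k, smooth2 (Psi k)) ->
  bigO 1 (fun s => X s - a) -> bigO 1 (fun s => Y s - b) ->
  bigO 1 (fun s => truncation Psi M (X s) (Y s) s - Psi O a b).
Proof.
  intros HPsi HX HY.
  assert (Hz : forall c, bigO 1 (fun _ => c - c)).
  { intros c. apply bigO_ext_all with (2 := bigO_zero 1). intros; ring. }
  induction M as [|M IH].
  - apply bigO_ext_all with (fun s => Psi O (X s) (Y s) - Psi O a b).
    { intros s. unfold truncation. simpl. ring. }
    apply (smooth2_bigO (Psi O) a b 1 (fun _ => a) (fun _ => b)); auto.
  - apply bigO_ext_all with (fun s => (truncation Psi M (X s) (Y s) s - Psi O a b) +
      s ^ S M * (Psi (S M) (X s) (Y s) - Psi (S M) a b) + s ^ S M * Psi (S M) a b).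
    { intros s. unfold truncation. rewrite tech5. ring. }
    apply bigO_plus; [apply bigO_plus; [exact IH|]|].
    + apply bigO_le with (S M + 1)%nat; [lia|]. apply bigO_mult; [apply bigO_pow|].
      apply (smooth2_bigO (Psi (S M)) a b 1 (fun _ => a) (fun _ => b)); auto.
    + apply bigO_le with (S M + 0)%nat; [lia|]. apply bigO_mult; [apply bigO_pow|].
      apply bigO_const.
Qed.

Lemma bigO_lt_radius (n : nat) (r : R) (h : R -> R) :
  0 < r -> bigO (S n) h -> at_right 0 (fun s => Rabs (h s) < r).
Proof.
  intros Hr Hh. apply bigO_le with (n := 1%nat) in Hh; [|lia].
  assert (H1 : bigO 1 (fun s => h s - 0)).
  { apply bigO_ext_all with (2 := Hh). intros; ring. }
  generalize (bigO1_near 0 0 r h h Hr H1 H1). apply filter_imp. intros s [H _].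
  rewrite Rminus_0_r in H. exact H.
Qed.

Lemma near_shift (a b r x y u v : R) :
  near a b (r / 2) x y -> Rabs u < r / 2 -> Rabs v < r / 2 -> near a b r (x + u) (y + v).
Proof.
  intros [H1 H2] Hu Hv.
  split; [replace (x + u - a) with ((x - a) + u) by ring|
          replace (y + v - b) with ((y - b) + v) by ring];
    apply Rle_lt_trans with (1 := Rabs_triang _ _); lra.
Qed.

Lemma near_half (a b r x y : R) : 0 < r -> near a b (r / 2) x y -> near a b r x y.
Proof. intros Hr [H1 H2]. split; lra. Qed.

(** Only the coefficients up to [q] contribute to the Jacobian matrix modulo
    [s ^ (q + 1)], and it may be taken at any approximate solution [(X0, Y0)]
    agreeing with [(X, Y)] to that order. *)
Lemma truncation_linear (q : nat) (Psi : nat -> R -> R -> R) (a b : R) (X Y X0 Y0 : R -> R) (m : nat) :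
  (forall k, smooth2 (Psi k)) ->
  bigO 1 (fun s => X s - a) -> bigO 1 (fun s => Y s - b) ->
  bigO 1 (fun s => X0 s - a) -> bigO 1 (fun s => Y0 s - b) ->
  bigO (S q) (fun s => X s - X0 s) -> bigO (S q) (fun s => Y s - Y0 s) ->
  exists K, 0 <= K /\ at_right 0 (fun s => forall u v, Rabs u <= s ^ S q -> Rabs v <= s ^ S q ->
    Rabs (truncation Psi m (X s + u) (Y s + v) s - truncation Psi m (X s) (Y s) s -
      truncation (fun k => pd1 (Psi k)) (Nat.min m q) (X0 s) (Y0 s) s * u -
      truncation (fun k => pd2 (Psi k)) (Nat.min m q) (X0 s) (Y0 s) s * v) <=
    K * (s ^ S q * (Rabs u + Rabs v))).
Proof.
  intros HPsi HX HY HX0 HY0 [K1 [HK1 HdX]] [K2 [HK2 HdY]].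
  assert (Hlin : forall k, exists K, 0 <= K /\ at_right 0 (fun s => forall u v,
    Rabs u <= s ^ S q -> Rabs v <= s ^ S q ->
    Rabs (Psi k (X s + u) (Y s + v) - Psi k (X s) (Y s) -
      pd1 (Psi k) (X0 s) (Y0 s) * u - pd2 (Psi k) (X0 s) (Y0 s) * v) <=
    K * (s ^ S q * (Rabs u + Rabs v)))).
  { intros k. destruct (smooth2_linear (Psi k) a b (HPsi k)) as [r [K [Hr [HK HL]]]].
    exists (K * (2 * K1 + 2 * K2 + 2)). split; [apply Rmult_le_pos; lra|].
    assert (Hr2 : 0 < r / 2) by lra.
    generalize (filter_and _ _ (filter_and _ _ HdX HdY)
      (filter_and _ _ (bigO_lt_radius q _ _ Hr2 (bigO_pow (S q)))
      (filter_and _ _ (bigO1_near _ _ _ _ _ Hr2 HX HY) (bigO1_near _ _ _ _ _ Hr HX0 HY0)))).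
    apply filter_imp. intros s [[E1 E2] [Hs [N1 N0]]] u v Hu Hv.
    assert (Hs1 := Rle_abs (s ^ S q)).
    assert (N2 : near a b r (X s + u) (Y s + v)) by (apply near_shift; [exact N1|lra|lra]).
    apply near_half in N1; [|exact Hr].
    generalize (HL _ _ _ _ _ _ N0 N1 N2).
    replace (X s + u - X s) with u by ring. replace (Y s + v - Y s) with v by ring.
    intros E. apply Rle_trans with (1 := E).
    rewrite !Rmult_assoc. apply Rmult_le_compat_l; [exact HK|]. rewrite <- Rmult_assoc.
    apply Rmult_le_compat_r; [generalize (Rabs_pos u) (Rabs_pos v); lra|].
    replace (X s + u - X0 s) with ((X s - X0 s) + u) by ring.
    replace (Y s + v - Y0 s) with ((Y s - Y0 s) + v) by ring.
    generalize (Rabs_triang (X s - X0 s) u) (Rabs_triang (Y s - Y0 s) v). lra. }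
  assert (Hlip : forall k, exists K, 0 <= K /\ at_right 0 (fun s => forall u v,
    Rabs u <= s ^ S q -> Rabs v <= s ^ S q ->
    Rabs (Psi k (X s + u) (Y s + v) - Psi k (X s) (Y s)) <= K * (Rabs u + Rabs v))).
  { intros k. destruct (smooth2_lipschitz (Psi k) a b (HPsi k)) as [r [K [Hr [HK HL]]]].
    exists K. split; [exact HK|]. assert (Hr2 : 0 < r / 2) by lra.
    generalize (filter_and _ _ (bigO_lt_radius q _ _ Hr2 (bigO_pow (S q)))
      (bigO1_near _ _ _ _ _ Hr2 HX HY)).
    apply filter_imp. intros s [Hs N1] u v Hu Hv.
    assert (Hs1 := Rle_abs (s ^ S q)).
    assert (N2 : near a b r (X s + u) (Y s + v)) by (apply near_shift; [exact N1|lra|lra]).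
    apply near_half in N1; [|exact Hr].
    generalize (HL _ _ _ _ N1 N2).
    replace (X s + u - X s) with u by ring. replace (Y s + v - Y s) with v by ring. auto. }
  induction m as [|m [K [HK IH]]].
  - destruct (Hlin O) as [K [HK H]]. exists K. split; [exact HK|].
    revert H. apply filter_imp. intros s H u v Hu Hv.
    generalize (H u v Hu Hv). unfold truncation. simpl. rewrite !Rmult_1_l. auto.
  - destruct (Nat.le_gt_cases (S m) q) as [Hmq|Hmq].
    + destruct (Hlin (S m)) as [L [HL H]]. exists (K + L). split; [lra|].
      rewrite Nat.min_l by exact Hmq. rewrite Nat.min_l in IH by lia.
      generalize (filter_and _ _ (at_right0_lt 1 Rlt_0_1) (filter_and _ _ IH H)).
      apply filter_imp. intros s [Hs [E1 E2]] u v Hu Hv.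
      specialize (E1 u v Hu Hv). specialize (E2 u v Hu Hv).
      unfold truncation in *. rewrite !tech5.
      match goal with |- Rabs ?A <= _ => match type of E1 with Rabs ?B <= _ =>
        match type of E2 with Rabs ?C <= _ => replace A with (B + s ^ S m * C) by ring end end end.
      apply Rle_trans with (1 := Rabs_triang _ _).
      rewrite Rmult_plus_distr_r. apply Rplus_le_compat; [exact E1|].
      rewrite Rabs_mult. apply Rle_trans with (2 := E2).
      rewrite <- Rmult_1_l. apply Rmult_le_compat_r; [apply Rabs_pos|].
      rewrite Rabs_pos_eq by (apply pow_le; lra).
      rewrite <- (pow_O s). apply pow_le_pow_lt1; [lra|lia].
    + destruct (Hlip (S m)) as [L [HL H]]. exists (K + L). split; [lra|].
      rewrite Nat.min_r by lia. rewrite Nat.min_r in IH by lia.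
      generalize (filter_and _ _ (at_right0_lt 1 Rlt_0_1) (filter_and _ _ IH H)).
      apply filter_imp. intros s [Hs [E1 E2]] u v Hu Hv.
      specialize (E1 u v Hu Hv). specialize (E2 u v Hu Hv).
      unfold truncation in *. rewrite !(tech5 _ m).
      match goal with |- Rabs ?A <= _ => match type of E1 with Rabs ?B <= _ =>
        match type of E2 with Rabs ?C <= _ => replace A with (B + s ^ S m * C) by ring end end end.
      apply Rle_trans with (1 := Rabs_triang _ _).
      rewrite Rmult_plus_distr_r. apply Rplus_le_compat; [exact E1|].
      rewrite Rabs_mult, Rabs_pos_eq by (apply pow_le; lra).
      replace (L * (s ^ S q * (Rabs u + Rabs v))) with (s ^ S q * (L * (Rabs u + Rabs v))) by ring.
      apply Rmult_le_compat; [apply pow_le; lra|apply Rabs_pos| |exact E2].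
      apply pow_le_pow_lt1; [lra|lia].
Qed.

(** The linear part is the same for all orders [M], so the sign of its trace is
    decided once and for all. It is replaced by a polynomial in [s], which can be
    differentiated although [f] is only known up to small functions. *)
Lemma remainder_equation (q : nat) (f : R -> R -> R -> R) (Psi : nat -> R -> R -> R)
    (sg : R) (a b c : nat -> R) :
  (forall k, smooth2 (Psi k)) -> local_expansion f Psi sg 0 ->
  (forall M, bigO (S M) (fun s => dsum q c M s -
    truncation Psi M (sg + psum a M s) (psum b M s) s)) ->
  exists l1 l2, horner l1 0 = pd1 (Psi O) sg 0 /\ horner l2 0 = pd2 (Psi O) sg 0 /\
    forall M, (q <= M)%nat -> exists K, 0 <= K /\
      at_right 0 (fun s => forall u v, Rabs u <= s ^ S q -> Rabs v <= s ^ S q ->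
        Rabs (f (sg + psum a M s + u) (psum b M s + v) s - dsum q c M s -
          (horner l1 s * u + horner l2 s * v)) <=
        K * (s ^ S q * (Rabs u + Rabs v) + s ^ S M)).
Proof.
  intros HPsi Hf Hres.
  assert (HX : forall M, bigO 1 (fun s => sg + psum a M s - sg)).
  { intros M. apply bigO_ext_all with (2 := psum_bigO1 a M). intros; ring. }
  assert (HY : forall M, bigO 1 (fun s => psum b M s - 0)).
  { intros M. apply bigO_ext_all with (2 := psum_bigO1 b M). intros; ring. }
  assert (Hpoly : forall Q : nat -> R -> R -> R, (forall k, smooth2 (Q k)) ->
    exists l, horner l 0 = Q O sg 0 /\
      bigO (S q) (fun s => truncation Q q (sg + psum a q s) (psum b q s) s - horner l s)).
  { intros Q HQ.
    destruct (expandable_poly (S q) (fun s => truncation Q q (sg + psum a q s) (psum b q s) s))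
      as [l Hl].
    - apply (expandable_truncation Q sg 0 (S q) q (fun s => sg + psum a q s) (psum b q)); auto.
      + apply expandable_plus; [apply expandable_const|apply expandable_psum].
      + apply expandable_psum.
    - exists l. split; [|exact Hl].
      apply Rminus_diag_uniq. apply bigO1_const_zero with (fun _ => 0); [apply bigO_zero|].
      apply bigO_ext_all with (fun s =>
        (truncation Q q (sg + psum a q s) (psum b q s) s - Q O sg 0) -
        (truncation Q q (sg + psum a q s) (psum b q s) s - horner l s) -
        (horner l s - horner l 0)); [intros; ring|].
      apply bigO_minus; [apply bigO_minus|apply horner_0].
      + apply (truncation_base Q sg 0 q (fun s => sg + psum a q s)); auto.
      + apply bigO_le with (2 := Hl). lia. }
  destruct (Hpoly (fun k => pd1 (Psi k))) as [l1 [Z1 H1]]; [intros; apply smooth2_pd1, HPsi|].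
  destruct (Hpoly (fun k => pd2 (Psi k))) as [l2 [Z2 H2]]; [intros; apply smooth2_pd2, HPsi|].
  exists l1, l2. split; [exact Z1|]. split; [exact Z2|]. intros M HM.
  destruct H1 as [L1 [HL1 H1]], H2 as [L2 [HL2 H2]].
  destruct (truncation_linear q Psi sg 0 (fun s => sg + psum a M s) (psum b M)
    (fun s => sg + psum a q s) (psum b q) M) as [K [HK HT]]; auto.
  { apply bigO_ext_all with (2 := psum_tail a q M HM). intros; ring. }
  { apply psum_tail, HM. }
  rewrite Nat.min_r in HT by exact HM.
  destruct (Hf M) as [r [Kf [Hr [HKf Hfe]]]].
  destruct (Hres M) as [Kr [HKr Hre]].
  exists (K + L1 + L2 + Kf + Kr). split; [lra|].
  assert (Hr2 : 0 < r / 2) by lra.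
  generalize (filter_and _ _ (filter_and _ _ (filter_and _ _ H1 H2)
      (filter_and _ _ (at_right0_lt 1 Rlt_0_1) (bigO_lt_radius q _ _ Hr2 (bigO_pow (S q)))))
    (filter_and _ _ (filter_and _ _ HT Hfe)
      (filter_and _ _ Hre (bigO1_near _ _ _ _ _ Hr2 (HX M) (HY M))))).
  apply filter_imp. intros s [[[E1 E2] [Hs01 Hs]] [[E3 E4] [E5 N1]]] u v Hu Hv.
  specialize (E3 u v Hu Hv).
  assert (Hs1 := Rle_abs (s ^ S q)).
  specialize (E4 (sg + psum a M s + u) (psum b M s + v)
    ltac:(apply near_shift; [exact N1|lra|lra])).
  set (T1 := truncation Psi M (sg + psum a M s + u) (psum b M s + v) s) in *.
  set (T0 := truncation Psi M (sg + psum a M s) (psum b M s) s) in *.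
  set (J1 := truncation (fun k => pd1 (Psi k)) q (sg + psum a q s) (psum b q s) s) in *.
  set (J2 := truncation (fun k => pd2 (Psi k)) q (sg + psum a q s) (psum b q s) s) in *.
  set (f1 := f (sg + psum a M s + u) (psum b M s + v) s) in *.
  replace (f1 - dsum q c M s - (horner l1 s * u + horner l2 s * v)) with
    ((f1 - T1) + (T1 - T0 - J1 * u - J2 * v) + ((J1 - horner l1 s) * u) +
      ((J2 - horner l2 s) * v) - (dsum q c M s - T0)) by ring.
  assert (B1 : Rabs ((J1 - horner l1 s) * u) <= L1 * (s ^ S q * Rabs u)).
  { rewrite Rabs_mult, <- Rmult_assoc. apply Rmult_le_compat_r; [apply Rabs_pos|exact E1]. }
  assert (B2 : Rabs ((J2 - horner l2 s) * v) <= L2 * (s ^ S q * Rabs v)).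
  { rewrite Rabs_mult, <- Rmult_assoc. apply Rmult_le_compat_r; [apply Rabs_pos|exact E2]. }
  assert (P1 : 0 <= s ^ S q) by nonneg.
  assert (P2 : 0 <= s ^ S M) by nonneg.
  assert (Pu := Rabs_pos u). assert (Pv := Rabs_pos v).
  assert (U : 0 <= s ^ S q * Rabs u) by nonneg.
  assert (V : 0 <= s ^ S q * Rabs v) by nonneg.
  assert (B : forall x1 x2 x3 x4 x5, Rabs (x1 + x2 + x3 + x4 - x5) <=
    Rabs x1 + Rabs x2 + Rabs x3 + Rabs x4 + Rabs x5).
  { intros. unfold Rminus. generalize (Rabs_triang (x1 + x2 + x3 + x4) (- x5))
      (Rabs_triang (x1 + x2 + x3) x4) (Rabs_triang (x1 + x2) x3) (Rabs_triang x1 x2).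
    rewrite Rabs_Ropp. lra. }
  apply Rle_trans with (1 := B _ _ _ _ _).
  apply Rle_trans with (Kf * s ^ S M + K * (s ^ S q * (Rabs u + Rabs v)) + L1 * (s ^ S q * Rabs u)
    + L2 * (s ^ S q * Rabs v) + Kr * s ^ S M); [lra|].
  rewrite !Rmult_plus_distr_l. nra.
Qed.

(** * Powers of time and scalar comparison *)


Definition tau (q : nat) (t : R) : R := Rpower t (- / INR q).

Lemma tau_pos (q : nat) (t : R) : 0 < tau q t.
Proof. apply exp_pos. Qed.

Lemma tpow_tau (q k : nat) (t : R) : tpow q k t = tau q t ^ k.
Proof.
  unfold tpow, tau. rewrite <- Rpower_pow by apply exp_pos. rewrite Rpower_mult.
  f_equal. unfold Rdiv. ring.
Qed.

Lemma tau_pow_q (q : nat) (t : R) : (0 < q)%nat -> 0 < t -> tau q t ^ q = / t.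
Proof.
  intros Hq Ht. unfold tau. rewrite <- Rpower_pow by apply exp_pos. rewrite Rpower_mult.
  replace (- / INR q * INR q) with (- (1)).
  - rewrite Rpower_Ropp, Rpower_1 by exact Ht. reflexivity.
  - field. apply not_0_INR. lia.
Qed.

Lemma is_derive_tau (q : nat) (t : R) :
  (0 < q)%nat -> 0 < t -> is_derive (tau q) t (- / INR q * tau q t ^ S q).
Proof.
  intros Hq Ht. rewrite <- tech_pow_Rmult, tau_pow_q by assumption. unfold tau, Rpower.
  auto_derive; [exact Ht|]. field. split; [lra|]. apply not_0_INR. lia.
Qed.

Lemma is_derive_tau_pow (q n : nat) (t : R) :
  (0 < q)%nat -> 0 < t ->
  is_derive (fun t => tau q t ^ n) t (- (INR n / INR q) * tau q t ^ (n + q)).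
Proof.
  intros Hq Ht. generalize (is_derive_pow _ n t _ (is_derive_tau q t Hq Ht)).
  intros H. eapply is_derive_ext; [intros; reflexivity|].
  replace (- (INR n / INR q) * tau q t ^ (n + q)) with
    (INR n * (- / INR q * tau q t ^ S q) * tau q t ^ Init.Nat.pred n); [exact H|].
  destruct n as [|n]; [simpl; unfold Rdiv; ring|].
  change (Init.Nat.pred (S n)) with n. replace (S n + q)%nat with (S q + n)%nat by lia.
  rewrite (pow_add _ (S q) n). unfold Rdiv. ring.
Qed.

Lemma tau_filterlim (q : nat) :
  (0 < q)%nat -> filterlim (tau q) (Rbar_locally p_infty) (at_right 0).
Proof.
  intros Hq P HP. apply at_right0_iff in HP. destruct HP as [d [Hd HP]].
  assert (Hdq : 0 < d ^ q) by nonneg.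
  exists (/ d ^ q). intros t Ht. apply HP. split; [apply tau_pos|].
  assert (H0 : 0 < / d ^ q) by nonneg.
  apply Rnot_le_lt. intros Hle.
  assert (d ^ q <= tau q t ^ q) by (apply pow_incr; lra).
  rewrite tau_pow_q in H by (assumption || lra).
  apply Rinv_le_contravar in H; [|exact Hdq]. rewrite Rinv_inv in H. lra.
Qed.

Lemma eventually_tau (q : nat) (P : R -> Prop) :
  (0 < q)%nat -> at_right 0 P -> exists T, 1 < T /\ forall t, T <= t -> P (tau q t).
Proof.
  intros Hq HP. destruct (tau_filterlim q Hq P HP) as [M HM].
  exists (Rmax (M + 1) 2). assert (A := Rmax_l (M + 1) 2). assert (B := Rmax_r (M + 1) 2).
  split; [lra|]. intros t Ht. apply HM. lra.
Qed.

Lemma nondecreasing (f df : R -> R) (a b : R) :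
  a <= b -> (forall t, a <= t <= b -> is_derive f t (df t)) ->
  (forall t, a <= t <= b -> 0 <= df t) -> f a <= f b.
Proof.
  intros Hab Hf Hd. destruct (mean_value f df a b) as [c [Hc E]].
  - intros c. rewrite Rmin_left, Rmax_right by exact Hab. apply Hf.
  - rewrite Rmin_left, Rmax_right in Hc by exact Hab. specialize (Hd c Hc). nra.
Qed.

Lemma is_derive_local_sign (f : R -> R) (x l : R) :
  is_derive f x l -> l < 0 -> exists d, 0 < d /\ forall h, 0 < h < d -> f x < f (x - h).
Proof.
  intros Hf Hl. apply is_derive_Reals in Hf.
  destruct (Hf (- l / 2) ltac:(lra)) as [d Hd].
  exists d. split; [apply cond_pos|]. intros h Hh.
  specialize (Hd (- h) ltac:(lra) ltac:(rewrite Rabs_Ropp, Rabs_pos_eq; lra)).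
  apply Rabs_def2 in Hd.
  unfold Rminus at 1. apply Rminus_lt_0.
  replace (f (x + - h) - f x) with (- h * ((f (x + - h) - f x) / - h)) by (field; lra). nra.
Qed.

(** At a first zero the derivative could not be negative. *)
Lemma stays_negative (phi dphi : R -> R) (t0 t1 : R) :
  (forall t, t0 <= t <= t1 -> is_derive phi t (dphi t)) ->
  phi t0 < 0 ->
  (forall t, t0 <= t <= t1 -> phi t = 0 -> dphi t < 0) ->
  forall t, t0 <= t <= t1 -> phi t < 0.
Proof.
  intros Hd H0 Hz s Hs. apply Rnot_le_lt. intros Hps.
  set (E := fun t => t0 <= t <= s /\ forall r, t0 <= r <= t -> phi r < 0).
  destruct (completeness E) as [T [HT1 HT2]].
  { exists s. intros t [Ht _]. lra. }
  { exists t0. split; [lra|]. intros r Hr. replace r with t0 by lra. exact H0. }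
  assert (HtT : t0 <= T).
  { apply HT1. split; [lra|]. intros r Hr. replace r with t0 by lra. exact H0. }
  assert (HTs : T <= s). { apply HT2. intros t [Ht _]. lra. }
  assert (Hbelow : forall r, t0 <= r < T -> phi r < 0).
  { intros r Hr. apply NNPP. intros Hn.
    assert (T <= r); [|lra]. apply HT2. intros t [Ht Ht2].
    apply Rnot_lt_le. intros Hrt. apply Hn. apply Ht2. lra. }
  assert (Hcont : continuity_pt phi T).
  { apply continuity_pt_filterlim. apply (ex_derive_continuous phi T).
    exists (dphi T). apply Hd. lra. }
  assert (Hnear : forall e, 0 < e -> exists d, 0 < d /\ forall r, Rabs (r - T) < d ->
    Rabs (phi r - phi T) < e).
  { intros e He. destruct (Hcont e He) as [d [Hd1 Hd2]]. exists d. split; [exact Hd1|].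
    intros r Hr. destruct (Req_dec r T) as [->|Hne].
    - rewrite Rminus_diag, Rabs_R0. exact He.
    - apply (Hd2 r). split; [split; [exact I|intros Heq; apply Hne; symmetry; exact Heq]|exact Hr]. }
  destruct (Rtotal_order (phi T) 0) as [Hlt|[Heq|Hgt]].
  - destruct (Hnear (- phi T) ltac:(lra)) as [d [Hd1 Hd2]].
    assert (HTs' : T < s). { destruct HTs as [HTs| ->]; [exact HTs|lra]. }
    set (r := Rmin (T + d / 2) s).
    assert (Hr : T < r) by (unfold r; apply Rmin_glb_lt; lra).
    assert (r <= T); [|lra]. apply HT1. split.
    + split; [lra|apply Rmin_r].
    + intros u Hu. destruct (Rlt_le_dec u T) as [HuT|HuT]; [apply Hbelow; lra|].
      assert (r <= T + d / 2) by apply Rmin_l.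
      specialize (Hd2 u ltac:(rewrite Rabs_pos_eq; lra)). apply Rabs_def2 in Hd2. lra.
  - destruct (is_derive_local_sign phi T (dphi T)) as [d [Hd1 Hd2]].
    { apply Hd. lra. } { apply Hz; lra. }
    assert (HT0 : t0 < T). { destruct HtT as [HtT|HtT]; [exact HtT|]. rewrite <- HtT in Heq. lra. }
    set (h := Rmin (d / 2) (T - t0)).
    assert (0 < h) by (unfold h; apply Rmin_glb_lt; lra).
    assert (h <= d / 2) by apply Rmin_l. assert (h <= T - t0) by apply Rmin_r.
    specialize (Hd2 h ltac:(lra)). specialize (Hbelow (T - h) ltac:(lra)). lra.
  - destruct (Hnear (phi T) Hgt) as [d [Hd1 Hd2]].
    assert (HT0 : t0 < T). { destruct HtT as [HtT|HtT]; [exact HtT|]. rewrite <- HtT in Hgt. lra. }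
    set (h := Rmin (d / 2) (T - t0)).
    assert (0 < h) by (unfold h; apply Rmin_glb_lt; lra).
    assert (h <= d / 2) by apply Rmin_l. assert (h <= T - t0) by apply Rmin_r.
    specialize (Hd2 (T - h)). replace (T - h - T) with (- h) in Hd2 by ring.
    rewrite Rabs_Ropp, Rabs_pos_eq in Hd2 by lra. specialize (Hd2 ltac:(lra)).
    apply Rabs_def2 in Hd2. specialize (Hbelow (T - h) ltac:(lra)). lra.
Qed.

Lemma stays_negative_backward (phi dphi : R -> R) (t0 t1 : R) :
  (forall t, t0 <= t <= t1 -> is_derive phi t (dphi t)) ->
  phi t1 < 0 ->
  (forall t, t0 <= t <= t1 -> phi t = 0 -> 0 < dphi t) ->
  forall t, t0 <= t <= t1 -> phi t < 0.
Proof.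
  intros Hd H1 Hz t Ht.
  rewrite <- (Ropp_involutive t).
  apply (stays_negative (fun s => phi (- s)) (fun s => - dphi (- s)) (- t1) (- t0)).
  - intros s Hs. replace (- dphi (- s)) with (scal (-1) (dphi (- s))).
    + apply (is_derive_comp phi (fun s => - s) s (dphi (- s)) (-1)).
      * apply Hd. lra.
      * auto_derive; [exact I|ring].
    + unfold scal. simpl. unfold mult. simpl. ring.
  - rewrite Ropp_involutive. exact H1.
  - intros s Hs E. specialize (Hz (- s) ltac:(lra) E). lra.
  - lra.
Qed.

Lemma nonpos_of_vanishing (q : nat) (h : R -> R) (K T t : R) :
  (0 < q)%nat -> (forall t', Rmax t T <= t' -> h t <= K * tau q t') -> h t <= 0.
Proof.
  intros Hq H. apply Rnot_lt_le. intros Hpos.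
  assert (HK : 0 < Rabs K + 1) by (generalize (Rabs_pos K); lra).
  destruct (eventually_tau q (fun s => 0 < s < h t / (Rabs K + 1)) Hq) as [T1 [_ HT1]].
  { apply at_right0_lt. apply Rdiv_lt_0_compat; lra. }
  set (t' := Rmax (Rmax t T) T1).
  specialize (H t' (Rmax_l _ _)). destruct (HT1 t' (Rmax_r _ _)) as [P1 P2].
  assert (tau q t' * (Rabs K + 1) < h t).
  { apply Rlt_le_trans with (h t / (Rabs K + 1) * (Rabs K + 1)).
    - apply Rmult_lt_compat_r; assumption.
    - right. field. lra. }
  generalize (Rle_abs K). intros. nra.
Qed.

(** [E] is an integrating factor for the linear part [om]. *)
Lemma weighted_comparison (E om f df g dg : R -> R) (a b : R) :
  a <= b ->
  (forall t, a <= t <= b -> 0 < E t /\ is_derive E t (E t * om t)) ->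
  (forall t, a <= t <= b -> is_derive f t (df t) /\ is_derive g t (dg t)) ->
  (forall t, a <= t <= b -> dg t + om t * g t <= df t + om t * f t) ->
  E a * (f a - g a) <= E b * (f b - g b).
Proof.
  intros Hab HE Hfg Hineq.
  apply (nondecreasing (fun t => E t * (f t - g t))
    (fun t => E t * om t * (f t - g t) + E t * (df t - dg t))) with (1 := Hab); intros t Ht;
    destruct (HE t Ht) as [E0 E1], (Hfg t Ht) as [F1 G1].
  - apply (is_derive_mult E (fun t => f t - g t)); [exact E1| |intros; apply Rmult_comm].
    apply @is_derive_minus; assumption.
  - specialize (Hineq t Ht).
    replace (E t * om t * (f t - g t) + E t * (df t - dg t)) with
      (E t * ((df t + om t * f t) - (dg t + om t * g t))) by ring.
    apply Rmult_le_pos; lra.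
Qed.

Lemma is_derive_time_pow (q C : nat) (t : R) :
  (0 < q)%nat -> 0 < t -> is_derive (fun t => t ^ C) t (t ^ C * (INR C * tau q t ^ q)).
Proof.
  intros Hq Ht. rewrite tau_pow_q by assumption.
  replace (t ^ C * (INR C * / t)) with (INR C * 1 * t ^ Init.Nat.pred C).
  - apply is_derive_pow. apply @is_derive_id.
  - destruct C as [|C]; [simpl; ring|]. change (Init.Nat.pred (S C)) with C. simpl (t ^ S C).
    field. lra.
Qed.

Lemma is_derive_exp_scal (mu t : R) : is_derive (fun t => exp (mu * t)) t (exp (mu * t) * mu).
Proof. auto_derive; [exact I|ring]. Qed.

Lemma is_derive_scal_tau_pow (q n : nat) (K t : R) :
  (0 < q)%nat -> 0 < t ->
  is_derive (fun t => K * tau q t ^ n) t (- (K * (INR n / INR q)) * (tau q t ^ q * tau q t ^ n)).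
Proof.
  intros Hq Ht.
  replace (- (K * (INR n / INR q)) * (tau q t ^ q * tau q t ^ n)) with
    (K * (- (INR n / INR q) * tau q t ^ (n + q))) by (rewrite pow_add; ring).
  apply is_derive_scal. apply is_derive_tau_pow; assumption.
Qed.

(** Comparison from infinity: a differential inequality whose linear part
    allows decay no faster than [t ^ -C] forces the bound [O(tau ^ s)], with
    [s > C q], on functions already known to be smaller than [t ^ -C]. *)
Lemma decay_from_infinity (q C s : nat) (f df : R -> R) (K K0 T : R) :
  (0 < q)%nat -> (C * q < s)%nat -> 0 <= K -> 0 < T ->
  (forall t, T <= t -> is_derive f t (df t)) ->
  (forall t, T <= t -> - (INR C * tau q t ^ q * f t) - K * tau q t ^ (q + s) <= df t) ->
  (forall t, T <= t -> f t <= K0 * tau q t ^ S (C * q)) ->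
  forall t, T <= t -> f t <= K * INR q * tau q t ^ s.
Proof.
  intros Hq HCs HK HT Hf Hdf Hsmall t Ht.
  assert (Hq0 : 0 < INR q) by nonneg.
  assert (Hpos : forall n u, 0 < tau q u ^ n) by (intros; apply pow_lt, tau_pos).
  assert (HtC : 0 < t ^ C) by (apply pow_lt; lra).
  apply Rminus_le, Rmult_le_reg_l with (t ^ C); [exact HtC|]. rewrite Rmult_0_r.
  apply (nonpos_of_vanishing q (fun t => t ^ C * (f t - K * INR q * tau q t ^ s)) K0 T t Hq).
  intros u Hu.
  assert (Htu : t <= u) by apply (Rle_trans _ _ _ (Rmax_l _ _) Hu).
  apply Rle_trans with (u ^ C * (f u - K * INR q * tau q u ^ s)).
  - apply (weighted_comparison (fun t => t ^ C) (fun t => INR C * tau q t ^ q) f df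
      (fun t => K * INR q * tau q t ^ s)
      (fun t => - (K * INR q * (INR s / INR q)) * (tau q t ^ q * tau q t ^ s)) t u Htu).
    + intros v Hv. split; [apply pow_lt; lra|apply is_derive_time_pow; [exact Hq|lra]].
    + intros v Hv. split; [apply Hf; lra|apply is_derive_scal_tau_pow; [exact Hq|lra]].
    + intros v Hv. specialize (Hdf v ltac:(lra)). rewrite (pow_add _ q s) in Hdf.
      assert (HCs' : INR C * INR q + 1 <= INR s).
      { rewrite <- mult_INR, <- S_INR. apply le_INR. lia. }
      replace (- (K * INR q * (INR s / INR q)) * (tau q v ^ q * tau q v ^ s)) with
        (- (K * INR s * (tau q v ^ q * tau q v ^ s))) by (field; lra).
      assert (0 <= K * (tau q v ^ q * tau q v ^ s)) by nonneg.
      nra.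
  - assert (HuC : 0 < u ^ C) by (apply pow_lt; lra).
    assert (HC : u ^ C * tau q u ^ (C * q) = 1).
    { rewrite Nat.mul_comm, pow_mult, tau_pow_q, <- Rpow_mult_distr, Rinv_r, pow1
        by (assumption || lra). reflexivity. }
    assert (0 <= K * INR q * tau q u ^ s) by nonneg.
    apply Rle_trans with (u ^ C * (K0 * tau q u ^ S (C * q))).
    + apply Rmult_le_compat_l; [lra|]. specialize (Hsmall u ltac:(lra)). lra.
    + right. simpl. transitivity (K0 * tau q u * (u ^ C * tau q u ^ (C * q))); [ring|].
      rewrite HC. ring.
Qed.

(** The initial value is absorbed in the constant of the comparison function,
    which must then only decrease slowly enough for the damping [om]. *)
Lemma comparison_from_start (q s : nat) (E om f df : R -> R) (K T : R) :
  (0 < q)%nat -> 0 <= K -> 0 < T ->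
  (forall t, T <= t -> 0 < E t /\ is_derive E t (E t * om t)) ->
  (forall t, T <= t -> is_derive f t (df t)) ->
  (forall K' t, K <= K' -> T <= t ->
    df t + om t * f t <= K' * (om t - INR s / INR q * tau q t ^ q) * tau q t ^ s) ->
  exists K', forall t, T <= t -> f t <= K' * tau q t ^ s.
Proof.
  intros Hq HK HT HE Hf Hineq.
  assert (Hpos : forall n u, 0 < tau q u ^ n) by (intros; apply pow_lt, tau_pos).
  set (K' := K + Rabs (f T) / tau q T ^ s). exists K'. intros t Ht.
  assert (HK0 : 0 <= Rabs (f T) / tau q T ^ s) by nonneg.
  assert (H0 : 0 <= K' * tau q T ^ s - f T).
  { unfold K'. rewrite Rmult_plus_distr_r.
    replace (Rabs (f T) / tau q T ^ s * tau q T ^ s) with (Rabs (f T))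
      by (field; apply Rgt_not_eq, Hpos).
    assert (0 <= K * tau q T ^ s) by nonneg.
    generalize (Rle_abs (f T)). lra. }
  assert (H : E T * (K' * tau q T ^ s - f T) <= E t * (K' * tau q t ^ s - f t)).
  { apply (weighted_comparison E om (fun t => K' * tau q t ^ s)
      (fun t => - (K' * (INR s / INR q)) * (tau q t ^ q * tau q t ^ s)) f df T t Ht).
    - intros u Hu. apply HE. lra.
    - intros u Hu. split; [apply is_derive_scal_tau_pow; [exact Hq|lra]|apply Hf; lra].
    - intros u Hu. specialize (Hineq K' u ltac:(unfold K'; lra) ltac:(lra)). lra. }
  destruct (HE T ltac:(lra)) as [ET _], (HE t Ht) as [Et _].
  assert (0 <= E T * (K' * tau q T ^ s - f T)) by nra.
  apply Rminus_le, Ropp_le_cancel. rewrite Ropp_0, Ropp_minus_distr.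
  apply Rmult_le_reg_l with (E t); [exact Et|]. rewrite Rmult_0_r. lra.
Qed.

(** A damping [B / t] with [B > s / q] makes the initial value decay faster than
    [tau ^ s], which is what the forcing term of order [q + s] produces. *)
Lemma decay_from_start (q B s : nat) (f df : R -> R) (K T : R) :
  (0 < q)%nat -> (s < B * q)%nat -> 0 <= K -> 0 < T ->
  (forall t, T <= t -> is_derive f t (df t)) ->
  (forall t, T <= t -> df t <= - (INR B * tau q t ^ q * f t) + K * tau q t ^ (q + s)) ->
  exists K', forall t, T <= t -> f t <= K' * tau q t ^ s.
Proof.
  intros Hq HBs HK HT Hf Hdf.
  assert (Hq0 : 0 < INR q) by nonneg.
  assert (HKq : 0 <= K * INR q) by nonneg.
  apply (comparison_from_start q s (fun t => t ^ B) (fun t => INR B * tau q t ^ q) f df (K * INR q) T);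
    try assumption.
  - intros t Ht. split; [apply pow_lt; lra|apply is_derive_time_pow; [exact Hq|lra]].
  - intros K' t HK' Ht. specialize (Hdf t Ht). rewrite pow_add in Hdf.
    assert (HBs' : INR s + 1 <= INR B * INR q).
    { rewrite <- mult_INR, <- S_INR. apply le_INR. lia. }
    replace (K' * (INR B * tau q t ^ q - INR s / INR q * tau q t ^ q) * tau q t ^ s) with
      (K' / INR q * (INR B * INR q - INR s) * (tau q t ^ q * tau q t ^ s)) by (field; lra).
    assert (E : K <= K' / INR q).
    { apply Rmult_le_reg_r with (INR q); [exact Hq0|]. unfold Rdiv. rewrite Rmult_assoc, Rinv_l; lra. }
    assert (P : 0 < tau q t ^ q * tau q t ^ s) by (apply Rmult_lt_0_compat; apply pow_lt, tau_pos).
    assert (K * 1 <= K' / INR q * (INR B * INR q - INR s)) by nra.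
    nra.
Qed.

(** An expanding component is controlled from infinity, where it vanishes. *)
Lemma unstable_component (q s : nat) (mu : R) (f df : R -> R) (K K0 T : R) :
  (0 < q)%nat -> 0 < mu -> 0 <= K -> 0 < T ->
  (forall t, T <= t -> is_derive f t (df t)) ->
  (forall t, T <= t -> mu * f t - K * tau q t ^ s <= df t) ->
  (forall t, T <= t -> f t <= K0 * tau q t) ->
  forall t, T <= t -> f t <= K / mu * tau q t ^ s.
Proof.
  intros Hq Hmu HK HT Hf Hdf Hsmall t Ht.
  assert (Hq0 : 0 < INR q) by nonneg.
  assert (Hpos : forall n u, 0 < tau q u ^ n) by (intros; apply pow_lt, tau_pos).
  assert (HKm : 0 <= K / mu) by nonneg.
  apply Rminus_le, Rmult_le_reg_l with (exp (- mu * t)); [apply exp_pos|]. rewrite Rmult_0_r.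
  apply (nonpos_of_vanishing q (fun t => exp (- mu * t) * (f t - K / mu * tau q t ^ s)) (Rabs K0) T t Hq).
  intros u Hu.
  assert (Htu : t <= u) by apply (Rle_trans _ _ _ (Rmax_l _ _) Hu).
  apply Rle_trans with (exp (- mu * u) * (f u - K / mu * tau q u ^ s)).
  - apply (weighted_comparison (fun t => exp (- mu * t)) (fun _ => - mu) f df
      (fun t => K / mu * tau q t ^ s)
      (fun t => - (K / mu * (INR s / INR q)) * (tau q t ^ q * tau q t ^ s)) t u Htu).
    + intros v Hv. split; [apply exp_pos|apply is_derive_exp_scal].
    + intros v Hv. split; [apply Hf; lra|apply is_derive_scal_tau_pow; [exact Hq|lra]].
    + intros v Hv. specialize (Hdf v ltac:(lra)).
      assert (0 <= K / mu * (INR s / INR q) * (tau q v ^ q * tau q v ^ s)) by nonneg.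
      replace (- mu * (K / mu * tau q v ^ s)) with (- (K * tau q v ^ s)) by (field; lra). lra.
  - assert (E : exp (- mu * u) <= 1).
    { apply Rlt_le. rewrite <- exp_0. apply exp_increasing. nra. }
    specialize (Hsmall u ltac:(lra)).
    assert (0 <= K / mu * tau q u ^ s) by nonneg.
    assert (K0 * tau q u <= Rabs K0 * tau q u).
    { apply Rmult_le_compat_r; [apply Rlt_le, tau_pos|apply Rle_abs]. }
    assert (0 <= Rabs K0 * tau q u) by nonneg.
    generalize (exp_pos (- mu * u)). intros. nra.
Qed.

(** The comparison function [tau ^ s] decays slower than [exp (- mu t / 2)] once
    [t] is large. *)
Lemma stable_component (q s : nat) (mu : R) (f df : R -> R) (K T : R) :
  (0 < q)%nat -> 0 < mu -> 0 <= K -> 0 < T ->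
  (forall t, T <= t -> INR s / INR q * tau q t ^ q <= mu / 2) ->
  (forall t, T <= t -> is_derive f t (df t)) ->
  (forall t, T <= t -> df t <= - mu * f t + K * tau q t ^ s) ->
  exists K', forall t, T <= t -> f t <= K' * tau q t ^ s.
Proof.
  intros Hq Hmu HK HT Hlate Hf Hdf.
  assert (HK0 : 0 <= 2 * K / mu) by nonneg.
  apply (comparison_from_start q s (fun t => exp (mu * t)) (fun _ => mu) f df (2 * K / mu) T);
    try assumption.
  - intros t Ht. split; [apply exp_pos|apply is_derive_exp_scal].
  - intros K' t HK' Ht. specialize (Hdf t Ht). specialize (Hlate t Ht).
    apply Rle_trans with (K * tau q t ^ s); [lra|].
    apply Rmult_le_compat_r; [apply pow_le, Rlt_le, tau_pos|].
    apply Rle_trans with (K' * (mu / 2)); [|apply Rmult_le_compat_l; lra].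
    apply Rle_trans with (2 * K / mu * (mu / 2)); [right; field; lra|].
    apply Rmult_le_compat_r; lra.
Qed.

(** * The Cauchy problem for globally Lipschitz fields *)


(** Joint continuity, stated along curves: the form in which it enters Picard
    iteration and is preserved by changes of variables. *)
Definition field_continuous (g : R -> R -> R -> R) (D : R -> Prop) : Prop :=
  forall (th A B : R -> R) (t : R), D (th t) -> continuous th t -> continuous A t -> continuous B t ->
    continuous (fun s => g (th s) (A s) (B s)) t.

Definition everywhere (_ : R) : Prop := True.

Definition field_lipschitz (h : R -> R -> R -> R) : Prop :=
  forall T, exists L, 0 <= L /\ forall t a b a' b', Rabs t <= T ->
    Rabs (h t a' b' - h t a b) <= L * (Rabs (a' - a) + Rabs (b' - b)).

Definition solves (h1 h2 : R -> R -> R -> R) (A B : R -> R) : Prop :=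
  forall t, is_derive A t (h1 t (A t) (B t)) /\ is_derive B t (h2 t (A t) (B t)).

Lemma is_derive_continuous (f : R -> R) (t l : R) : is_derive f t l -> continuous f t.
Proof. intros H. apply (ex_derive_continuous f t). exists l. exact H. Qed.

Lemma is_derive_primitive (phi : R -> R) (t0 t : R) :
  (forall s, continuous phi s) -> is_derive (fun t => RInt phi t0 t) t (phi t).
Proof.
  intros Hc. apply (is_derive_RInt phi (fun t => RInt phi t0 t) t0 t); [|apply Hc].
  apply filter_forall. intros u. apply (@RInt_correct R_CompleteNormedModule).
  apply (@ex_RInt_continuous R_CompleteNormedModule). intros z _. apply Hc.
Qed.

(** Bielecki's weight: measured against [exp (lam * |t - t0|)], integration
    from [t0] contracts by the factor [1 / lam] on any interval. *)
Lemma exponential_bound (D d : R -> R) (t0 T M lam : R) :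
  0 < lam -> 0 <= M -> Rabs t0 <= T -> D t0 = 0 ->
  (forall s, is_derive D s (d s)) ->
  (forall s, Rabs s <= T -> Rabs (d s) <= M * exp (lam * Rabs (s - t0))) ->
  forall t, Rabs t <= T -> Rabs (D t) <= M / lam * exp (lam * Rabs (t - t0)).
Proof.
  intros Hlam HM HT0. revert D d.
  assert (HMl : 0 <= M / lam) by nonneg.
  assert (Half : forall D d, D t0 = 0 -> (forall s, is_derive D s (d s)) ->
    (forall s, Rabs s <= T -> Rabs (d s) <= M * exp (lam * Rabs (s - t0))) ->
    forall t, Rabs t <= T -> D t <= M / lam * exp (lam * Rabs (t - t0))).
  { intros D d HD0 HD Hd t Ht.
    apply Rabs_le_between in Ht. apply Rabs_le_between in HT0.
    destruct (Rle_lt_dec t0 t) as [Hle|Hlt].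
    - assert (H : M / lam * exp (lam * (t0 - t0)) - D t0 <= M / lam * exp (lam * (t - t0)) - D t).
      { apply (nondecreasing (fun s => M / lam * exp (lam * (s - t0)) - D s)
          (fun s => M * exp (lam * (s - t0)) - d s)) with (1 := Hle).
        - intros s Hs. apply @is_derive_minus; [|apply HD]. auto_derive; [exact I|]. unfold Rminus. field. lra.
        - intros s Hs. generalize (Hd s ltac:(apply Rabs_le; lra)).
          rewrite (Rabs_pos_eq (s - t0)) by lra.
          generalize (Rle_abs (d s)). lra. }
      rewrite HD0, Rminus_diag, Rmult_0_r, exp_0 in H. rewrite Rabs_pos_eq by lra. lra.
    - assert (H : - (M / lam * exp (lam * (t0 - t)) - D t) <=
                  - (M / lam * exp (lam * (t0 - t0)) - D t0)).
      { apply (nondecreasing (fun s => - (M / lam * exp (lam * (t0 - s)) - D s))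
          (fun s => M * exp (lam * (t0 - s)) + d s)) with (a := t) (b := t0); [lra| |].
        - intros s Hs. replace (M * exp (lam * (t0 - s)) + d s) with
            (opp (minus (- M * exp (lam * (t0 - s))) (d s)))
            by (unfold opp, minus, plus; simpl; unfold opp; simpl; ring).
          apply @is_derive_opp. apply @is_derive_minus; [|apply HD].
          auto_derive; [exact I|]. unfold Rminus. field. lra.
        - intros s Hs. generalize (Hd s ltac:(apply Rabs_le; lra)).
          rewrite Rabs_minus_sym, (Rabs_pos_eq (t0 - s)) by lra.
          generalize (Rabs_maj2 (d s)). lra. }
      rewrite HD0, Rminus_diag, Rmult_0_r, exp_0 in H.
      rewrite Rabs_minus_sym, Rabs_pos_eq by lra. lra. }
  intros D d HD0 HD Hd t Ht. apply Rabs_le. split.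
  - apply Ropp_le_cancel. rewrite Ropp_involutive.
    apply (Half (fun s => - D s) (fun s => - d s)); [rewrite HD0; ring| |
      intros s Hs; rewrite Rabs_Ropp; auto|exact Ht].
    intros s. apply @is_derive_opp. apply HD.
  - apply Half with d; assumption.
Qed.

Lemma half_pow_vanishes (x K : R) : (forall n, x <= K * (/ 2) ^ n) -> x <= 0.
Proof.
  intros H. apply (is_lim_seq_le (fun _ => x) (fun n => K * (/ 2) ^ n) x 0 H).
  - apply is_lim_seq_const.
  - replace (Finite 0) with (Rbar_mult K 0) by (simpl; f_equal; ring).
    apply is_lim_seq_scal_l. apply is_lim_seq_geom. rewrite Rabs_pos_eq; lra.
Qed.

Lemma geometric_tail (v : nat -> R) (C : R) :
  (forall n, Rabs (v (S n) - v n) <= C * (/ 2) ^ n) ->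
  forall n k, Rabs (v (n + k)%nat - v n) <= 2 * C * (/ 2) ^ n * (1 - (/ 2) ^ k).
Proof.
  intros H n k. induction k as [|k IH].
  - rewrite Nat.add_0_r, Rminus_diag, Rabs_R0. simpl. right. ring.
  - rewrite Nat.add_succ_r.
    replace (v (S (n + k)) - v n) with ((v (S (n + k)) - v (n + k)%nat) + (v (n + k)%nat - v n)) by ring.
    apply Rle_trans with (1 := Rabs_triang _ _).
    specialize (H (n + k)%nat). rewrite pow_add in H.
    simpl ((/ 2) ^ S k). lra.
Qed.

Lemma geometric_limit (v : nat -> R) (C : R) :
  (forall n, Rabs (v (S n) - v n) <= C * (/ 2) ^ n) ->
  forall n, Rabs (real (Lim_seq v) - v n) <= 2 * C * (/ 2) ^ n.
Proof.
  intros H.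
  assert (HC : 0 <= C).
  { specialize (H O). simpl in H. generalize (Rabs_pos (v 1%nat - v O)). lra. }
  assert (Htail : forall n k, Rabs (v (n + k)%nat - v n) <= 2 * C * (/ 2) ^ n).
  { intros n k. apply Rle_trans with (1 := geometric_tail v C H n k).
    rewrite <- (Rmult_1_r (2 * C * (/ 2) ^ n)) at 2. apply Rmult_le_compat_l.
    - apply Rmult_le_pos; [lra|apply pow_le; lra].
    - assert (0 <= (/ 2) ^ k) by nonneg. lra. }
  assert (Hlim : is_lim_seq v (real (Lim_seq v))).
  { apply Lim_seq_correct'. apply ex_lim_seq_cauchy_corr. intros eps.
    assert (exists N, 2 * C * (/ 2) ^ N < eps / 2) as [N HN].
    { apply NNPP. intros Hn.
      assert (eps / 2 <= 0).
      { apply half_pow_vanishes with (2 * C). intros n. apply Rnot_lt_le. intros Hlt.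
        apply Hn. exists n. exact Hlt. }
      generalize (cond_pos eps). lra. }
    exists N. intros n m Hn Hm.
    replace n with (N + (n - N))%nat by lia. replace m with (N + (m - N))%nat by lia.
    generalize (Htail N (n - N)%nat) (Htail N (m - N)%nat). intros E1 E2.
    replace (v (N + (n - N))%nat - v (N + (m - N))%nat) with
      ((v (N + (n - N))%nat - v N) - (v (N + (m - N))%nat - v N)) by ring.
    unfold Rminus at 1. apply Rle_lt_trans with (1 := Rabs_triang _ _). rewrite Rabs_Ropp. lra. }
  intros n.
  apply (is_lim_seq_le (fun k => Rabs (v (k + n)%nat - v n)) (fun _ => 2 * C * (/ 2) ^ n)
    (Rabs (real (Lim_seq v) - v n)) (2 * C * (/ 2) ^ n)).
  - intros k. rewrite Nat.add_comm. apply Htail.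
  - apply is_lim_seq_continuous with (f := fun x => Rabs (x - v n)) (u := fun k => v (k + n)%nat).
    + apply continuity_pt_filterlim.
      apply (continuous_comp (fun x => x - v n) Rabs); [|apply continuous_Rabs].
      apply (ex_derive_continuous (fun x => x - v n)). auto_derive. exact I.
    + apply is_lim_seq_incr_n. exact Hlim.
  - apply is_lim_seq_const.
Qed.

Fixpoint picard (h1 h2 : R -> R -> R -> R) (t0 a0 b0 : R) (n : nat) : (R -> R) * (R -> R) :=
  match n with
  | O => (fun _ => a0, fun _ => b0)
  | S n => let u := picard h1 h2 t0 a0 b0 n in
      (fun t => a0 + RInt (fun s => h1 s (fst u s) (snd u s)) t0 t,
       fun t => b0 + RInt (fun s => h2 s (fst u s) (snd u s)) t0 t)
  end.

Lemma field_continuous_along (h : R -> R -> R -> R) (A B : R -> R) :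
  field_continuous h everywhere ->
  (forall t, continuous A t) -> (forall t, continuous B t) ->
  forall t, continuous (fun s => h s (A s) (B s)) t.
Proof. intros Hh HA HB t. apply (Hh (fun s => s) A B t I); auto. apply continuous_id. Qed.

Lemma picard_continuous (h1 h2 : R -> R -> R -> R) (t0 a0 b0 : R) (n : nat) :
  field_continuous h1 everywhere -> field_continuous h2 everywhere ->
  forall t, continuous (fst (picard h1 h2 t0 a0 b0 n)) t /\
    continuous (snd (picard h1 h2 t0 a0 b0 n)) t.
Proof.
  intros H1 H2. induction n as [|n IH]; intros t; simpl.
  - split; apply continuous_const.
  - assert (HP : forall c phi, (forall s, continuous phi s) ->
      continuous (fun t => c + RInt phi t0 t) t).
    { intros c phi Hphi. apply (continuous_plus (fun _ => c)); [apply continuous_const|].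
      apply is_derive_continuous with (phi t). apply is_derive_primitive, Hphi. }
    assert (I1 := fun s => proj1 (IH s)). assert (I2 := fun s => proj2 (IH s)).
    split.
    + exact (HP a0 _ (field_continuous_along h1 _ _ H1 I1 I2)).
    + exact (HP b0 _ (field_continuous_along h2 _ _ H2 I1 I2)).
Qed.

Lemma bounded_on_interval (f : R -> R) (T : R) :
  (forall t, continuous f t) -> exists K, 0 <= K /\ forall t, Rabs t <= T -> f t <= K.
Proof.
  intros Hf. destruct (Rle_lt_dec 0 T) as [HT|HT].
  - destruct (continuity_ab_maj f (- T) T) as [m [Hm _]]; [lra| |].
    + intros c _. apply continuity_pt_filterlim, Hf.
    + exists (Rabs (f m)). split; [apply Rabs_pos|]. intros t Ht.
      apply Rle_trans with (2 := Rle_abs _). apply Hm. apply Rabs_le_between, Ht.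
  - exists 0. split; [lra|]. intros t Ht. generalize (Rabs_pos t). lra.
Qed.

Lemma is_derive_prim_minus (phi psi : R -> R) (c t0 t : R) :
  (forall s, continuous phi s) -> (forall s, continuous psi s) ->
  is_derive (fun t => (c + RInt phi t0 t) - (c + RInt psi t0 t)) t (phi t - psi t).
Proof.
  intros H1 H2.
  apply is_derive_ext with (fun t => minus (RInt phi t0 t) (RInt psi t0 t)).
  { intros s. unfold minus, plus, opp; simpl. ring. }
  apply @is_derive_minus; apply is_derive_primitive; assumption.
Qed.

Lemma picard_contraction (h1 h2 : R -> R -> R -> R) (t0 a0 b0 T : R) :
  field_continuous h1 everywhere -> field_continuous h2 everywhere ->
  field_lipschitz h1 -> field_lipschitz h2 -> Rabs t0 <= T ->
  let u := picard h1 h2 t0 a0 b0 in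
  exists lam C, 0 < lam /\ 0 <= C /\ forall n t, Rabs t <= T ->
    Rabs (fst (u (S n)) t - fst (u n) t) + Rabs (snd (u (S n)) t - snd (u n) t) <=
    C * (/ 2) ^ n * exp (lam * Rabs (t - t0)).
Proof.
  intros Hc1 Hc2 Hl1 Hl2 HT u.
  destruct (Hl1 T) as [L1 [HL1 HLip1]], (Hl2 T) as [L2 [HL2 HLip2]].
  assert (Hcu : forall n t, continuous (fst (u n)) t /\ continuous (snd (u n)) t).
  { intros n t. apply picard_continuous; assumption. }
  destruct (bounded_on_interval (fun t => Rabs (fst (u 1%nat) t - fst (u O) t) +
    Rabs (snd (u 1%nat) t - snd (u O) t)) T) as [C [HC HCb]].
  { intros t. destruct (Hcu 1%nat t) as [C1 C2], (Hcu O t) as [D1 D2].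
    apply (continuous_plus (fun t => Rabs (fst (u 1%nat) t - fst (u O) t))); apply continuous_Rabs_comp;
      [apply (continuous_minus (fst (u 1%nat)))|apply (continuous_minus (snd (u 1%nat)))]; assumption. }
  set (lam := 2 * (L1 + L2) + 1). exists lam, C.
  assert (Hlam : 0 < lam) by (unfold lam; lra).
  split; [exact Hlam|]. split; [exact HC|].
  induction n as [|n IH]; intros t Ht.
  - apply Rle_trans with (1 := HCb t Ht). simpl. rewrite Rmult_1_r, <- (Rmult_1_r C) at 1.
    apply Rmult_le_compat_l; [exact HC|]. rewrite <- exp_0.
    assert (0 <= lam * Rabs (t - t0)) by nonneg.
    destruct H as [H|<-]; [apply Rlt_le, exp_increasing, H|lra].
  - assert (HB : forall h L c, field_continuous h everywhere -> 0 <= L ->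
      (forall t a b a' b', Rabs t <= T ->
        Rabs (h t a' b' - h t a b) <= L * (Rabs (a' - a) + Rabs (b' - b))) ->
      Rabs ((c + RInt (fun s => h s (fst (u (S n)) s) (snd (u (S n)) s)) t0 t) -
            (c + RInt (fun s => h s (fst (u n) s) (snd (u n) s)) t0 t)) <=
        L * (C * (/ 2) ^ n) / lam * exp (lam * Rabs (t - t0))).
    { intros h L c Hh HL HLip.
      apply (exponential_bound
        (fun t => (c + RInt (fun s => h s (fst (u (S n)) s) (snd (u (S n)) s)) t0 t) -
            (c + RInt (fun s => h s (fst (u n) s) (snd (u n) s)) t0 t))
        (fun s => h s (fst (u (S n)) s) (snd (u (S n)) s) - h s (fst (u n) s) (snd (u n) s)) t0 T);
        try assumption.
      - apply Rmult_le_pos; [exact HL|]. apply Rmult_le_pos; [exact HC|apply pow_le; lra].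
      - rewrite !RInt_point. unfold zero; simpl. ring.
      - intros s. exact (is_derive_prim_minus _ _ c t0 s
          (field_continuous_along h _ _ Hh (fun r => proj1 (Hcu (S n) r)) (fun r => proj2 (Hcu (S n) r)))
          (field_continuous_along h _ _ Hh (fun r => proj1 (Hcu n r)) (fun r => proj2 (Hcu n r)))).
      - intros s Hs. apply Rle_trans with (1 := HLip _ _ _ _ _ Hs).
        rewrite Rmult_assoc. apply Rmult_le_compat_l; [exact HL|]. apply IH, Hs. }
    generalize (HB h1 L1 a0 Hc1 HL1 HLip1) (HB h2 L2 b0 Hc2 HL2 HLip2). intros E1 E2.
    apply Rle_trans with (L1 * (C * (/ 2) ^ n) / lam * exp (lam * Rabs (t - t0)) +
      L2 * (C * (/ 2) ^ n) / lam * exp (lam * Rabs (t - t0))).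
    + apply Rplus_le_compat; [exact E1|exact E2].
    + rewrite <- Rmult_plus_distr_r. apply Rmult_le_compat_r; [apply Rlt_le, exp_pos|].
      replace (L1 * (C * (/ 2) ^ n) / lam + L2 * (C * (/ 2) ^ n) / lam) with
        ((L1 + L2) / lam * (C * (/ 2) ^ n)) by (field; lra).
      simpl. replace (C * (/ 2 * (/ 2) ^ n)) with (/ 2 * (C * (/ 2) ^ n)) by ring.
      apply Rmult_le_compat_r; [apply Rmult_le_pos; [exact HC|apply pow_le; lra]|].
      apply Rmult_le_reg_r with lam; [exact Hlam|]. unfold Rdiv.
      rewrite Rmult_assoc, Rinv_l by lra. unfold lam. lra.
Qed.

(** The Lipschitz constant is uniform in space on bounded intervals of time, so the
    iterates converge on the whole line, on both sides of [t0]. *)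
Lemma cauchy_lipschitz (h1 h2 : R -> R -> R -> R) (t0 a0 b0 : R) :
  field_continuous h1 everywhere -> field_continuous h2 everywhere ->
  field_lipschitz h1 -> field_lipschitz h2 ->
  exists A B, A t0 = a0 /\ B t0 = b0 /\ solves h1 h2 A B.
Proof.
  intros Hc1 Hc2 Hl1 Hl2. set (u := picard h1 h2 t0 a0 b0).
  assert (Hcu : forall n t, continuous (fst (u n)) t /\ continuous (snd (u n)) t).
  { intros n t. apply picard_continuous; assumption. }
  set (A := fun t => real (Lim_seq (fun n => fst (u n) t))).
  set (B := fun t => real (Lim_seq (fun n => snd (u n) t))).
  assert (Hconv : forall T, Rabs t0 <= T -> exists lam C, 0 < lam /\ 0 <= C /\
    forall n t, Rabs t <= T ->
      Rabs (A t - fst (u n) t) <= C * (/ 2) ^ n * exp (lam * Rabs (t - t0)) /\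
      Rabs (B t - snd (u n) t) <= C * (/ 2) ^ n * exp (lam * Rabs (t - t0))).
  { intros T HT.
    destruct (picard_contraction h1 h2 t0 a0 b0 T) as [lam [C [Hlam [HC H]]]]; try assumption.
    exists lam, (2 * C). split; [exact Hlam|]. split; [lra|]. intros n t Ht.
    specialize (fun n => H n t Ht). fold u in H.
    assert (G1 : forall n, Rabs (fst (u (S n)) t - fst (u n) t) <=
      (C * exp (lam * Rabs (t - t0))) * (/ 2) ^ n).
    { intros k. specialize (H k). generalize (Rabs_pos (snd (u (S k)) t - snd (u k) t)). lra. }
    assert (G2 : forall n, Rabs (snd (u (S n)) t - snd (u n) t) <=
      (C * exp (lam * Rabs (t - t0))) * (/ 2) ^ n).
    { intros k. specialize (H k). generalize (Rabs_pos (fst (u (S k)) t - fst (u k) t)). lra. }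
    split.
    - generalize (geometric_limit (fun n => fst (u n) t) _ G1 n). unfold A. lra.
    - generalize (geometric_limit (fun n => snd (u n) t) _ G2 n). unfold B. lra. }
  assert (Hexp : forall lam t T, 0 < lam -> Rabs t0 <= T -> Rabs t <= T ->
    exp (lam * Rabs (t - t0)) <= exp (lam * (2 * T))).
  { intros lam t T Hlam HT Ht.
    assert (Rabs (t - t0) <= 2 * T).
    { unfold Rminus. apply Rle_trans with (1 := Rabs_triang _ _). rewrite Rabs_Ropp. lra. }
    assert (lam * Rabs (t - t0) <= lam * (2 * T)) by nonneg.
    destruct H0 as [H0| ->]; [apply Rlt_le, exp_increasing, H0|lra]. }
  (* A locally uniform limit of continuous functions is continuous. *)
  assert (Hlimcont : forall (Z : R -> R) (z : nat -> R -> R), (forall n t, continuous (z n) t) ->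
    (forall T, Rabs t0 <= T -> exists K, forall n t, Rabs t <= T ->
      Rabs (Z t - z n t) <= K * (/ 2) ^ n) -> forall t, continuous Z t).
  { intros Z z Hz HZ t. apply continuity_pt_filterlim. intros eps Heps.
    destruct (HZ (Rmax (Rabs t0) (Rabs t + 1)) (Rmax_l _ _)) as [K HK].
    assert (exists N, K * (/ 2) ^ N < eps / 3) as [N HN].
    { apply NNPP. intros Hn.
      assert (eps / 3 <= 0); [|lra].
      apply half_pow_vanishes with K. intros n. apply Rnot_lt_le. intros Hlt.
      apply Hn. exists n. exact Hlt. }
    specialize (HK N).
    destruct (proj2 (continuity_pt_filterlim (z N) t) (Hz N t) (eps / 3) ltac:(lra)) as [d [Hd1 Hd2]].
    exists (Rmin d 1). split; [apply Rmin_glb_lt; lra|]. intros s [Hs1 Hs2].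
    simpl in *. unfold Rdist in *.
    assert (Rabs (s - t) < d) by (apply Rlt_le_trans with (1 := Hs2), Rmin_l).
    assert (Rabs (s - t) < 1) by (apply Rlt_le_trans with (1 := Hs2), Rmin_r).
    specialize (Hd2 s (conj Hs1 H)).
    assert (Rabs s <= Rmax (Rabs t0) (Rabs t + 1)).
    { apply Rle_trans with (2 := Rmax_r _ _).
      replace s with (t + (s - t)) by ring. apply Rle_trans with (1 := Rabs_triang _ _). lra. }
    assert (Rabs t <= Rmax (Rabs t0) (Rabs t + 1)).
    { apply Rle_trans with (2 := Rmax_r _ _). lra. }
    assert (E1 := HK s H1). assert (E2 := HK t H2). rewrite Rabs_minus_sym in E2.
    replace (Z s - Z t) with ((Z s - z N s) + (z N s - z N t) + (z N t - Z t)) by ring.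
    generalize (Rabs_triang ((Z s - z N s) + (z N s - z N t)) (z N t - Z t))
      (Rabs_triang (Z s - z N s) (z N s - z N t)). lra. }
  assert (Hunif : forall T, Rabs t0 <= T -> exists K, forall n t, Rabs t <= T ->
      Rabs (A t - fst (u n) t) <= K * (/ 2) ^ n /\ Rabs (B t - snd (u n) t) <= K * (/ 2) ^ n).
  { intros T HT. destruct (Hconv T HT) as [lam [C [Hlam [HC H]]]].
    exists (C * exp (lam * (2 * T))). intros n t Ht. destruct (H n t Ht) as [E1 E2].
    assert (C * (/ 2) ^ n * exp (lam * Rabs (t - t0)) <= C * exp (lam * (2 * T)) * (/ 2) ^ n).
    { replace (C * exp (lam * (2 * T)) * (/ 2) ^ n) with (C * (/ 2) ^ n * exp (lam * (2 * T))) by ring.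
      apply Rmult_le_compat_l; [apply Rmult_le_pos; [exact HC|apply pow_le; lra]|].
      apply Hexp; assumption. }
    lra. }
  assert (HcA : forall t, continuous A t).
  { apply (Hlimcont A (fun n => fst (u n)) (fun n t => proj1 (Hcu n t))). intros T HT.
    destruct (Hunif T HT) as [K HK]. exists K. intros n t Ht. apply HK, Ht. }
  assert (HcB : forall t, continuous B t).
  { apply (Hlimcont B (fun n => snd (u n)) (fun n t => proj2 (Hcu n t))). intros T HT.
    destruct (Hunif T HT) as [K HK]. exists K. intros n t Ht. apply HK, Ht. }
  (* Both sides of the integral equation are within [O(2 ^ -n)] of the same iterate. *)
  assert (Hfix : forall h c (Z : R -> R) (z : nat -> R -> R),
    field_continuous h everywhere -> field_lipschitz h ->
    (forall n t, z (S n) t = c + RInt (fun s => h s (fst (u n) s) (snd (u n) s)) t0 t) ->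
    (forall T, Rabs t0 <= T -> exists K, forall n t, Rabs t <= T -> Rabs (Z t - z n t) <= K * (/ 2) ^ n) ->
    forall t, Z t = c + RInt (fun s => h s (A s) (B s)) t0 t).
  { intros h c Z z Hch Hlh Hz HZ t.
    set (T := Rmax (Rabs t0) (Rabs t)).
    assert (HT0 : Rabs t0 <= T) by apply Rmax_l. assert (HT : Rabs t <= T) by apply Rmax_r.
    destruct (Hconv T HT0) as [lam [C [Hlam [HC H]]]].
    destruct (Hlh T) as [L [HL HLip]]. destruct (HZ T HT0) as [K HK].
    apply Rminus_diag_uniq, Rabs_eq_0, Rle_antisym; [|apply Rabs_pos].
    apply half_pow_vanishes with (K / 2 + L * (2 * C) / lam * exp (lam * Rabs (t - t0))).
    intros n. specialize (HK (S n) t HT).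
    assert (E : Rabs ((c + RInt (fun s => h s (fst (u n) s) (snd (u n) s)) t0 t) -
      (c + RInt (fun s => h s (A s) (B s)) t0 t)) <=
      L * (2 * C * (/ 2) ^ n) / lam * exp (lam * Rabs (t - t0))).
    { apply (exponential_bound
        (fun t => (c + RInt (fun s => h s (fst (u n) s) (snd (u n) s)) t0 t) -
          (c + RInt (fun s => h s (A s) (B s)) t0 t))
        (fun s => h s (fst (u n) s) (snd (u n) s) - h s (A s) (B s)) t0 T); try assumption.
      - apply Rmult_le_pos; [exact HL|]. apply Rmult_le_pos; [lra|apply pow_le; lra].
      - rewrite !RInt_point. unfold zero; simpl. ring.
      - intros s. exact (is_derive_prim_minus _ _ c t0 s
          (field_continuous_along h _ _ Hch (fun r => proj1 (Hcu n r)) (fun r => proj2 (Hcu n r)))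
          (field_continuous_along h _ _ Hch HcA HcB)).
      - intros s Hs. apply Rle_trans with (1 := HLip _ _ _ _ _ Hs).
        rewrite Rmult_assoc. apply Rmult_le_compat_l; [exact HL|].
        destruct (H n s Hs) as [E1 E2]. rewrite Rabs_minus_sym in E1. rewrite Rabs_minus_sym in E2.
        lra. }
    rewrite <- Hz in E.
    replace (Z t - (c + RInt (fun s => h s (A s) (B s)) t0 t)) with
      ((Z t - z (S n) t) + (z (S n) t - (c + RInt (fun s => h s (A s) (B s)) t0 t))) by ring.
    apply Rle_trans with (1 := Rabs_triang _ _).
    simpl in HK. rewrite Rmult_plus_distr_r. apply Rplus_le_compat; [lra|].
    apply Rle_trans with (1 := E). right. unfold Rdiv. ring. }
  assert (EA : forall t, A t = a0 + RInt (fun s => h1 s (A s) (B s)) t0 t).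
  { apply (Hfix h1 a0 A (fun n => fst (u n))); try assumption; [reflexivity|].
    intros T HT. destruct (Hunif T HT) as [K HK]. exists K. intros n t Ht. apply HK, Ht. }
  assert (EB : forall t, B t = b0 + RInt (fun s => h2 s (A s) (B s)) t0 t).
  { apply (Hfix h2 b0 B (fun n => snd (u n))); try assumption; [reflexivity|].
    intros T HT. destruct (Hunif T HT) as [K HK]. exists K. intros n t Ht. apply HK, Ht. }
  assert (Hder : forall h c (Z : R -> R), field_continuous h everywhere ->
    (forall t, Z t = c + RInt (fun s => h s (A s) (B s)) t0 t) ->
    forall t, is_derive Z t (h t (A t) (B t))).
  { intros h c Z Hh HZ t.
    apply is_derive_ext with (fun t => plus c (RInt (fun s => h s (A s) (B s)) t0 t)).
    - intros s. symmetry. apply HZ.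
    - replace (h t (A t) (B t)) with (plus zero (h t (A t) (B t))) by apply plus_zero_l.
      apply @is_derive_plus; [apply @is_derive_const|].
      apply (is_derive_primitive (fun s => h s (A s) (B s))).
      apply field_continuous_along; assumption. }
  exists A, B. split; [|split].
  - rewrite EA, RInt_point. unfold zero; simpl. ring.
  - rewrite EB, RInt_point. unfold zero; simpl. ring.
  - intros t. split; [apply Hder with a0|apply Hder with b0]; assumption.
Qed.

(** The squared distance of two solutions grows at most exponentially. *)
Lemma gronwall (h1 h2 : R -> R -> R -> R) (t0 T : R) :
  field_lipschitz h1 -> field_lipschitz h2 -> 0 <= t0 <= T ->
  exists K, 0 <= K /\ forall A B A' B', solves h1 h2 A B -> solves h1 h2 A' B' ->
    forall t, t0 <= t <= T ->
    Rabs (A' t - A t) <= K * (Rabs (A' t0 - A t0) + Rabs (B' t0 - B t0)) /\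
    Rabs (B' t - B t) <= K * (Rabs (A' t0 - A t0) + Rabs (B' t0 - B t0)).
Proof.
  intros Hl1 Hl2 HT.
  destruct (Hl1 T) as [L1 [HL1 HLip1]], (Hl2 T) as [L2 [HL2 HLip2]].
  set (L := 4 * (L1 + L2)). set (K2 := exp (L * (T - t0))).
  exists (sqrt K2). split; [apply sqrt_pos|]. intros A B A' B' HS HS' t Ht.
  set (E := fun t => (A' t - A t) ^ 2 + (B' t - B t) ^ 2).
  set (dE := fun t => 2 * (A' t - A t) * (h1 t (A' t) (B' t) - h1 t (A t) (B t)) +
    2 * (B' t - B t) * (h2 t (A' t) (B' t) - h2 t (A t) (B t))).
  assert (HdE : forall s, is_derive E s (dE s)).
  { intros s. destruct (HS s) as [D1 D2], (HS' s) as [D1' D2']. unfold E, dE.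
    auto_derive.
    - repeat split; eexists; eassumption.
    - replace (Derive (fun x => A x) s) with (h1 s (A s) (B s)) by (symmetry; apply is_derive_unique, D1).
      replace (Derive (fun x => B x) s) with (h2 s (A s) (B s)) by (symmetry; apply is_derive_unique, D2).
      replace (Derive (fun x => A' x) s) with (h1 s (A' s) (B' s)) by (symmetry; apply is_derive_unique, D1').
      replace (Derive (fun x => B' x) s) with (h2 s (A' s) (B' s)) by (symmetry; apply is_derive_unique, D2').
      ring. }
  assert (Hineq : forall s, t0 <= s <= T -> dE s <= L * E s).
  { intros s Hs.
    assert (HsT : Rabs s <= T) by (rewrite Rabs_pos_eq; lra).
    specialize (HLip1 s (A s) (B s) (A' s) (B' s) HsT).
    specialize (HLip2 s (A s) (B s) (A' s) (B' s) HsT).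
    unfold dE, E, L. set (x := A' s - A s) in *. set (y := B' s - B s) in *.
    set (p := h1 s (A' s) (B' s) - h1 s (A s) (B s)) in *.
    set (r := h2 s (A' s) (B' s) - h2 s (A s) (B s)) in *.
    assert (Q1 : x * p <= Rabs x * (L1 * (Rabs x + Rabs y))).
    { apply Rle_trans with (1 := Rle_abs _). rewrite Rabs_mult.
      apply Rmult_le_compat_l; [apply Rabs_pos|exact HLip1]. }
    assert (Q2 : y * r <= Rabs y * (L2 * (Rabs x + Rabs y))).
    { apply Rle_trans with (1 := Rle_abs _). rewrite Rabs_mult.
      apply Rmult_le_compat_l; [apply Rabs_pos|exact HLip2]. }
    assert (S1 : x ^ 2 = Rabs x ^ 2) by (rewrite pow2_abs; reflexivity).
    assert (S2 : y ^ 2 = Rabs y ^ 2) by (rewrite pow2_abs; reflexivity).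
    rewrite S1, S2. set (X := Rabs x) in *. set (Y := Rabs y) in *.
    assert (X * (X + Y) <= 2 * (X ^ 2 + Y ^ 2)) by nra.
    assert (Y * (X + Y) <= 2 * (X ^ 2 + Y ^ 2)) by nra.
    nra. }
  assert (HE : E t <= K2 * E t0).
  { assert (H : exp (- L * t0) * (0 - E t0) <= exp (- L * t) * (0 - E t)).
    { apply (weighted_comparison (fun s => exp (- L * s)) (fun _ => - L) (fun _ => 0) (fun _ => 0) E dE);
        try lra; intros s Hs.
      - split; [apply exp_pos|apply is_derive_exp_scal].
      - split; [apply @is_derive_const|apply HdE].
      - specialize (Hineq s ltac:(lra)). lra. }
    apply Rmult_le_reg_l with (exp (- L * t)); [apply exp_pos|].
    apply Rle_trans with (exp (- L * t0) * E t0); [lra|].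
    unfold K2. rewrite <- Rmult_assoc, <- exp_plus.
    apply Rmult_le_compat_r; [apply Rplus_le_le_0_compat; apply pow2_ge_0|].
    assert (0 <= L) by nonneg.
    assert (HH : - L * t0 <= - L * t + L * (T - t0)) by nra.
    destruct HH as [HH|HH]; [apply Rlt_le, exp_increasing, HH|rewrite HH; lra]. }
  assert (HK2 : 0 <= K2) by nonneg.
  set (d := Rabs (A' t0 - A t0) + Rabs (B' t0 - B t0)).
  assert (Hd0 : 0 <= d) by nonneg.
  assert (HE0 : E t0 <= d ^ 2).
  { unfold E, d. rewrite <- (pow2_abs (A' t0 - A t0)), <- (pow2_abs (B' t0 - B t0)).
    generalize (Rabs_pos (A' t0 - A t0)) (Rabs_pos (B' t0 - B t0)). intros. nra. }
  assert (Hfin : E t <= (sqrt K2 * d) ^ 2).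
  { rewrite Rpow_mult_distr, pow2_sqrt by exact HK2.
    apply Rle_trans with (1 := HE). apply Rmult_le_compat_l; assumption. }
  assert (Hkd : 0 <= sqrt K2 * d) by (apply Rmult_le_pos; [apply sqrt_pos|exact Hd0]).
  assert (Hsq : forall x y : R, 0 <= y -> x ^ 2 <= y ^ 2 -> x <= y).
  { intros x y Hy Hxy. apply Rnot_lt_le. intros Hlt. nra. }
  split; apply Hsq; try exact Hkd; rewrite pow2_abs;
    (apply Rle_trans with (2 := Hfin);
     change (E t) with ((A' t - A t) ^ 2 + (B' t - B t) ^ 2);
     generalize (pow2_ge_0 (A' t - A t)) (pow2_ge_0 (B' t - B t)); lra).
Qed.

(** * Orbits trapped in a shrinking tube *)


Definition clamp (r x : R) : R := Rmax (- r) (Rmin r x).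

Lemma clamp_bound (r x : R) : 0 <= r -> Rabs (clamp r x) <= r.
Proof.
  intros Hr. unfold clamp. apply Rabs_le. split; [apply Rmax_l|].
  apply Rmax_lub; [lra|apply Rmin_l].
Qed.

Lemma clamp_id (r x : R) : Rabs x <= r -> clamp r x = x.
Proof.
  intros H. apply Rabs_le_between in H. unfold clamp.
  rewrite Rmin_right, Rmax_right; lra.
Qed.

Lemma clamp_above (r x : R) : 0 <= r -> r <= x -> clamp r x = r.
Proof. intros Hr H. unfold clamp. rewrite Rmin_left, Rmax_right; lra. Qed.

Lemma clamp_below (r x : R) : 0 <= r -> x <= - r -> clamp r x = - r.
Proof. intros Hr H. unfold clamp. rewrite Rmin_right, Rmax_left; lra. Qed.

Lemma clamp_lipschitz (r x y : R) : Rabs (clamp r x - clamp r y) <= Rabs (x - y).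
Proof.
  unfold clamp, Rmin. destruct (Rle_dec r x), (Rle_dec r y); unfold Rmax;
    repeat match goal with |- context [Rle_dec ?a ?b] => destruct (Rle_dec a b) end;
    unfold Rabs; repeat match goal with |- context [Rcase_abs ?a] => destruct (Rcase_abs a) end; lra.
Qed.

Lemma continuous_Rmax_comp (f g : R -> R) (t : R) :
  continuous f t -> continuous g t -> continuous (fun s => Rmax (f s) (g s)) t.
Proof.
  intros Hf Hg. apply continuous_ext with (fun s => (f s + g s + Rabs (f s - g s)) * / 2).
  { intros s. unfold Rmax, Rabs. destruct (Rle_dec (f s) (g s)), (Rcase_abs (f s - g s)); lra. }
  apply (continuous_mult (fun s => f s + g s + Rabs (f s - g s)) (fun _ => / 2)).
  - apply (continuous_plus (fun s => f s + g s) (fun s => Rabs (f s - g s))).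
    + apply (continuous_plus f g); assumption.
    + apply (continuous_comp (fun s => f s - g s) Rabs); [|apply continuous_Rabs].
      apply (continuous_minus f g); assumption.
  - apply continuous_const.
Qed.

Lemma continuous_clamp (r x : R -> R) (t : R) :
  continuous r t -> continuous x t -> continuous (fun s => clamp (r s) (x s)) t.
Proof.
  intros Hr Hx. unfold clamp. apply continuous_Rmax_comp.
  - apply (continuous_opp r). exact Hr.
  - apply continuous_ext with (fun s => - Rmax (- r s) (- x s)).
    + intros s. unfold Rmax, Rmin. destruct (Rle_dec (- r s) (- x s)), (Rle_dec (r s) (x s)); lra.
    + apply (continuous_opp (fun s => Rmax (- r s) (- x s))).
      apply continuous_Rmax_comp; [apply (continuous_opp r)|apply (continuous_opp x)]; assumption.
Qed.

Definition locally_lipschitz (g : R -> R -> R -> R) : Prop :=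
  forall T1 T2 r, 0 < T1 -> exists L, 0 <= L /\ forall t a b a' b', T1 <= t <= T2 ->
    Rabs a <= r -> Rabs b <= r -> Rabs a' <= r -> Rabs b' <= r ->
    Rabs (g t a' b' - g t a b) <= L * (Rabs (a' - a) + Rabs (b' - b)).

Definition positive_time (t : R) : Prop := 0 < t.

(** The field [g] in the square tube of half-width [r], extended constantly
    across the sides of the tube and before the time [t0]: the extension is
    globally Lipschitz and has the same orbits inside the tube. *)
Definition tube_field (t0 : R) (r : R -> R) (g : R -> R -> R -> R) (t a b : R) : R :=
  g (Rmax t0 t) (clamp (r (Rmax t0 t)) a) (clamp (r (Rmax t0 t)) b).

Lemma tube_field_continuous (t0 : R) (r : R -> R) (g : R -> R -> R -> R) :
  0 < t0 -> field_continuous g positive_time -> (forall t, 0 < t -> continuous r t) ->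
  field_continuous (tube_field t0 r g) everywhere.
Proof.
  intros Ht0 Hg Hr th A B t _ Hth HA HB. unfold tube_field.
  assert (Hmax : continuous (fun s => Rmax t0 (th s)) t).
  { apply continuous_Rmax_comp; [apply continuous_const|exact Hth]. }
  assert (Hpos : 0 < Rmax t0 (th t)) by (apply Rlt_le_trans with t0; [exact Ht0|apply Rmax_l]).
  assert (Hrm : continuous (fun s => r (Rmax t0 (th s))) t).
  { apply (continuous_comp (fun s => Rmax t0 (th s)) r); [exact Hmax|apply Hr, Hpos]. }
  apply (Hg (fun s => Rmax t0 (th s)) (fun s => clamp (r (Rmax t0 (th s))) (A s))
    (fun s => clamp (r (Rmax t0 (th s))) (B s))); try assumption;
    apply continuous_clamp; assumption.
Qed.

Lemma tube_field_lipschitz (t0 : R) (r : R -> R) (g : R -> R -> R -> R) :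
  0 < t0 -> locally_lipschitz g -> (forall t, t0 <= t -> 0 <= r t <= 1) ->
  field_lipschitz (tube_field t0 r g).
Proof.
  intros Ht0 Hg Hr T. destruct (Hg t0 (Rmax t0 T) 1 Ht0) as [L [HL H]].
  exists L. split; [exact HL|]. intros t a b a' b' Ht. unfold tube_field.
  assert (H1 : t0 <= Rmax t0 t) by apply Rmax_l.
  assert (H2 : Rmax t0 t <= Rmax t0 T).
  { apply Rmax_lub; [apply Rmax_l|]. apply Rle_trans with (2 := Rmax_r _ _).
    apply Rle_trans with (2 := Ht). apply Rle_abs. }
  specialize (Hr (Rmax t0 t) H1).
  assert (Hc : forall x, Rabs (clamp (r (Rmax t0 t)) x) <= 1).
  { intros x. apply Rle_trans with (r (Rmax t0 t)); [apply clamp_bound|]; lra. }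
  apply Rle_trans with (1 := H (Rmax t0 t) _ _ _ _ (conj H1 H2) (Hc a) (Hc b) (Hc a') (Hc b')).
  apply Rmult_le_compat_l; [exact HL|]. apply Rplus_le_compat; apply clamp_lipschitz.
Qed.

Lemma tube_field_inside (t0 : R) (r : R -> R) (g : R -> R -> R -> R) (t a b : R) :
  t0 <= t -> Rabs a <= r t -> Rabs b <= r t -> tube_field t0 r g t a b = g t a b.
Proof.
  intros Ht Ha Hb. unfold tube_field. rewrite Rmax_right by exact Ht.
  rewrite !clamp_id by assumption. reflexivity.
Qed.

Lemma cluster_point (u : nat -> R) (K : R) :
  (forall n, Rabs (u n) <= K) ->
  exists l, forall eps N, 0 < eps -> exists n, (N <= n)%nat /\ Rabs (u n - l) < eps.
Proof.
  intros H. destruct (Bolzano_Weierstrass u (fun c => - K <= c <= K)) as [l Hl].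
  - apply compact_P3.
  - intros n. apply Rabs_le_between, H.
  - exists l. intros eps N Heps.
    destruct (Hl (fun x => Rabs (x - l) < eps) N) as [n [Hn1 Hn2]].
    + exists (mkposreal eps Heps). intros x Hx. exact Hx.
    + exists n. split; assumption.
Qed.

Lemma cluster_point_2d (u v : nat -> R) (K : R) :
  (forall n, Rabs (u n) <= K) -> (forall n, Rabs (v n) <= K) ->
  exists l m, forall eps N, 0 < eps ->
    exists n, (N <= n)%nat /\ Rabs (u n - l) < eps /\ Rabs (v n - m) < eps.
Proof.
  intros Hu Hv. destruct (cluster_point u K Hu) as [l Hl].
  assert (Hsub : forall k, exists n, (k <= n)%nat /\ Rabs (u n - l) < / (INR k + 1)) by nonneg.
  set (s := fun k => proj1_sig (constructive_indefinite_description _ (Hsub k))).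
  assert (Hs : forall k, (k <= s k)%nat /\ Rabs (u (s k) - l) < / (INR k + 1)).
  { intros k. exact (proj2_sig (constructive_indefinite_description _ (Hsub k))). }
  destruct (cluster_point (fun k => v (s k)) K) as [m Hm]; [intros; apply Hv|].
  exists l, m. intros eps N Heps.
  destruct (archimed_cor1 eps Heps) as [M [HM1 HM2]].
  destruct (Hm eps (Nat.max N M) Heps) as [k [Hk1 Hk2]].
  destruct (Hs k) as [Hs1 Hs2]. exists (s k). split; [lia|]. split; [|exact Hk2].
  apply Rlt_trans with (1 := Hs2). apply Rle_lt_trans with (2 := HM1).
  apply Rinv_le_contravar; [apply lt_0_INR, HM2|].
  apply Rle_trans with (INR k); [apply le_INR; lia|lra].
Qed.

(** Compactness replaces uniqueness here: the solutions that stay in the tube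
    up to time [t0 + n] need not converge, but a cluster point of their
    initial values gives one that never leaves. *)
Lemma trapped_forever (h1 h2 : R -> R -> R -> R) (r : R -> R) (t0 : R) :
  field_continuous h1 everywhere -> field_continuous h2 everywhere ->
  field_lipschitz h1 -> field_lipschitz h2 -> 0 <= t0 ->
  (forall n, exists A B, solves h1 h2 A B /\
    forall t, t0 <= t <= t0 + INR n -> Rabs (A t) <= r t /\ Rabs (B t) <= r t) ->
  exists A B, solves h1 h2 A B /\ forall t, t0 <= t -> Rabs (A t) <= r t /\ Rabs (B t) <= r t.
Proof.
  intros Hc1 Hc2 Hl1 Hl2 Ht0 H.
  assert (H' : forall n, exists Z : (R -> R) * (R -> R), solves h1 h2 (fst Z) (snd Z) /\
    forall t, t0 <= t <= t0 + INR n -> Rabs (fst Z t) <= r t /\ Rabs (snd Z t) <= r t).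
  { intros n. destruct (H n) as [A [B HAB]]. exists (A, B). exact HAB. }
  set (Z := fun n => proj1_sig (constructive_indefinite_description _ (H' n))).
  assert (HZ : forall n, solves h1 h2 (fst (Z n)) (snd (Z n)) /\
    forall t, t0 <= t <= t0 + INR n -> Rabs (fst (Z n) t) <= r t /\ Rabs (snd (Z n) t) <= r t).
  { intros n. exact (proj2_sig (constructive_indefinite_description _ (H' n))). }
  clearbody Z. clear H H'.
  assert (Hn0 : forall n, t0 <= t0 <= t0 + INR n) by (intros n; generalize (pos_INR n); lra).
  destruct (cluster_point_2d (fun n => fst (Z n) t0) (fun n => snd (Z n) t0) (r t0))
    as [a [b Hab]].
  { intros n. apply (proj2 (HZ n) t0 (Hn0 n)). }
  { intros n. apply (proj2 (HZ n) t0 (Hn0 n)). }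
  destruct (cauchy_lipschitz h1 h2 t0 a b) as [A [B [HA [HB HS]]]]; try assumption.
  exists A, B. split; [exact HS|]. intros t Ht.
  destruct (gronwall h1 h2 t0 t) as [K [HK HG]]; try assumption; [lra|].
  destruct (INR_unbounded (t - t0)) as [N HN].
  assert (Hclose : forall eps, 0 < eps -> Rabs (A t) <= r t + eps /\ Rabs (B t) <= r t + eps).
  { intros eps Heps.
    assert (Hd : 0 < eps / (2 * (K + 1))) by (apply Rdiv_lt_0_compat; lra).
    destruct (Hab _ N Hd) as [n [Hn [E1 E2]]].
    destruct (HZ n) as [HSn HTn].
    assert (HNn : INR N <= INR n) by nonneg.
    destruct (HTn t ltac:(lra)) as [T1 T2].
    destruct (HG _ _ _ _ HSn HS t ltac:(lra)) as [G1 G2].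
    rewrite HA, HB in G1, G2. rewrite Rabs_minus_sym in E1. rewrite Rabs_minus_sym in E2.
    assert (Hsmall : K * (Rabs (a - fst (Z n) t0) + Rabs (b - snd (Z n) t0)) <= eps).
    { apply Rle_trans with (K * (2 * (eps / (2 * (K + 1))))).
      - apply Rmult_le_compat_l; lra.
      - apply Rle_trans with ((K + 1) * (2 * (eps / (2 * (K + 1))))).
        + apply Rmult_le_compat_r; lra.
        + right. field. lra. }
    split.
    - replace (A t) with (fst (Z n) t + (A t - fst (Z n) t)) by ring.
      apply Rle_trans with (1 := Rabs_triang _ _). lra.
    - replace (B t) with (snd (Z n) t + (B t - snd (Z n) t)) by ring.
      apply Rle_trans with (1 := Rabs_triang _ _). lra. }
  split; apply le_epsilon; intros eps Heps; apply Hclose; exact Heps.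
Qed.

(** * Energy near a center *)


Lemma eventually_time_tau (q : nat) (P : R -> Prop) :
  (0 < q)%nat -> at_right 0 P -> Rbar_locally p_infty (fun t => P (tau q t)).
Proof. intros Hq HP. exact (tau_filterlim q Hq P HP). Qed.

Lemma eventually_gt (T : R) : Rbar_locally p_infty (fun t => T < t).
Proof. exists T. auto. Qed.

Lemma eventually_tau_lt (q : nat) (d : R) :
  (0 < q)%nat -> 0 < d -> Rbar_locally p_infty (fun t => 0 < tau q t < d).
Proof. intros Hq Hd. apply (eventually_time_tau q (fun s => 0 < s < d) Hq), at_right0_lt, Hd. Qed.

Lemma expandable_horner (N : nat) (l : list R) : expandable N (horner l).
Proof.
  revert N. induction l as [|c l IH]; intros N.
  - apply expandable_ext_all with (2 := expandable_const N 0). reflexivity.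
  - apply expandable_pred. exists c, (horner l). split; [|apply IH].
    apply filter_forall. reflexivity.
Qed.

Definition derivatives (g1 g2 : R -> R -> R -> R) (A B : R -> R) (t : R) : Prop :=
  is_derive A t (g1 t (A t) (B t)) /\ is_derive B t (g2 t (A t) (B t)).

(** The remainder of a solution with respect to its [M]-th approximation
    satisfies an equation of this form. *)
Definition quasi_linear (q : nat) (l11 l12 l21 l22 : list R) (M : nat)
    (g1 g2 : R -> R -> R -> R) : Prop :=
  exists K, 0 <= K /\ Rbar_locally p_infty (fun t => forall u v,
    Rabs u <= tau q t ^ S q -> Rabs v <= tau q t ^ S q ->
    Rabs (g1 t u v - (horner l11 (tau q t) * u + horner l12 (tau q t) * v)) <=
      K * (tau q t ^ S q * (Rabs u + Rabs v) + tau q t ^ S M) /\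
    Rabs (g2 t u v - (horner l21 (tau q t) * u + horner l22 (tau q t) * v)) <=
      K * (tau q t ^ S q * (Rabs u + Rabs v) + tau q t ^ S M)).

(** Invariant under the flow of the trace-free part of the matrix
    [[a b; c d]]: no averaging is needed to see the slow growth rate, which is
    the trace. *)
Definition energy (a b c d u v : R) : R := - c * u ^ 2 + (a - d) * (u * v) + b * v ^ 2.

Definition energy_at (q : nat) (l11 l12 l21 l22 : list R) (A B : R -> R) (t : R) : R :=
  energy (horner l11 (tau q t)) (horner l12 (tau q t)) (horner l21 (tau q t))
    (horner l22 (tau q t)) (A t) (B t).

Lemma horner_near (q : nat) (l : list R) (e : R) :
  (0 < q)%nat -> 0 < e ->
  Rbar_locally p_infty (fun t => Rabs (horner l (tau q t) - horner l 0) < e).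
Proof.
  intros Hq He. apply (eventually_time_tau q (fun s => Rabs (horner l s - horner l 0) < e) Hq).
  apply bigO_lt_radius with O; [exact He|apply horner_0].
Qed.

Lemma energy_equivalent (kappa a b c d u v : R) :
  0 < kappa ->
  let dl := Rmin kappa 1 / 4 in
  Rabs (a - 0) < dl -> Rabs (b - 1) < dl -> Rabs (c - - kappa) < dl -> Rabs (d - 0) < dl ->
  Rmin kappa 1 / 8 * (Rabs u + Rabs v) ^ 2 <= energy a b c d u v /\
  energy a b c d u v <= (kappa + 3) * (Rabs u + Rabs v) ^ 2.
Proof.
  intros Hk dl Ha Hb Hc Hd. unfold energy.
  assert (H1 : Rmin kappa 1 <= kappa) by apply Rmin_l.
  assert (H2 : Rmin kappa 1 <= 1) by apply Rmin_r.
  unfold dl in *. set (m := Rmin kappa 1) in *. clearbody m. clear dl.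
  apply Rabs_def2 in Ha. apply Rabs_def2 in Hb. apply Rabs_def2 in Hc. apply Rabs_def2 in Hd.
  rewrite <- (pow2_abs u), <- (pow2_abs v).
  assert (Huv : Rabs (u * v) = Rabs u * Rabs v) by apply Rabs_mult.
  assert (Hb2 : - (m / 2) * (Rabs u * Rabs v) <= (a - d) * (u * v) <= m / 2 * (Rabs u * Rabs v)).
  { rewrite <- Huv. rewrite Ropp_mult_distr_l_reverse. apply Rabs_le_between. rewrite Rabs_mult.
    apply Rmult_le_compat_r; [apply Rabs_pos|]. apply Rabs_le. lra. }
  set (x := Rabs u) in *. set (y := Rabs v) in *.
  assert (Hx : 0 <= x) by nonneg. assert (Hy : 0 <= y) by nonneg.
  assert (Hsq : 2 * (x * y) <= x ^ 2 + y ^ 2).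
  { clearbody x y. generalize (pow2_ge_0 (x - y)). intros. nra. }
  split.
  - 
    nra.
  - 
    assert (m / 2 * (x * y) <= x * y) by nra. nra.
Qed.

Lemma tau_derivative_bound (q : nat) (t : R) :
  (0 < q)%nat -> Rabs (- / INR q * tau q t ^ S q) <= tau q t ^ S q.
Proof.
  intros Hq. rewrite Rabs_mult, (Rabs_pos_eq (tau q t ^ S q)) by (apply pow_le, Rlt_le, tau_pos).
  rewrite <- (Rmult_1_l (tau q t ^ S q)) at 2.
  apply Rmult_le_compat_r; [apply pow_le, Rlt_le, tau_pos|].
  rewrite Rabs_Ropp, Rabs_pos_eq by (apply Rlt_le, Rinv_0_lt_compat, lt_0_INR, Hq).
  rewrite <- Rinv_1. apply Rinv_le_contravar; [lra|]. apply (le_INR 1). lia.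
Qed.

Lemma horner_tau_derive (q : nat) (l : list R) :
  (0 < q)%nat -> exists K dl, 0 <= K /\ Rbar_locally p_infty (fun t =>
    is_derive (fun t => horner l (tau q t)) t (dl t) /\ Rabs (dl t) <= K * tau q t ^ S q /\
    Rabs (horner l (tau q t)) <= K).
Proof.
  intros Hq. destruct (horner_derive l) as [dl [H1 [K H2]]].
  destruct (horner_bounded l) as [L HL].
  exists (Rabs K + Rabs L), (fun t => (- / INR q * tau q t ^ S q) * dl (tau q t)).
  assert (HK := Rabs_pos K). assert (HL0 := Rabs_pos L).
  split; [lra|].
  generalize (filter_and _ _ (eventually_gt 0) (eventually_tau_lt q 1 Hq Rlt_0_1)).
  apply filter_imp. intros t [Ht Htau]. split; [|split].
  - apply (is_derive_comp (horner l) (tau q)); [apply H1|apply is_derive_tau; assumption].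
  - rewrite Rabs_mult, Rmult_comm. apply Rmult_le_compat; try apply Rabs_pos.
    + specialize (H2 (tau q t) ltac:(lra)). generalize (Rle_abs K). lra.
    + apply tau_derivative_bound, Hq.
  - specialize (HL (tau q t) ltac:(lra)). generalize (Rle_abs L). lra.
Qed.

Lemma Rabs_triang3 (x y z : R) : Rabs (x + y + z) <= Rabs x + Rabs y + Rabs z.
Proof. generalize (Rabs_triang (x + y) z) (Rabs_triang x y). lra. Qed.

Lemma is_derive_energy (a b c d A B : R -> R) (t da db dc dd dA dB : R) :
  is_derive a t da -> is_derive b t db -> is_derive c t dc -> is_derive d t dd ->
  is_derive A t dA -> is_derive B t dB ->
  is_derive (fun t => energy (a t) (b t) (c t) (d t) (A t) (B t)) t
    (- dc * A t ^ 2 + (da - dd) * (A t * B t) + db * B t ^ 2 +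
     (- 2 * c t * A t + (a t - d t) * B t) * dA + ((a t - d t) * A t + 2 * b t * B t) * dB).
Proof.
  intros Da Db Dc Dd DA DB. unfold energy. auto_derive.
  - repeat split; eexists; eassumption.
  - replace (Derive (fun x => a x) t) with da by (symmetry; apply is_derive_unique, Da).
    replace (Derive (fun x => b x) t) with db by (symmetry; apply is_derive_unique, Db).
    replace (Derive (fun x => c x) t) with dc by (symmetry; apply is_derive_unique, Dc).
    replace (Derive (fun x => d x) t) with dd by (symmetry; apply is_derive_unique, Dd).
    replace (Derive (fun x => A x) t) with dA by (symmetry; apply is_derive_unique, DA).
    replace (Derive (fun x => B x) t) with dB by (symmetry; apply is_derive_unique, DB).
    ring.
Qed.

(** Along the linear part the energy changes at the rate of the trace alone; the
    other terms come from the slow variation of the coefficients and from the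
    errors. *)
Lemma energy_derivative (q : nat) (l11 l12 l21 l22 : list R) (M : nat) (g1 g2 : R -> R -> R -> R) :
  (0 < q)%nat -> quasi_linear q l11 l12 l21 l22 M g1 g2 ->
  exists K, 0 <= K /\ Rbar_locally p_infty (fun t => forall A B,
    derivatives g1 g2 A B t -> Rabs (A t) <= tau q t ^ S q -> Rabs (B t) <= tau q t ^ S q ->
    let Q := energy_at q l11 l12 l21 l22 A B in
    is_derive Q t (Derive Q t) /\
    Rabs (Derive Q t - (horner l11 (tau q t) + horner l22 (tau q t)) * Q t) <=
      K * (tau q t ^ S q * (Rabs (A t) + Rabs (B t)) ^ 2 +
           tau q t ^ S M * (Rabs (A t) + Rabs (B t)))).
Proof.
  intros Hq [K [HK HG]].
  destruct (horner_tau_derive q l11 Hq) as [Ka [da [HKa Ha]]].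
  destruct (horner_tau_derive q l12 Hq) as [Kb [db [HKb Hb]]].
  destruct (horner_tau_derive q l21 Hq) as [Kc [dc [HKc Hc]]].
  destruct (horner_tau_derive q l22 Hq) as [Kd [dd [HKd Hd]]].
  set (S4 := Ka + Kb + Kc + Kd).
  assert (HS4 : 0 <= S4) by nonneg.
  exists (S4 + 4 * S4 * K). split; [apply Rplus_le_le_0_compat; [exact HS4|]; apply Rmult_le_pos; lra|].
  generalize (filter_and _ _ HG (filter_and _ _ (filter_and _ _ Ha Hb) (filter_and _ _ Hc Hd))).
  apply filter_imp. intros t [HGt [[[Da [Ea Ba]] [Db [Eb Bb]]] [[Dc [Ec Bc]] [Dd [Ed Bd]]]]] A B [DA DB] HA HB Q.
  destruct (HGt (A t) (B t) HA HB) as [G1 G2]. clear HGt HG Ha Hb Hc Hd.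
  set (a := horner l11 (tau q t)) in *. set (b := horner l12 (tau q t)) in *.
  set (c := horner l21 (tau q t)) in *. set (d := horner l22 (tau q t)) in *.
  set (dQ := - dc t * A t ^ 2 + (da t - dd t) * (A t * B t) + db t * B t ^ 2 +
    (- 2 * c * A t + (a - d) * B t) * g1 t (A t) (B t) +
    ((a - d) * A t + 2 * b * B t) * g2 t (A t) (B t)).
  assert (HdQ : is_derive Q t dQ).
  { eapply is_derive_ext; [intros; reflexivity|]. unfold dQ, a, b, c, d.
    apply (is_derive_energy (fun t => horner l11 (tau q t)) (fun t => horner l12 (tau q t))
      (fun t => horner l21 (tau q t)) (fun t => horner l22 (tau q t))); assumption. }
  rewrite (is_derive_unique _ _ _ HdQ). split; [exact HdQ|].
  change (Q t) with (energy a b c d (A t) (B t)).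
  set (e1 := g1 t (A t) (B t) - (a * A t + b * B t)) in *.
  set (e2 := g2 t (A t) (B t) - (c * A t + d * B t)) in *.
  replace (dQ - (a + d) * energy a b c d (A t) (B t)) with
    ((- dc t * A t ^ 2 + (da t - dd t) * (A t * B t) + db t * B t ^ 2) +
     (- 2 * c * A t + (a - d) * B t) * e1 + ((a - d) * A t + 2 * b * B t) * e2)
    by (unfold dQ, energy, e1, e2; ring).
  set (x := Rabs (A t)) in *. set (y := Rabs (B t)) in *.
  assert (Hx : 0 <= x) by nonneg. assert (Hy : 0 <= y) by nonneg.
  set (w := tau q t ^ S q) in *. set (z := tau q t ^ S M) in *.
  assert (Hw : 0 <= w) by nonneg.
  assert (Hz : 0 <= z) by nonneg.
  set (E := K * (w * (x + y) + z)) in *.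
  assert (HE : 0 <= E) by nonneg.
  assert (B1 : Rabs (- dc t * A t ^ 2 + (da t - dd t) * (A t * B t) + db t * B t ^ 2) <=
    S4 * (w * (x + y) ^ 2)).
  { apply Rle_trans with (1 := Rabs_triang3 _ _ _). rewrite !Rabs_mult, Rabs_Ropp, <- !RPow_abs.
    fold x y.
    assert (U1 : Rabs (dc t) * x ^ 2 <= Kc * w * x ^ 2) by nra.
    assert (U2 : Rabs (db t) * y ^ 2 <= Kb * w * y ^ 2) by nra.
    assert (U3 : Rabs (da t - dd t) * (x * y) <= (Ka * w + Kd * w) * (x * y)).
    { apply Rmult_le_compat_r; [apply Rmult_le_pos; assumption|].
      unfold Rminus. apply Rle_trans with (1 := Rabs_triang _ _). rewrite Rabs_Ropp. lra. }
    assert (V1 : Kc * w * x ^ 2 <= Kc * w * (x + y) ^ 2).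
    { apply Rmult_le_compat_l; [apply Rmult_le_pos; lra|nra]. }
    assert (V2 : Kb * w * y ^ 2 <= Kb * w * (x + y) ^ 2).
    { apply Rmult_le_compat_l; [apply Rmult_le_pos; lra|nra]. }
    assert (V3 : (Ka * w + Kd * w) * (x * y) <= (Ka * w + Kd * w) * (x + y) ^ 2).
    { apply Rmult_le_compat_l; [|nra]. apply Rplus_le_le_0_compat; apply Rmult_le_pos; lra. }
    unfold S4. lra. }
  assert (Had : Rabs (a - d) <= Ka + Kd).
  { unfold Rminus. apply Rle_trans with (1 := Rabs_triang _ _). rewrite Rabs_Ropp. lra. }
  assert (B2 : Rabs ((- 2 * c * A t + (a - d) * B t) * e1) <= (2 * S4 * (x + y)) * E).
  { rewrite Rabs_mult. apply Rmult_le_compat; try apply Rabs_pos; [|exact G1].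
    apply Rle_trans with (1 := Rabs_triang _ _). rewrite !Rabs_mult. fold x y.
    replace (Rabs (-2)) with 2 by (rewrite Rabs_left; lra).
    assert (2 * Rabs c * x <= 2 * S4 * x) by (apply Rmult_le_compat_r; [exact Hx|unfold S4; lra]).
    assert (Rabs (a - d) * y <= 2 * S4 * y) by (apply Rmult_le_compat_r; [exact Hy|unfold S4; lra]).
    lra. }
  assert (B3 : Rabs (((a - d) * A t + 2 * b * B t) * e2) <= (2 * S4 * (x + y)) * E).
  { rewrite Rabs_mult. apply Rmult_le_compat; try apply Rabs_pos; [|exact G2].
    apply Rle_trans with (1 := Rabs_triang _ _). rewrite !Rabs_mult. fold x y.
    rewrite (Rabs_pos_eq 2) by lra.
    assert (2 * Rabs b * y <= 2 * S4 * y) by (apply Rmult_le_compat_r; [exact Hy|unfold S4; lra]).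
    assert (Rabs (a - d) * x <= 2 * S4 * x) by (apply Rmult_le_compat_r; [exact Hx|unfold S4; lra]).
    lra. }
  apply Rle_trans with (1 := Rabs_triang3 _ _ _).
  apply Rle_trans with (S4 * (w * (x + y) ^ 2) + 4 * S4 * (x + y) * E); [lra|].
  unfold E.
  replace (4 * S4 * (x + y) * (K * (w * (x + y) + z))) with
    (4 * S4 * K * (w * (x + y) ^ 2 + z * (x + y))) by ring.
  assert (0 <= S4 * (z * (x + y))) by nonneg.
  lra.
Qed.

(** * Orbits asymptotic to a center *)


Lemma energy_ex_derive (q : nat) (l11 l12 l21 l22 : list R) :
  (0 < q)%nat -> Rbar_locally p_infty (fun t => forall A B, ex_derive A t -> ex_derive B t ->
    let Q := energy_at q l11 l12 l21 l22 A B in is_derive Q t (Derive Q t)).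
Proof.
  intros Hq.
  destruct (horner_tau_derive q l11 Hq) as [Ka [da [_ Ha]]].
  destruct (horner_tau_derive q l12 Hq) as [Kb [db [_ Hb]]].
  destruct (horner_tau_derive q l21 Hq) as [Kc [dc [_ Hc]]].
  destruct (horner_tau_derive q l22 Hq) as [Kd [dd [_ Hd]]].
  generalize (filter_and _ _ (filter_and _ _ Ha Hb) (filter_and _ _ Hc Hd)).
  apply filter_imp. intros t [[[Da _] [Db _]] [[Dc _] [Dd _]]] A B [dA DA] [dB DB] Q.
  apply Derive_correct. eexists.
  apply (is_derive_energy (fun t => horner l11 (tau q t)) (fun t => horner l12 (tau q t))
      (fun t => horner l21 (tau q t)) (fun t => horner l22 (tau q t))); eassumption.
Qed.

Lemma energy_bounds (q : nat) (kappa : R) (l11 l12 l21 l22 : list R) :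
  (0 < q)%nat -> 0 < kappa ->
  horner l11 0 = 0 -> horner l12 0 = 1 -> horner l21 0 = - kappa -> horner l22 0 = 0 ->
  exists c C, 0 < c /\ 0 < C /\ Rbar_locally p_infty (fun t => forall A B : R -> R,
    c * (Rabs (A t) + Rabs (B t)) ^ 2 <= energy_at q l11 l12 l21 l22 A B t /\
    energy_at q l11 l12 l21 l22 A B t <= C * (Rabs (A t) + Rabs (B t)) ^ 2).
Proof.
  intros Hq Hk Z11 Z12 Z21 Z22.
  assert (Hmin : 0 < Rmin kappa 1) by (apply Rmin_glb_lt; lra).
  exists (Rmin kappa 1 / 8), (kappa + 3). split; [lra|]. split; [lra|].
  assert (Hdl : 0 < Rmin kappa 1 / 4) by lra.
  generalize (filter_and _ _
    (filter_and _ _ (horner_near q l11 _ Hq Hdl) (horner_near q l12 _ Hq Hdl))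
    (filter_and _ _ (horner_near q l21 _ Hq Hdl) (horner_near q l22 _ Hq Hdl))).
  rewrite Z11, Z12, Z21, Z22. apply filter_imp. intros t [[H1 H2] [H3 H4]] A B.
  apply energy_equivalent; assumption.
Qed.

(** The threshold is [1 / t = tau ^ q], the rate at which tubes of width [tau ^ m]
    shrink. *)
Lemma trace_dichotomy (q : nat) (l l' : list R) :
  (0 < q)%nat ->
  (exists C, 0 <= C /\ Rbar_locally p_infty (fun t =>
    - C * tau q t ^ q <= horner l (tau q t) + horner l' (tau q t))) \/
  (forall B, Rbar_locally p_infty (fun t =>
    horner l (tau q t) + horner l' (tau q t) <= - B * tau q t ^ q)).
Proof.
  intros Hq. destruct (expandable_dichotomy q (fun s => horner l s + horner l' s))
    as [[C [HC H]]|H].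
  - apply expandable_plus; apply expandable_horner.
  - left. exists C. split; [exact HC|].
    exact (eventually_time_tau q (fun s => - C * s ^ q <= horner l s + horner l' s) Hq H).
  - right. intros B.
    exact (eventually_time_tau q (fun s => horner l s + horner l' s <= - B * s ^ q) Hq (H B)).
Qed.

Lemma sq_le_sq (x y : R) : 0 <= y -> x ^ 2 <= y ^ 2 -> x <= y.
Proof. intros Hy Hxy. apply Rnot_lt_le. intros Hlt. nra. Qed.

Definition regular (g : R -> R -> R -> R) : Prop :=
  field_continuous g positive_time /\ locally_lipschitz g.

Lemma continuous_tau_pow (q n : nat) (t : R) :
  (0 < q)%nat -> 0 < t -> continuous (fun t => tau q t ^ n) t.
Proof. intros Hq Ht. eapply is_derive_continuous. apply is_derive_tau_pow; assumption. Qed.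

(** Reduces the existence of an orbit trapped forever to bounded intervals of time,
    for the extended field. *)
Lemma trapped_in_tube (q p : nat) (g1 g2 : R -> R -> R -> R) (t0 : R) :
  (0 < q)%nat -> 0 < t0 -> regular g1 -> regular g2 ->
  (forall t, t0 <= t -> tau q t <= 1) ->
  let h1 := tube_field t0 (fun t => tau q t ^ p) g1 in
  let h2 := tube_field t0 (fun t => tau q t ^ p) g2 in
  (field_continuous h1 everywhere /\ field_continuous h2 everywhere /\
   field_lipschitz h1 /\ field_lipschitz h2) /\
  ((forall n, exists A B, solves h1 h2 A B /\
    forall t, t0 <= t <= t0 + INR n -> Rabs (A t) <= tau q t ^ p /\ Rabs (B t) <= tau q t ^ p) ->
  exists A B, forall t, t0 <= t -> derivatives g1 g2 A B t /\
    Rabs (A t) <= tau q t ^ p /\ Rabs (B t) <= tau q t ^ p).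
Proof.
  intros Hq Ht0 [C1 L1] [C2 L2] Htau h1 h2.
  assert (Hr : forall t, t0 <= t -> 0 <= tau q t ^ p <= 1).
  { intros t Ht. split; [apply pow_le, Rlt_le, tau_pos|].
    rewrite <- (pow1 p). apply pow_incr. split; [apply Rlt_le, tau_pos|apply Htau, Ht]. }
  assert (Hc1 : field_continuous h1 everywhere).
  { apply tube_field_continuous; try assumption. intros; apply continuous_tau_pow; assumption. }
  assert (Hc2 : field_continuous h2 everywhere).
  { apply tube_field_continuous; try assumption. intros; apply continuous_tau_pow; assumption. }
  assert (Hl1 : field_lipschitz h1) by (apply tube_field_lipschitz; assumption).
  assert (Hl2 : field_lipschitz h2) by (apply tube_field_lipschitz; assumption).
  split; [auto|]. intros H.
  destruct (trapped_forever h1 h2 (fun t => tau q t ^ p) t0) as [A [B [HS HAB]]];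
    try assumption; [lra|].
  exists A, B. intros t Ht. destruct (HAB t Ht) as [HA HB]. destruct (HS t) as [D1 D2].
  split; [|split; assumption].
  unfold h1 in D1. unfold h2 in D2.
  rewrite (tube_field_inside t0 (fun t => tau q t ^ p)) in D1 by assumption.
  rewrite (tube_field_inside t0 (fun t => tau q t ^ p)) in D2 by assumption.
  split; assumption.
Qed.

(** The tube of energy [tau ^ (2 m)] shrinks at the logarithmic rate [(2 m / q) / t].
    If the trace is at least [- E / t], a large [m] makes every orbit leave it
    outward; if the trace is eventually below any such bound, every orbit enters it. *)
Lemma center_trapped (q : nat) (kappa : R) (l11 l12 l21 l22 : list R) :
  (0 < q)%nat -> 0 < kappa ->
  horner l11 0 = 0 -> horner l12 0 = 1 -> horner l21 0 = - kappa -> horner l22 0 = 0 ->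
  exists p0, forall p M g1 g2, (p0 <= p)%nat -> (p + 1 + q <= M)%nat ->
    regular g1 -> regular g2 -> quasi_linear q l11 l12 l21 l22 M g1 g2 ->
    exists t0 A B, 0 < t0 /\ forall t, t0 <= t -> derivatives g1 g2 A B t /\
      Rabs (A t) <= tau q t ^ p /\ Rabs (B t) <= tau q t ^ p.
Proof.
  intros Hq Hk Z11 Z12 Z21 Z22.
  assert (Hq0 : 0 < INR q) by nonneg.
  destruct (energy_bounds q kappa l11 l12 l21 l22) as [c [C [Hc [HC Hbounds]]]]; try assumption.
  assert (Hp0 : exists p0, (q + 1 <= p0)%nat /\
    ((exists E, 0 <= E /\ E + 1 <= 2 * INR p0 / INR q /\ Rbar_locally p_infty (fun t =>
      - E * tau q t ^ q <= horner l11 (tau q t) + horner l22 (tau q t))) \/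
     (forall E, Rbar_locally p_infty (fun t =>
      horner l11 (tau q t) + horner l22 (tau q t) <= - E * tau q t ^ q)))).
  { destruct (trace_dichotomy q l11 l22 Hq) as [[E [HE H]]|H].
    - destruct (INR_unbounded ((E + 1) * INR q)) as [N HN].
      (* The margin [1] above [E] leaves room for the errors. *)
      exists (N + q + 1)%nat. split; [lia|]. left. exists E. split; [exact HE|]. split; [|exact H].
      apply Rmult_le_reg_r with (INR q); [exact Hq0|].
      replace (2 * INR (N + q + 1) / INR q * INR q) with (2 * INR (N + q + 1)) by (field; lra).
      rewrite !plus_INR. simpl (INR 1). generalize (pos_INR N). lra.
    - exists (q + 1)%nat. split; [lia|]. right. exact H. }
  destruct Hp0 as [p0 [Hp0 Htrace]]. exists p0.
  intros p M g1 g2 Hp HM R1 R2 HQL.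
  destruct (energy_derivative q l11 l12 l21 l22 M g1 g2 Hq HQL) as [K [HK HdQ]].
  set (sg := sqrt (/ c)).
  assert (Hsg : sg ^ 2 = / c) by (apply pow2_sqrt, Rlt_le, Rinv_0_lt_compat, Hc).
  assert (Hsg0 : 0 <= sg) by apply sqrt_pos.
  set (W := K * (sg ^ 2 + sg)).
  assert (HW : 0 <= W) by nonneg.
  set (m := S p).
  set (rate := 2 * INR m / INR q).
  assert (Htr : (exists E, E + 1 <= rate /\ Rbar_locally p_infty (fun t =>
      - E * tau q t ^ q <= horner l11 (tau q t) + horner l22 (tau q t))) \/
     Rbar_locally p_infty (fun t =>
      horner l11 (tau q t) + horner l22 (tau q t) <= - (rate + 1) * tau q t ^ q)).
  { destruct Htrace as [[E [_ [HE H]]]|H]; [left|right; apply H].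
    exists E. split; [|exact H]. apply Rle_trans with (1 := HE). unfold rate, Rdiv.
    apply Rmult_le_compat_r; [apply Rlt_le, Rinv_0_lt_compat, Hq0|].
    apply Rmult_le_compat_l; [lra|]. apply le_INR. unfold m. lia. }
  clear Htrace.
  assert (Hd : 0 < Rmin (Rmin 1 c) (/ (W + 1))).
  { apply Rmin_glb_lt; [apply Rmin_glb_lt; lra|]. apply Rinv_0_lt_compat. lra. }
  destruct (filter_and _ _
      (filter_and _ _ (filter_and _ _ (eventually_gt 0) (eventually_tau_lt q _ Hq Hd)) Hbounds)
      (filter_and _ _ HdQ (energy_ex_derive q l11 l12 l21 l22 Hq))) as [T1 Hlate].
  assert (Hsign : exists T2, (exists E, E + 1 <= rate /\ forall t, T2 < t ->
      - E * tau q t ^ q <= horner l11 (tau q t) + horner l22 (tau q t)) \/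
     (forall t, T2 < t ->
      horner l11 (tau q t) + horner l22 (tau q t) <= - (rate + 1) * tau q t ^ q)).
  { destruct Htr as [[E [HE [T2 H]]]|[T2 H]]; exists T2; [left|right; exact H].
    exists E. split; [exact HE|exact H]. }
  destruct Hsign as [T2 Hsign].
  set (t0 := Rmax T1 (Rmax T2 0) + 1).
  assert (Ht01 : T1 < t0) by (unfold t0; generalize (Rmax_l T1 (Rmax T2 0)); lra).
  assert (Ht02 : T2 < t0).
  { unfold t0; generalize (Rmax_r T1 (Rmax T2 0)) (Rmax_l T2 0); lra. }
  assert (Ht00 : 0 < t0).
  { unfold t0; generalize (Rmax_r T1 (Rmax T2 0)) (Rmax_r T2 0); lra. }
  clearbody t0.
  assert (Htau : forall t, t0 <= t -> 0 < tau q t /\ tau q t < 1 /\ tau q t < c /\ W * tau q t < 1).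
  { intros t Ht. destruct (Hlate t ltac:(lra)) as [[[_ [A1 A2]] _] _].
    generalize (Rmin_l (Rmin 1 c) (/ (W + 1))) (Rmin_r (Rmin 1 c) (/ (W + 1)))
      (Rmin_l 1 c) (Rmin_r 1 c). intros.
    split; [exact A1|]. split; [lra|]. split; [lra|].
    assert (tau q t * (W + 1) < 1); [|lra].
    apply Rlt_le_trans with (/ (W + 1) * (W + 1)).
    - apply Rmult_lt_compat_r; lra.
    - right. field. lra. }
  destruct (trapped_in_tube q p g1 g2 t0 Hq Ht00 R1 R2) as [[Hc1 [Hc2 [Hl1 Hl2]]] Htrap].
  { intros t Ht. generalize (Htau t Ht). lra. }
  set (h1 := tube_field t0 (fun t => tau q t ^ p) g1) in *.
  set (h2 := tube_field t0 (fun t => tau q t ^ p) g2) in *.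
  (* The energy tube of radius [tau ^ m] lies inside the square tube of half-width [tau ^ p]. *)
  assert (Hinside : forall A B t, t0 <= t ->
    energy_at q l11 l12 l21 l22 A B t <= tau q t ^ (2 * m) ->
    Rabs (A t) + Rabs (B t) <= sg * tau q t ^ m /\
    Rabs (A t) <= tau q t ^ p /\ Rabs (B t) <= tau q t ^ p).
  { intros A B t Ht HE. destruct (Hlate t ltac:(lra)) as [[_ Hb] _].
    destruct (Hb A B) as [Hb1 _]. destruct (Htau t Ht) as [P1 [P2 [P3 P4]]].
    set (s := Rabs (A t) + Rabs (B t)) in *.
    assert (Hcs : c * s ^ 2 <= (tau q t ^ m) ^ 2).
    { apply Rle_trans with (1 := Hb1). apply Rle_trans with (1 := HE).
      rewrite <- pow_mult, Nat.mul_comm. lra. }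
    assert (Hpm : 0 <= tau q t ^ m) by nonneg.
    assert (Hpp : 0 <= tau q t ^ p) by nonneg.
    assert (Hs1 : s <= sg * tau q t ^ m).
    { apply sq_le_sq; [apply Rmult_le_pos; assumption|].
      rewrite Rpow_mult_distr, Hsg. apply Rmult_le_reg_l with c; [exact Hc|].
      rewrite <- Rmult_assoc, Rinv_r by lra. lra. }
    assert (Hs2 : s <= tau q t ^ p).
    { apply sq_le_sq; [exact Hpp|]. apply Rmult_le_reg_l with c; [exact Hc|].
      apply Rle_trans with (1 := Hcs). unfold m.
      replace (tau q t ^ S p) with (tau q t * tau q t ^ p) by reflexivity. rewrite Rpow_mult_distr.
      apply Rmult_le_compat_r; [apply pow2_ge_0|]. nra. }
    unfold s in *. generalize (Rabs_pos (A t)) (Rabs_pos (B t)). intros.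
    split; [exact Hs1|]. split; lra. }
  set (phi := fun A B t => energy_at q l11 l12 l21 l22 A B t - tau q t ^ (2 * m)).
  set (dphi := fun A B t => Derive (energy_at q l11 l12 l21 l22 A B) t -
    (- (INR (2 * m) / INR q) * tau q t ^ (2 * m + q))).
  assert (Hphi : forall A B, solves h1 h2 A B -> forall t, t0 <= t ->
    is_derive (phi A B) t (dphi A B t)).
  { intros A B HS t Ht. destruct (HS t) as [DA DB].
    destruct (Hlate t ltac:(lra)) as [[[Ht' _] _] [_ HE]].
    apply @is_derive_minus.
    - apply HE; [exists (h1 t (A t) (B t))|exists (h2 t (A t) (B t))]; assumption.
    - apply is_derive_tau_pow; assumption. }
  (* On the boundary of the tube the errors carry one more power of [tau] than
     [tau ^ (2 m) / t]. *)
  assert (Hzero : forall A B, solves h1 h2 A B -> forall t, t0 <= t -> phi A B t = 0 ->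
    Rabs (dphi A B t - (horner l11 (tau q t) + horner l22 (tau q t)) * tau q t ^ (2 * m) -
      rate * tau q t ^ (2 * m + q)) < tau q t ^ (2 * m + q)).
  { intros A B HS t Ht Hz. unfold phi in Hz. apply Rminus_diag_uniq in Hz.
    destruct (Hinside A B t Ht ltac:(lra)) as [Hs [HA HB]].
    destruct (HS t) as [DA DB]. unfold h1 in DA. unfold h2 in DB.
    rewrite (tube_field_inside t0 (fun t => tau q t ^ p)) in DA by assumption.
    rewrite (tube_field_inside t0 (fun t => tau q t ^ p)) in DB by assumption.
    destruct (Htau t Ht) as [P1 [P2 [P3 P4]]].
    assert (Hpq : tau q t ^ p <= tau q t ^ S q) by (apply pow_le_pow_lt1; [lra|lia]).
    destruct (Hlate t ltac:(lra)) as [_ [HE _]].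
    destruct (HE A B (conj DA DB) ltac:(lra) ltac:(lra)) as [_ HE2]. clear HE.
    rewrite Hz in HE2. unfold dphi.
    replace (Derive (energy_at q l11 l12 l21 l22 A B) t -
      - (INR (2 * m) / INR q) * tau q t ^ (2 * m + q) -
      (horner l11 (tau q t) + horner l22 (tau q t)) * tau q t ^ (2 * m) -
      rate * tau q t ^ (2 * m + q)) with
      (Derive (energy_at q l11 l12 l21 l22 A B) t -
      (horner l11 (tau q t) + horner l22 (tau q t)) * tau q t ^ (2 * m))
      by (unfold rate; rewrite mult_INR; simpl (INR 2); field; lra).
    apply Rle_lt_trans with (1 := HE2).
    set (s := Rabs (A t) + Rabs (B t)) in *.
    assert (Hs0 : 0 <= s) by nonneg.
    assert (Hpos : forall n, 0 < tau q t ^ n) by nonneg.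
    assert (Hs2 : s ^ 2 <= sg ^ 2 * tau q t ^ (2 * m)).
    { rewrite Nat.mul_comm, pow_mult, <- Rpow_mult_distr. apply pow_incr. split; assumption. }
    assert (HM' : tau q t ^ S M <= tau q t ^ (S q + m)) by (apply pow_le_pow_lt1; [lra|unfold m; lia]).
    assert (HX : K * (tau q t ^ S q * s ^ 2 + tau q t ^ S M * s) <= W * tau q t * tau q t ^ (2 * m + q)).
    { unfold W. rewrite !Rmult_assoc. apply Rmult_le_compat_l; [exact HK|].
      apply Rle_trans with (tau q t ^ S q * (sg ^ 2 * tau q t ^ (2 * m)) +
        tau q t ^ (S q + m) * (sg * tau q t ^ m)).
      - apply Rplus_le_compat.
        + apply Rmult_le_compat_l; [apply Rlt_le, Hpos|exact Hs2].
        + apply Rmult_le_compat; try assumption. apply Rlt_le, Hpos.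
      - right. replace (2 * m + q)%nat with (m + m + q)%nat by lia.
        replace (2 * m)%nat with (m + m)%nat by lia. rewrite !pow_add. simpl. ring. }
    apply Rle_lt_trans with (1 := HX).
    rewrite <- (Rmult_1_l (tau q t ^ (2 * m + q))) at 2.
    apply Rmult_lt_compat_r; [apply Hpos|exact P4]. }
  assert (Htube : forall A B t, t0 <= t -> phi A B t < 0 ->
    Rabs (A t) <= tau q t ^ p /\ Rabs (B t) <= tau q t ^ p).
  { intros A B t Ht Hneg. unfold phi in Hneg. apply (Hinside A B t Ht). lra. }
  assert (Hstart : forall A B t, A t = 0 -> B t = 0 -> phi A B t < 0).
  { intros A B t HA HB. unfold phi, energy_at. rewrite HA, HB. unfold energy.
    generalize (pow_lt (tau q t) (2 * m) (tau_pos q t)). intros. nra. }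
  exists t0.
  assert (Hex : forall n, exists A B, solves h1 h2 A B /\
    forall t, t0 <= t <= t0 + INR n -> Rabs (A t) <= tau q t ^ p /\ Rabs (B t) <= tau q t ^ p).
  { intros n. destruct Hsign as [[E [HE Hge]]|Hle].
    - (* Every orbit leaves the energy tube through its boundary: shoot backward. *)
      destruct (cauchy_lipschitz h1 h2 (t0 + INR n) 0 0) as [A [B [HA [HB HS]]]]; try assumption.
      exists A, B. split; [exact HS|]. intros t Ht. apply Htube; [lra|].
      apply (stays_negative_backward (phi A B) (dphi A B) t0 (t0 + INR n)); try assumption.
      + intros u Hu. apply Hphi; [exact HS|lra].
      + apply Hstart; assumption.
      + intros u Hu Hz. specialize (Hzero A B HS u ltac:(lra) Hz).
        specialize (Hge u ltac:(lra)). apply Rabs_def2 in Hzero.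
        assert (P : 0 < tau q u ^ (2 * m)) by apply pow_lt, tau_pos.
        assert (P' : 0 < tau q u ^ q) by apply pow_lt, tau_pos.
        rewrite pow_add in Hzero. set (y := tau q u ^ (2 * m)) in *. set (z := tau q u ^ q) in *.
        assert (- E * z * y <= (horner l11 (tau q u) + horner l22 (tau q u)) * y)
          by (apply Rmult_le_compat_r; lra).
        assert ((E + 1) * (y * z) <= rate * (y * z)) by nra.
        lra.
    - destruct (cauchy_lipschitz h1 h2 t0 0 0) as [A [B [HA [HB HS]]]]; try assumption.
      exists A, B. split; [exact HS|]. intros t Ht. apply Htube; [lra|].
      apply (stays_negative (phi A B) (dphi A B) t0 (t0 + INR n)); try assumption.
      + intros u Hu. apply Hphi; [exact HS|lra].
      + apply Hstart; assumption.
      + intros u Hu Hz. specialize (Hzero A B HS u ltac:(lra) Hz).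
        specialize (Hle u ltac:(lra)). apply Rabs_def2 in Hzero.
        assert (P : 0 < tau q u ^ (2 * m)) by apply pow_lt, tau_pos.
        rewrite pow_add in Hzero. set (y := tau q u ^ (2 * m)) in *. set (z := tau q u ^ q) in *.
        assert ((horner l11 (tau q u) + horner l22 (tau q u)) * y <= - (rate + 1) * z * y)
          by (apply Rmult_le_compat_r; lra).
        lra. }
  destruct (Htrap Hex) as [A [B HAB]]. exists A, B. split; [exact Ht00|exact HAB].
Qed.

(** Each pass through the energy inequality improves the bound on the energy by one
    power of [tau], until the error of order [M + 1] is reached. The starting bound
    matters when the trace is negative of order [1 / t]: the comparison from infinity
    applies only to orbits that decay faster than the linear flow allows. *)
Lemma center_decay (q : nat) (kappa : R) (l11 l12 l21 l22 : list R) :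
  (0 < q)%nat -> 0 < kappa ->
  horner l11 0 = 0 -> horner l12 0 = 1 -> horner l21 0 = - kappa -> horner l22 0 = 0 ->
  exists p0, forall p M g1 g2 A B K, (p0 <= p)%nat ->
    quasi_linear q l11 l12 l21 l22 M g1 g2 ->
    Rbar_locally p_infty (fun t => derivatives g1 g2 A B t /\
      Rabs (A t) <= K * tau q t ^ p /\ Rabs (B t) <= K * tau q t ^ p) ->
    forall n, (2 * n + q <= S M)%nat -> exists K', Rbar_locally p_infty (fun t =>
      Rabs (A t) <= K' * tau q t ^ n /\ Rabs (B t) <= K' * tau q t ^ n).
Proof.
  intros Hq Hk Z11 Z12 Z21 Z22.
  assert (Hq0 : 0 < INR q) by nonneg.
  destruct (energy_bounds q kappa l11 l12 l21 l22) as [c [C [Hc [HC Hbounds]]]]; try assumption.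
  assert (Hp0 : exists p0, (q + 2 <= p0)%nat /\
    ((exists E, (E * q < 2 * p0)%nat /\ Rbar_locally p_infty (fun t =>
      - INR E * tau q t ^ q <= horner l11 (tau q t) + horner l22 (tau q t))) \/
     (forall E, Rbar_locally p_infty (fun t =>
      horner l11 (tau q t) + horner l22 (tau q t) <= - E * tau q t ^ q)))).
  { destruct (trace_dichotomy q l11 l22 Hq) as [[E [HE H]]|H].
    - destruct (INR_unbounded E) as [N HN].
      exists (N * q + q + 2)%nat. split; [lia|]. left. exists N. split; [lia|].
      revert H. apply filter_imp. intros t H. apply Rle_trans with (2 := H).
      apply Rmult_le_compat_r; [apply pow_le, Rlt_le, tau_pos|lra].
    - exists (q + 2)%nat. split; [lia|]. right. exact H. }
  destruct Hp0 as [p0 [Hp0 Htrace]]. exists p0.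
  intros p M g1 g2 A B K0 Hp HQL Horb.
  destruct (energy_derivative q l11 l12 l21 l22 M g1 g2 Hq HQL) as [K [HK HdQ]].
  set (Q := energy_at q l11 l12 l21 l22 A B).
  assert (Hd : 0 < Rmin 1 (/ (Rabs K0 + 1))).
  { apply Rmin_glb_lt; [lra|]. apply Rinv_0_lt_compat. generalize (Rabs_pos K0). lra. }
  set (s := fun t => Rabs (A t) + Rabs (B t)).
  assert (Hs0 : forall t, 0 <= s t).
  { intros t. unfold s. generalize (Rabs_pos (A t)) (Rabs_pos (B t)). lra. }
  set (E0 := 2 * Rabs K0).
  assert (HE0 : 0 <= E0) by nonneg.
  assert (Hev : Rbar_locally p_infty (fun t => (0 < t /\ 0 < tau q t < 1) /\
    (s t <= 1 /\ s t <= E0 * tau q t ^ p) /\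
    (c * s t ^ 2 <= Q t /\ Q t <= C * s t ^ 2) /\ is_derive Q t (Derive Q t) /\
    Rabs (Derive Q t - (horner l11 (tau q t) + horner l22 (tau q t)) * Q t) <=
      K * (tau q t ^ S q * s t ^ 2 + tau q t ^ S M * s t))).
  { assert (Hd2 : 0 < / (E0 + 1)) by nonneg.
    generalize (filter_and _ _
      (filter_and _ _ (filter_and _ _ (eventually_gt 0) (eventually_tau_lt q _ Hq Hd2))
        (eventually_tau_lt q _ Hq Hd))
      (filter_and _ _ Horb (filter_and _ _ Hbounds HdQ))).
    apply filter_imp. intros t [[[Ht Ht2] Ht3] [[HD [HA HB]] [Hb HE]]].
    assert (Hpos : forall n, 0 < tau q t ^ n) by (intros; apply pow_lt, tau_pos).
    generalize (Rmin_l 1 (/ (Rabs K0 + 1))) (Rmin_r 1 (/ (Rabs K0 + 1))). intros M1 M2.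
    assert (Hk0 : K0 * tau q t ^ p <= Rabs K0 * tau q t ^ p).
    { apply Rmult_le_compat_r; [apply Rlt_le, Hpos|apply Rle_abs]. }
    assert (Hinv : forall x, 0 <= x -> tau q t < / (x + 1) -> x * tau q t <= 1).
    { intros x Hx Hlt. assert ((x + 1) * tau q t <= (x + 1) * / (x + 1)) by nonneg.
      rewrite Rinv_r in H by lra. generalize (tau_pos q t). lra. }
    assert (Hin : Rabs K0 * tau q t ^ p <= tau q t ^ S q).
    { apply Rle_trans with (Rabs K0 * tau q t ^ (1 + S q)).
      - apply Rmult_le_compat_l; [apply Rabs_pos|]. apply pow_le_pow_lt1; [lra|lia].
      - rewrite pow_add, pow_1, <- Rmult_assoc.
        rewrite <- (Rmult_1_l (tau q t ^ S q)) at 2. apply Rmult_le_compat_r; [apply Rlt_le, Hpos|].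
        apply Hinv; [apply Rabs_pos|lra]. }
    split; [split; [exact Ht|lra]|]. split.
    - assert (s t <= E0 * tau q t ^ p) by (unfold s, E0; lra). split; [|assumption].
      apply Rle_trans with (1 := H). apply Rle_trans with (E0 * tau q t).
      + apply Rmult_le_compat_l; [exact HE0|]. rewrite <- (pow_1 (tau q t)) at 2.
        apply pow_le_pow_lt1; [lra|lia].
      + apply Hinv; [exact HE0|lra].
    - split; [apply Hb|]. apply HE; [exact HD|lra|lra]. }
  assert (Hboot : forall k, (k + q <= S M)%nat ->
    exists Kk, 0 <= Kk /\ Rbar_locally p_infty (fun t => Q t <= Kk * tau q t ^ k)).
  { induction k as [|k IH]; intros HkM.
    - exists C. split; [lra|]. revert Hev. apply filter_imp.
      intros t [_ [[H1 _] [[_ H2] _]]]. simpl. apply Rle_trans with (1 := H2).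
      apply Rmult_le_compat_l; [lra|]. specialize (Hs0 t). nra.
    - destruct (IH ltac:(lia)) as [Kk [HKk Hk1]].
      set (L := K * (Kk / c + 1)).
      assert (HKc : 0 <= Kk / c) by nonneg.
      assert (HL : 0 <= L) by nonneg.
      assert (Hder : Rbar_locally p_infty (fun t => (0 < t /\ 0 < tau q t < 1) /\
        0 <= Q t /\ Q t <= C * E0 ^ 2 * tau q t ^ (2 * p) /\ is_derive Q t (Derive Q t) /\
        Rabs (Derive Q t - (horner l11 (tau q t) + horner l22 (tau q t)) * Q t) <=
          L * tau q t ^ (q + S k))).
      { generalize (filter_and _ _ Hev Hk1). apply filter_imp.
        intros t [[Ht [[H1 H2] [[H3 H4] [H5 H6]]]] H7].
        assert (Hpos : forall n, 0 < tau q t ^ n) by (intros; apply pow_lt, tau_pos).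
        specialize (Hs0 t). split; [exact Ht|]. split; [|split; [|split; [exact H5|]]].
        - apply Rle_trans with (2 := H3). apply Rmult_le_pos; [lra|apply pow2_ge_0].
        - apply Rle_trans with (1 := H4). rewrite Rmult_assoc. apply Rmult_le_compat_l; [lra|].
          rewrite (Nat.mul_comm 2 p), pow_mult, <- Rpow_mult_distr. apply pow_incr. lra.
        - apply Rle_trans with (1 := H6). unfold L. rewrite Rmult_assoc.
          apply Rmult_le_compat_l; [exact HK|]. rewrite Rmult_plus_distr_r, Rmult_1_l.
          apply Rplus_le_compat.
          + assert (Hs2 : s t ^ 2 <= Kk / c * tau q t ^ k).
            { apply Rmult_le_reg_l with c; [exact Hc|].
              replace (c * (Kk / c * tau q t ^ k)) with (Kk * tau q t ^ k) by (field; lra). lra. }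
            replace (Kk / c * tau q t ^ (q + S k)) with (tau q t ^ S q * (Kk / c * tau q t ^ k)).
            * apply Rmult_le_compat_l; [apply Rlt_le, Hpos|exact Hs2].
            * replace (q + S k)%nat with (S q + k)%nat by lia. rewrite pow_add. ring.
          + apply Rle_trans with (tau q t ^ S M * 1).
            * apply Rmult_le_compat_l; [apply Rlt_le, Hpos|exact H1].
            * rewrite Rmult_1_r. apply pow_le_pow_lt1; [lra|lia]. }
      destruct Htrace as [[E [HE Htr]]|Htr].
      + destruct (Nat.le_gt_cases (S k) (E * q)) as [Hsmall|Hlarge].
        * (* The assumed bound on the orbit already gives this order. *)
          exists (C * E0 ^ 2). split; [apply Rmult_le_pos; [lra|apply pow2_ge_0]|].
          revert Hder. apply filter_imp. intros t [[Ht Ht2] [_ [H _]]].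
          apply Rle_trans with (1 := H). apply Rmult_le_compat_l.
          -- apply Rmult_le_pos; [lra|apply pow2_ge_0].
          -- apply pow_le_pow_lt1; [lra|lia].
        * destruct (filter_and _ _ Hder Htr) as [T HT].
          exists (L * INR q). split; [apply Rmult_le_pos; lra|].
          exists (Rmax T 0 + 1). intros t Ht.
          assert (HT0 : 0 <= Rmax T 0) by apply Rmax_r.
          assert (HTT : T <= Rmax T 0) by apply Rmax_l.
          apply (decay_from_infinity q E (S k) Q (Derive Q) L (C * E0 ^ 2) (Rmax T 0 + 1));
            try assumption; try lra.
          -- intros u Hu. apply (HT u). lra.
          -- intros u Hu. destruct (HT u ltac:(lra)) as [[_ [Q0 [_ [_ H]]]] Htru].
             apply Rabs_le_between in H.
             assert (- INR E * tau q u ^ q * Q u <=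
               (horner l11 (tau q u) + horner l22 (tau q u)) * Q u)
               by (apply Rmult_le_compat_r; assumption). lra.
          -- intros u Hu. destruct (HT u ltac:(lra)) as [[[_ Htu] [_ [H _]]] _].
             apply Rle_trans with (1 := H). apply Rmult_le_compat_l.
             ++ apply Rmult_le_pos; [lra|apply pow2_ge_0].
             ++ apply pow_le_pow_lt1; [lra|lia].
      + destruct (filter_and _ _ Hder (Htr (INR (S (S k))))) as [T HT].
        assert (HT0 : 0 <= Rmax T 0) by apply Rmax_r.
        assert (HTT : T <= Rmax T 0) by apply Rmax_l.
        destruct (decay_from_start q (S (S k)) (S k) Q (Derive Q) L (Rmax T 0 + 1)) as [K' HK'];
          try assumption; try lra; try nia.
        -- intros u Hu. apply (HT u). lra.
        -- intros u Hu. destruct (HT u ltac:(lra)) as [[_ [Q0 [_ [_ H]]]] Htru].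
           apply Rabs_le_between in H.
           assert ((horner l11 (tau q u) + horner l22 (tau q u)) * Q u <=
             - INR (S (S k)) * tau q u ^ q * Q u)
             by (apply Rmult_le_compat_r; assumption). lra.
        -- exists (Rabs K'). split; [apply Rabs_pos|]. exists (Rmax T 0 + 1). intros t Ht.
           apply Rle_trans with (1 := HK' t ltac:(lra)).
           apply Rmult_le_compat_r; [apply pow_le, Rlt_le, tau_pos|apply Rle_abs]. }
  intros n Hn. destruct (Hboot (2 * n)%nat Hn) as [Kn [HKn HQn]].
  exists (sqrt (Kn / c)). generalize (filter_and _ _ Hev HQn). apply filter_imp.
  intros t [[Ht [_ [[H3 _] _]]] HQt].
  assert (HKc : 0 <= Kn / c) by nonneg.
  assert (s t <= sqrt (Kn / c) * tau q t ^ n).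
  { apply sq_le_sq.
    - apply Rmult_le_pos; [apply sqrt_pos|apply pow_le; lra].
    - rewrite Rpow_mult_distr, pow2_sqrt by exact HKc. rewrite <- pow_mult, Nat.mul_comm.
      apply Rmult_le_reg_l with c; [exact Hc|].
      replace (c * (Kn / c * tau q t ^ (2 * n))) with (Kn * tau q t ^ (2 * n)) by (field; lra). lra. }
  unfold s in H. generalize (Rabs_pos (A t)) (Rabs_pos (B t)). lra.
Qed.

(** * Orbits asymptotic to a saddle *)


(** With [c = - mu] and [c = mu], the two components of the field [(g1, g2)] in the
    eigencoordinates [xi = v - mu u], [eta = v + mu u] of [u' = v], [v' = mu ^ 2 u]. *)
Definition eigen_field (mu c : R) (g1 g2 : R -> R -> R -> R) (t xi eta : R) : R :=
  g2 t ((eta - xi) / (2 * mu)) ((xi + eta) / 2) + c * g1 t ((eta - xi) / (2 * mu)) ((xi + eta) / 2).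

Lemma horner_bound_tau (q : nat) (l : list R) :
  (0 < q)%nat -> exists K, 0 <= K /\
    Rbar_locally p_infty (fun t => Rabs (horner l (tau q t) - horner l 0) <= K * tau q t).
Proof.
  intros Hq. destruct (horner_0 l) as [K [HK H]]. exists K. split; [exact HK|].
  generalize (eventually_time_tau q (fun s => Rabs (horner l s - horner l 0) <= K * s ^ 1) Hq H).
  apply filter_imp. intros t. rewrite pow_1. auto.
Qed.

Lemma saddle_splitting (q : nat) (mu : R) (l11 l12 l21 l22 : list R) (M : nat) (g1 g2 : R -> R -> R -> R) :
  (0 < q)%nat -> 0 < mu ->
  horner l11 0 = 0 -> horner l12 0 = 1 -> horner l21 0 = mu ^ 2 -> horner l22 0 = 0 ->
  quasi_linear q l11 l12 l21 l22 M g1 g2 ->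
  exists K d, 0 <= K /\ 0 < d /\ Rbar_locally p_infty (fun t => forall xi eta,
    Rabs xi <= d * tau q t ^ S q -> Rabs eta <= d * tau q t ^ S q ->
    Rabs (eigen_field mu (- mu) g1 g2 t xi eta + mu * xi) <=
      K * (tau q t * (Rabs xi + Rabs eta) + tau q t ^ S M) /\
    Rabs (eigen_field mu mu g1 g2 t xi eta - mu * eta) <=
      K * (tau q t * (Rabs xi + Rabs eta) + tau q t ^ S M)).
Proof.
  intros Hq Hmu Z11 Z12 Z21 Z22 [K [HK HG]].
  destruct (horner_bound_tau q l11 Hq) as [K1 [HK1 B1]].
  destruct (horner_bound_tau q l12 Hq) as [K2 [HK2 B2]].
  destruct (horner_bound_tau q l21 Hq) as [K3 [HK3 B3]].
  destruct (horner_bound_tau q l22 Hq) as [K4 [HK4 B4]].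
  set (L := K + K1 + K2 + K3 + K4).
  assert (HL : 0 <= L) by nonneg.
  assert (Hi : 0 < / (2 * mu)) by (apply Rinv_0_lt_compat; lra).
  set (w := / (2 * mu) + / 2).
  assert (Hw : 0 < w) by (unfold w; lra).
  exists ((1 + mu) * L * (2 * w + 1)), (Rmin 1 mu).
  split; [apply Rmult_le_pos; [apply Rmult_le_pos; lra|lra]|].
  split; [apply Rmin_glb_lt; lra|].
  generalize (filter_and _ _ (filter_and _ _ HG (eventually_tau_lt q 1 Hq Rlt_0_1))
    (filter_and _ _ (filter_and _ _ B1 B2) (filter_and _ _ B3 B4))).
  rewrite Z11, Z12, Z21, Z22. apply filter_imp.
  intros t [[HGt Ht] [[E1 E2] [E3 E4]]] xi eta Hxi Heta.
  set (T := tau q t) in *. set (z := T ^ S q) in *.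
  assert (Hz : 0 < z) by (apply pow_lt; lra).
  assert (HzT : z <= T). { rewrite <- (pow_1 T). apply pow_le_pow_lt1; [lra|lia]. }
  assert (Hm1 : Rmin 1 mu <= 1) by apply Rmin_l.
  assert (Hm2 : Rmin 1 mu <= mu) by apply Rmin_r.
  assert (Hdz1 : Rmin 1 mu * z <= z) by nra.
  assert (Hdz2 : Rmin 1 mu * z <= mu * z) by nra.
  set (u := (eta - xi) / (2 * mu)). set (v := (xi + eta) / 2).
  set (n := Rabs xi + Rabs eta).
  assert (Hn : 0 <= n) by nonneg.
  assert (Hu : Rabs u <= / (2 * mu) * n).
  { unfold u, Rdiv. rewrite Rabs_mult, (Rabs_pos_eq (/ (2 * mu))) by lra.
    rewrite Rmult_comm. apply Rmult_le_compat_l; [lra|]. unfold n, Rminus.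
    apply Rle_trans with (1 := Rabs_triang _ _). rewrite Rabs_Ropp. lra. }
  assert (Hv : Rabs v <= / 2 * n).
  { unfold v, Rdiv. rewrite Rabs_mult, (Rabs_pos_eq (/ 2)) by lra.
    rewrite Rmult_comm. apply Rmult_le_compat_l; [lra|]. unfold n.
    apply Rle_trans with (1 := Rabs_triang _ _). lra. }
  assert (Huz : Rabs u <= z).
  { apply Rle_trans with (1 := Hu). apply Rmult_le_reg_l with (2 * mu); [lra|].
    rewrite <- Rmult_assoc, Rinv_r by lra. unfold n. lra. }
  assert (Hvz : Rabs v <= z) by (unfold n in Hv; lra).
  destruct (HGt u v Huz Hvz) as [G1 G2]. clear HGt.
  assert (Huv : Rabs u + Rabs v <= w * n) by (unfold w; lra).
  assert (Huv0 : 0 <= Rabs u + Rabs v) by nonneg.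
  assert (HM : 0 <= T ^ S M) by nonneg.
  set (X := T * (Rabs u + Rabs v) + T ^ S M).
  assert (HTuv : 0 <= T * (Rabs u + Rabs v)) by nonneg.
  assert (HzX : z * (Rabs u + Rabs v) + T ^ S M <= X).
  { unfold X. apply Rplus_le_compat_r. apply Rmult_le_compat_r; lra. }
  assert (Hlin : forall g a b a0 b0 Ka Kb, 0 <= Ka -> 0 <= Kb -> Ka + Kb + K <= L ->
    Rabs (a - a0) <= Ka * T -> Rabs (b - b0) <= Kb * T ->
    Rabs (g - (a * u + b * v)) <= K * (z * (Rabs u + Rabs v) + T ^ S M) ->
    Rabs (g - (a0 * u + b0 * v)) <= L * X).
  { intros g a b a0 b0 Ka Kb HKa HKb HKL Ha Hb Hg.
    replace (g - (a0 * u + b0 * v)) with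
      ((g - (a * u + b * v)) + (a - a0) * u + (b - b0) * v) by ring.
    apply Rle_trans with (1 := Rabs_triang3 _ _ _). rewrite !Rabs_mult.
    assert (Rabs (a - a0) * Rabs u <= Ka * T * Rabs u) by (apply Rmult_le_compat_r; [apply Rabs_pos|exact Ha]).
    assert (Rabs (b - b0) * Rabs v <= Kb * T * Rabs v) by (apply Rmult_le_compat_r; [apply Rabs_pos|exact Hb]).
    assert (F1 : Ka * T * Rabs u <= Ka * X).
    { rewrite Rmult_assoc. apply Rmult_le_compat_l; [exact HKa|]. unfold X.
      assert (0 <= T * Rabs v) by nonneg. lra. }
    assert (F2 : Kb * T * Rabs v <= Kb * X).
    { rewrite Rmult_assoc. apply Rmult_le_compat_l; [exact HKb|]. unfold X.
      assert (0 <= T * Rabs u) by nonneg. lra. }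
    assert (F3 : K * (z * (Rabs u + Rabs v) + T ^ S M) <= K * X) by nonneg.
    assert (F4 : (Ka + Kb + K) * X <= L * X).
    { apply Rmult_le_compat_r; [unfold X; lra|exact HKL]. }
    lra. }
  assert (H1 := Hlin (g1 t u v) _ _ 0 1 K1 K2 HK1 HK2 ltac:(unfold L; lra) E1 E2 G1).
  assert (H2 := Hlin (g2 t u v) _ _ (mu ^ 2) 0 K3 K4 HK3 HK4 ltac:(unfold L; lra) E3 E4 G2).
  assert (HXn : X <= (2 * w + 1) * (T * n + T ^ S M)).
  { unfold X. assert (T * (Rabs u + Rabs v) <= T * (w * n)) by nra.
    assert (0 <= T * n) by nonneg.
    assert (0 <= w * T ^ S M) by nonneg. lra. }
  assert (Hfin : (1 + mu) * (L * X) <= (1 + mu) * L * (2 * w + 1) * (T * n + T ^ S M)).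
  { rewrite !Rmult_assoc. apply Rmult_le_compat_l; [lra|]. apply Rmult_le_compat_l; assumption. }
  assert (Hc : forall c, Rabs c = mu ->
    Rabs (eigen_field mu c g1 g2 t xi eta - (mu ^ 2 * u + c * v)) <= (1 + mu) * (L * X)).
  { intros c Hcm. unfold eigen_field. fold u v.
    replace (g2 t u v + c * g1 t u v - (mu ^ 2 * u + c * v)) with
      ((g2 t u v - (mu ^ 2 * u + 0 * v)) + c * (g1 t u v - (0 * u + 1 * v))) by ring.
    apply Rle_trans with (1 := Rabs_triang _ _). rewrite Rabs_mult, Hcm.
    assert (mu * Rabs (g1 t u v - (0 * u + 1 * v)) <= mu * (L * X)) by nonneg.
    lra. }
  split.
  - replace (mu * xi) with (- (mu ^ 2 * u + - mu * v)) by (unfold u, v; field; lra).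
    apply Rle_trans with (2 := Hfin), Hc. rewrite Rabs_Ropp, Rabs_pos_eq; lra.
  - replace (mu * eta) with (mu ^ 2 * u + mu * v) by (unfold u, v; field; lra).
    apply Rle_trans with (2 := Hfin), Hc. rewrite Rabs_pos_eq; lra.
Qed.

Lemma continuous_eigencoordinates (mu : R) (A B : R -> R) (t : R) :
  continuous A t -> continuous B t ->
  continuous (fun s => (B s - A s) / (2 * mu)) t /\ continuous (fun s => (A s + B s) / 2) t.
Proof.
  intros HA HB. split.
  - apply (continuous_mult (fun s => B s - A s) (fun _ => / (2 * mu))); [|apply continuous_const].
    apply (continuous_minus B A); assumption.
  - apply (continuous_mult (fun s => A s + B s) (fun _ => / 2)); [|apply continuous_const].
    apply (continuous_plus A B); assumption.
Qed.

Lemma regular_eigen_field (mu c : R) (g1 g2 : R -> R -> R -> R) :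
  0 < mu -> regular g1 -> regular g2 -> regular (eigen_field mu c g1 g2).
Proof.
  intros Hmu [C1 L1] [C2 L2].
  assert (Hi : 0 < / (2 * mu)) by (apply Rinv_0_lt_compat; lra).
  split.
  - intros th A B t Ht Hth HA HB. destruct (continuous_eigencoordinates mu A B t HA HB) as [E1 E2].
    unfold eigen_field.
    apply (continuous_plus (fun s => g2 (th s) ((B s - A s) / (2 * mu)) ((A s + B s) / 2))
      (fun s => c * g1 (th s) ((B s - A s) / (2 * mu)) ((A s + B s) / 2))).
    + apply (C2 th (fun s => (B s - A s) / (2 * mu)) (fun s => (A s + B s) / 2)); assumption.
    + apply (continuous_mult (fun _ => c)); [apply continuous_const|].
      apply (C1 th (fun s => (B s - A s) / (2 * mu)) (fun s => (A s + B s) / 2)); assumption.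
  - intros T1 T2 r HT1.
    set (r' := (2 * / (2 * mu) + 1) * Rabs r).
    destruct (L1 T1 T2 r' HT1) as [K1 [HK1 H1]], (L2 T1 T2 r' HT1) as [K2 [HK2 H2]].
    set (w := / (2 * mu) + / 2).
    exists ((K2 + Rabs c * K1) * w). split.
    { apply Rmult_le_pos; [|unfold w; lra]. apply Rplus_le_le_0_compat; [exact HK2|].
      apply Rmult_le_pos; [apply Rabs_pos|exact HK1]. }
    intros t a b a' b' Ht Ha Hb Ha' Hb'.
    assert (Hr : r <= Rabs r) by apply Rle_abs.
    assert (Hu : forall x y, Rabs ((y - x) / (2 * mu)) <= / (2 * mu) * (Rabs x + Rabs y)).
    { intros x y. unfold Rdiv. rewrite Rabs_mult, (Rabs_pos_eq (/ (2 * mu))) by lra.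
      rewrite Rmult_comm. apply Rmult_le_compat_l; [lra|]. unfold Rminus.
      apply Rle_trans with (1 := Rabs_triang _ _). rewrite Rabs_Ropp. lra. }
    assert (Hv : forall x y, Rabs ((x + y) / 2) <= / 2 * (Rabs x + Rabs y)).
    { intros x y. unfold Rdiv. rewrite Rabs_mult, (Rabs_pos_eq (/ 2)) by lra.
      rewrite Rmult_comm. apply Rmult_le_compat_l; [lra|]. apply Rabs_triang. }
    assert (Hur : forall x y, Rabs x <= r -> Rabs y <= r -> Rabs ((y - x) / (2 * mu)) <= r').
    { intros x y Hx Hy. apply Rle_trans with (1 := Hu x y). unfold r'.
      assert (/ (2 * mu) * (Rabs x + Rabs y) <= / (2 * mu) * (2 * Rabs r)) by nra.
      generalize (Rabs_pos r). lra. }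
    assert (Hvr : forall x y, Rabs x <= r -> Rabs y <= r -> Rabs ((x + y) / 2) <= r').
    { intros x y Hx Hy. apply Rle_trans with (1 := Hv x y). unfold r'.
      assert (0 <= / (2 * mu) * Rabs r) by nonneg. lra. }
    set (N := Rabs (a' - a) + Rabs (b' - b)).
    assert (Hd : Rabs ((b' - a') / (2 * mu) - (b - a) / (2 * mu)) +
      Rabs ((a' + b') / 2 - (a + b) / 2) <= w * N).
    { replace ((b' - a') / (2 * mu) - (b - a) / (2 * mu)) with
        (((b' - b) - (a' - a)) / (2 * mu)) by (field; lra).
      replace ((a' + b') / 2 - (a + b) / 2) with (((a' - a) + (b' - b)) / 2) by field.
      generalize (Hu (a' - a) (b' - b)) (Hv (a' - a) (b' - b)). unfold w, N. lra. }
    specialize (H1 t _ _ _ _ Ht (Hur a b Ha Hb) (Hvr a b Ha Hb) (Hur a' b' Ha' Hb') (Hvr a' b' Ha' Hb')).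
    specialize (H2 t _ _ _ _ Ht (Hur a b Ha Hb) (Hvr a b Ha Hb) (Hur a' b' Ha' Hb') (Hvr a' b' Ha' Hb')).
    set (P1 := g1 t ((b' - a') / (2 * mu)) ((a' + b') / 2)) in *.
    set (P0 := g1 t ((b - a) / (2 * mu)) ((a + b) / 2)) in *.
    set (Q1 := g2 t ((b' - a') / (2 * mu)) ((a' + b') / 2)) in *.
    set (Q0 := g2 t ((b - a) / (2 * mu)) ((a + b) / 2)) in *.
    unfold eigen_field. fold P0 P1 Q0 Q1.
    replace (Q1 + c * P1 - (Q0 + c * P0)) with ((Q1 - Q0) + c * (P1 - P0)) by ring.
    apply Rle_trans with (1 := Rabs_triang _ _). rewrite Rabs_mult.
    assert (G2 := Rle_trans _ _ _ H2 (Rmult_le_compat_l K2 _ _ HK2 Hd)).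
    assert (G1 := Rmult_le_compat_l (Rabs c) _ _ (Rabs_pos c)
      (Rle_trans _ _ _ H1 (Rmult_le_compat_l K1 _ _ HK1 Hd))).
    lra.
Qed.

(** Shooting: outside the tube in the unstable direction the extended field
    points away from it, so an orbit found by the intermediate value theorem
    to sit on the axis at time [T1] has been inside all along. *)
Lemma saddle_shooting (h1 h2 : R -> R -> R -> R) (r dr : R -> R) (t0 T1 : R) :
  field_continuous h1 everywhere -> field_continuous h2 everywhere ->
  field_lipschitz h1 -> field_lipschitz h2 -> 0 <= t0 <= T1 ->
  (forall t, t0 <= t -> is_derive r t (dr t) /\ 0 < r t) ->
  (forall t a b, t0 <= t ->
    (a = r t -> h1 t a b < dr t) /\ (a = - r t -> - dr t < h1 t a b) /\
    (b = r t -> dr t < h2 t a b) /\ (b = - r t -> h2 t a b < - dr t)) ->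
  exists A B, solves h1 h2 A B /\ forall t, t0 <= t <= T1 -> Rabs (A t) <= r t /\ Rabs (B t) <= r t.
Proof.
  intros Hc1 Hc2 Hl1 Hl2 HT Hr Hsign.
  assert (Hsol : forall b, exists Z : (R -> R) * (R -> R),
    fst Z t0 = 0 /\ snd Z t0 = b /\ solves h1 h2 (fst Z) (snd Z)).
  { intros b. destruct (cauchy_lipschitz h1 h2 t0 0 b) as [A [B H]]; try assumption.
    exists (A, B). exact H. }
  set (Z := fun b => proj1_sig (constructive_indefinite_description _ (Hsol b))).
  assert (HZ : forall b, fst (Z b) t0 = 0 /\ snd (Z b) t0 = b /\ solves h1 h2 (fst (Z b)) (snd (Z b))).
  { intros b. exact (proj2_sig (constructive_indefinite_description _ (Hsol b))). }
  clearbody Z. clear Hsol.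
  assert (Hup : forall A B s, solves h1 h2 A B -> t0 <= s <= T1 -> r s < B s -> r T1 < B T1).
  { intros A B s HS Hs HB.
    assert (H : r T1 - B T1 < 0); [|lra].
    apply (stays_negative (fun t => r t - B t) (fun t => dr t - h2 t (A t) (B t)) s T1); try lra.
    - intros t Ht. apply @is_derive_minus; [apply Hr; lra|apply HS].
    - intros t Ht Hz. destruct (Hsign t (A t) (B t) ltac:(lra)) as [_ [_ [H _]]].
      specialize (H ltac:(lra)). lra. }
  assert (Hdown : forall A B s, solves h1 h2 A B -> t0 <= s <= T1 -> B s < - r s -> B T1 < - r T1).
  { intros A B s HS Hs HB.
    assert (H : B T1 + r T1 < 0); [|lra].
    apply (stays_negative (fun t => B t + r t) (fun t => h2 t (A t) (B t) + dr t) s T1); try lra.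
    - intros t Ht. apply @is_derive_plus; [apply HS|apply Hr; lra].
    - intros t Ht Hz. destruct (Hsign t (A t) (B t) ltac:(lra)) as [_ [_ [_ H]]].
      specialize (H ltac:(lra)). lra. }
  destruct (Hr t0 ltac:(lra)) as [_ Hr0]. destruct (Hr T1 ltac:(lra)) as [_ HrT].
  destruct (gronwall h1 h2 t0 T1 Hl1 Hl2 HT) as [K [HK HG]].
  (* Initial values twice the half-width lie outside the tube, on the two sides of it. *)
  destruct (IVT_gen (fun b => snd (Z b) T1) (- (2 * r t0)) (2 * r t0) 0) as [b [_ Hb]].
  { intros b eps Heps. exists (eps / (K + 1)). split; [apply Rdiv_lt_0_compat; lra|].
    intros b' [_ Hb']. simpl in *. unfold Rdist in *.
    destruct (HZ b) as [Ea [Eb HS]], (HZ b') as [Ea' [Eb' HS']].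
    destruct (HG _ _ _ _ HS HS' T1 ltac:(lra)) as [_ G].
    rewrite Ea, Ea', Eb, Eb', Rminus_diag, Rabs_R0, Rplus_0_l in G.
    apply Rle_lt_trans with (1 := G).
    apply Rle_lt_trans with ((K + 1) * Rabs (b' - b)).
    - generalize (Rabs_pos (b' - b)). lra.
    - apply Rlt_le_trans with ((K + 1) * (eps / (K + 1))).
      + apply Rmult_lt_compat_l; lra.
      + right. field. lra. }
  { destruct (HZ (- (2 * r t0))) as [_ [Eb HS]], (HZ (2 * r t0)) as [_ [Eb' HS']].
    assert (H1 := Hdown _ _ t0 HS ltac:(lra) ltac:(lra)).
    assert (H2 := Hup _ _ t0 HS' ltac:(lra) ltac:(lra)).
    split.
    - apply Rle_trans with (1 := Rmin_l _ _). lra.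
    - apply Rle_trans with (2 := Rmax_r _ _). lra. }
  destruct (HZ b) as [Ea [Eb HS]]. exists (fst (Z b)), (snd (Z b)). split; [exact HS|].
  intros t Ht. split.
  - apply Rabs_le. split.
    + assert (H : - fst (Z b) t - r t < 0); [|lra].
      apply (stays_negative (fun t => - fst (Z b) t - r t)
        (fun t => - h1 t (fst (Z b) t) (snd (Z b) t) - dr t) t0 T1); try lra.
      * intros u Hu. apply @is_derive_minus; [apply @is_derive_opp, HS|apply Hr; lra].
      * intros u Hu Hz. destruct (Hsign u (fst (Z b) u) (snd (Z b) u) ltac:(lra)) as [_ [H _]].
        specialize (H ltac:(lra)). lra.
    + assert (H : fst (Z b) t - r t < 0); [|lra].
      apply (stays_negative (fun t => fst (Z b) t - r t)
        (fun t => h1 t (fst (Z b) t) (snd (Z b) t) - dr t) t0 T1); try lra.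
      * intros u Hu. apply @is_derive_minus; [apply HS|apply Hr; lra].
      * intros u Hu Hz. destruct (Hsign u (fst (Z b) u) (snd (Z b) u) ltac:(lra)) as [H _].
        specialize (H ltac:(lra)). lra.
  - apply Rabs_le. split; apply Rnot_lt_le; intros Hlt.
    + generalize (Hdown _ _ t HS Ht Hlt). lra.
    + generalize (Hup _ _ t HS Ht Hlt). lra.
Qed.

Lemma saddle_trapped (q : nat) (mu : R) (l11 l12 l21 l22 : list R) :
  (0 < q)%nat -> 0 < mu ->
  horner l11 0 = 0 -> horner l12 0 = 1 -> horner l21 0 = mu ^ 2 -> horner l22 0 = 0 ->
  forall p M g1 g2, (q + 2 <= p)%nat -> (p <= M)%nat ->
    regular g1 -> regular g2 -> quasi_linear q l11 l12 l21 l22 M g1 g2 ->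
    exists t0 A B K, 0 < t0 /\ forall t, t0 <= t -> derivatives g1 g2 A B t /\
      Rabs (A t) <= K * tau q t ^ p /\ Rabs (B t) <= K * tau q t ^ p.
Proof.
  intros Hq Hmu Z11 Z12 Z21 Z22 p M g1 g2 Hp HM R1 R2 HQL.
  assert (Hq0 : 0 < INR q) by nonneg.
  destruct (saddle_splitting q mu l11 l12 l21 l22 M g1 g2) as [K [d [HK [Hd Hsplit]]]]; try assumption.
  assert (S1 := regular_eigen_field mu (- mu) g1 g2 Hmu R1 R2).
  assert (S2 := regular_eigen_field mu mu g1 g2 Hmu R1 R2).
  set (rate := INR p / INR q).
  assert (Hrate : 0 <= rate) by nonneg.
  assert (Hdd : 0 < Rmin (Rmin 1 d) (mu / (3 * K + rate + 1))).
  { apply Rmin_glb_lt; [apply Rmin_glb_lt; lra|]. apply Rdiv_lt_0_compat; lra. }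
  destruct (filter_and _ _ (filter_and _ _ (eventually_gt 0) (eventually_tau_lt q _ Hq Hdd)) Hsplit)
    as [T HT].
  set (t0 := Rmax T 0 + 1).
  assert (Ht00 : 0 < t0) by (unfold t0; generalize (Rmax_r T 0); lra).
  assert (Ht0T : T < t0) by (unfold t0; generalize (Rmax_l T 0); lra).
  clearbody t0.
  assert (Htau : forall t, t0 <= t -> 0 < tau q t /\ tau q t < 1 /\ tau q t < d /\
    (3 * K + rate) * tau q t < mu).
  { intros t Ht. destruct (HT t ltac:(lra)) as [[_ [A1 A2]] _].
    generalize (Rmin_l (Rmin 1 d) (mu / (3 * K + rate + 1)))
      (Rmin_r (Rmin 1 d) (mu / (3 * K + rate + 1))) (Rmin_l 1 d) (Rmin_r 1 d). intros.
    split; [exact A1|]. split; [lra|]. split; [lra|].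
    assert (tau q t * (3 * K + rate + 1) < mu); [|lra].
    apply Rlt_le_trans with (mu / (3 * K + rate + 1) * (3 * K + rate + 1)).
    - apply Rmult_lt_compat_r; lra.
    - right. field. lra. }
  destruct (trapped_in_tube q p (eigen_field mu (- mu) g1 g2) (eigen_field mu mu g1 g2) t0 Hq Ht00 S1 S2)
    as [[Hc1 [Hc2 [Hl1 Hl2]]] Htrap].
  { intros t Ht. generalize (Htau t Ht). lra. }
  set (h1 := tube_field t0 (fun t => tau q t ^ p) (eigen_field mu (- mu) g1 g2)) in *.
  set (h2 := tube_field t0 (fun t => tau q t ^ p) (eigen_field mu mu g1 g2)) in *.
  set (r := fun t => tau q t ^ p).
  set (dr := fun t => - rate * tau q t ^ (p + q)).
  assert (Hpos : forall n t, 0 < tau q t ^ n) by (intros; apply pow_lt, tau_pos).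
  (* On the sides of the tube the linear part [mu * r] beats the errors and the shrinking of the tube. *)
  assert (Hest : forall t x y, t0 <= t -> Rabs x <= r t -> Rabs y <= r t ->
    Rabs (eigen_field mu (- mu) g1 g2 t x y + mu * x) + Rabs (dr t) < mu * r t /\
    Rabs (eigen_field mu mu g1 g2 t x y - mu * y) + Rabs (dr t) < mu * r t).
  { intros t x y Ht Hx Hy. destruct (Htau t Ht) as [P1 [P2 [P3 P4]]].
    destruct (HT t ltac:(lra)) as [_ HS].
    assert (Hin : r t <= d * tau q t ^ S q).
    { unfold r. apply Rle_trans with (tau q t ^ S (S q)).
      - apply pow_le_pow_lt1; [lra|lia].
      - rewrite <- tech_pow_Rmult. apply Rmult_le_compat_r; [apply Rlt_le, Hpos|lra]. }
    destruct (HS x y ltac:(lra) ltac:(lra)) as [E1 E2].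
    assert (Hdr : Rabs (dr t) <= rate * tau q t * r t).
    { unfold dr, r. rewrite Rabs_mult, Rabs_Ropp, (Rabs_pos_eq rate) by exact Hrate.
      rewrite Rabs_pos_eq by apply Rlt_le, Hpos. rewrite Rmult_assoc.
      apply Rmult_le_compat_l; [exact Hrate|]. rewrite (tech_pow_Rmult (tau q t) p).
      apply pow_le_pow_lt1; [lra|lia]. }
    assert (HMr : tau q t ^ S M <= tau q t * r t).
    { unfold r. rewrite (tech_pow_Rmult (tau q t) p). apply pow_le_pow_lt1; [lra|lia]. }
    assert (HX : K * (tau q t * (Rabs x + Rabs y) + tau q t ^ S M) <= 3 * K * tau q t * r t).
    { replace (3 * K * tau q t * r t) with (K * (tau q t * (r t + r t) + tau q t * r t)) by ring.
      apply Rmult_le_compat_l; [exact HK|]. apply Rplus_le_compat; [|exact HMr].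
      apply Rmult_le_compat_l; lra. }
    assert (HY : (3 * K + rate) * tau q t * r t < mu * r t).
    { apply Rmult_lt_compat_r; [apply Hpos|exact P4]. }
    lra. }
  destruct Htrap as [XI [ETA HXE]].
  { intros n. apply (saddle_shooting h1 h2 r dr t0 (t0 + INR n)); try assumption.
    - generalize (pos_INR n). lra.
    - intros t Ht. split; [|apply Hpos]. apply is_derive_tau_pow; [exact Hq|lra].
    - intros t a b Ht. unfold h1, h2, tube_field. rewrite Rmax_right by exact Ht.
      fold (r t).
      assert (Hr0 : 0 <= r t) by nonneg.
      destruct (Hest t (clamp (r t) a) (clamp (r t) b) Ht (clamp_bound _ _ Hr0) (clamp_bound _ _ Hr0))
        as [E1 E2].
      assert (D1 := Rle_abs (dr t)). assert (D2 := Rabs_maj2 (dr t)).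
      split; [|split; [|split]]; intros ->.
      + rewrite (clamp_above (r t) (r t)) in * by lra.
        generalize (Rle_abs (eigen_field mu (- mu) g1 g2 t (r t) (clamp (r t) b) + mu * r t)). lra.
      + rewrite (clamp_below (r t) (- r t)) in * by lra.
        generalize (Rabs_maj2 (eigen_field mu (- mu) g1 g2 t (- r t) (clamp (r t) b) + mu * - r t)). lra.
      + rewrite (clamp_above (r t) (r t)) in * by lra.
        generalize (Rabs_maj2 (eigen_field mu mu g1 g2 t (clamp (r t) a) (r t) - mu * r t)). lra.
      + rewrite (clamp_below (r t) (- r t)) in * by lra.
        generalize (Rle_abs (eigen_field mu mu g1 g2 t (clamp (r t) a) (- r t) - mu * - r t)). lra. }
  assert (Hi : 0 < / (2 * mu)) by (apply Rinv_0_lt_compat; lra).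
  exists t0, (fun t => (ETA t - XI t) / (2 * mu)), (fun t => (XI t + ETA t) / 2), (2 * / (2 * mu) + 1).
  split; [exact Ht00|]. intros t Ht. destruct (HXE t Ht) as [[D1 D2] [B1 B2]].
  assert (P := Hpos p t). assert (P' : 0 <= / (2 * mu) * tau q t ^ p) by nonneg.
  split; [split|split].
  - replace (g1 t ((ETA t - XI t) / (2 * mu)) ((XI t + ETA t) / 2)) with
      (/ (2 * mu) * (eigen_field mu mu g1 g2 t (XI t) (ETA t) - eigen_field mu (- mu) g1 g2 t (XI t) (ETA t)))
      by (unfold eigen_field; field; lra).
    apply is_derive_ext with (fun t => / (2 * mu) * (ETA t - XI t)).
    { intros s. apply Rmult_comm. }
    apply is_derive_scal. apply @is_derive_minus; assumption.
  - replace (g2 t ((ETA t - XI t) / (2 * mu)) ((XI t + ETA t) / 2)) with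
      (/ 2 * (eigen_field mu (- mu) g1 g2 t (XI t) (ETA t) + eigen_field mu mu g1 g2 t (XI t) (ETA t)))
      by (unfold eigen_field; field).
    apply is_derive_ext with (fun t => / 2 * (XI t + ETA t)).
    { intros s. apply Rmult_comm. }
    apply is_derive_scal. apply @is_derive_plus; assumption.
  - unfold Rdiv. rewrite Rabs_mult, (Rabs_pos_eq (/ (2 * mu))) by lra.
    assert (Rabs (ETA t - XI t) <= 2 * tau q t ^ p).
    { unfold Rminus. apply Rle_trans with (1 := Rabs_triang _ _). rewrite Rabs_Ropp. lra. }
    assert (Rabs (ETA t - XI t) * / (2 * mu) <= 2 * tau q t ^ p * / (2 * mu))
      by (apply Rmult_le_compat_r; lra). lra.
  - unfold Rdiv. rewrite Rabs_mult, (Rabs_pos_eq (/ 2)) by lra.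
    generalize (Rabs_triang (XI t) (ETA t)). lra.
Qed.

(** Everything besides the constant diagonal part carries a factor [tau] or has order
    [M + 1], so each pass through the scalar comparisons gains one power. *)
Lemma saddle_decay (q : nat) (mu : R) (l11 l12 l21 l22 : list R) :
  (0 < q)%nat -> 0 < mu ->
  horner l11 0 = 0 -> horner l12 0 = 1 -> horner l21 0 = mu ^ 2 -> horner l22 0 = 0 ->
  forall p M g1 g2 A B K, (q + 2 <= p)%nat ->
    quasi_linear q l11 l12 l21 l22 M g1 g2 ->
    Rbar_locally p_infty (fun t => derivatives g1 g2 A B t /\
      Rabs (A t) <= K * tau q t ^ p /\ Rabs (B t) <= K * tau q t ^ p) ->
    forall n, (n <= S M)%nat -> exists K', Rbar_locally p_infty (fun t =>
      Rabs (A t) <= K' * tau q t ^ n /\ Rabs (B t) <= K' * tau q t ^ n).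
Proof.
  intros Hq Hmu Z11 Z12 Z21 Z22 p M g1 g2 A B K0 Hp HQL Horb.
  assert (Hq0 : 0 < INR q) by nonneg.
  destruct (saddle_splitting q mu l11 l12 l21 l22 M g1 g2) as [K [d [HK [Hd Hsplit]]]]; try assumption.
  set (XI := fun t => B t + - mu * A t). set (ETA := fun t => B t + mu * A t).
  assert (Hpos : forall n t, 0 < tau q t ^ n) by (intros; apply pow_lt, tau_pos).
  assert (HA : forall t, (ETA t - XI t) / (2 * mu) = A t) by (intros t; unfold ETA, XI; field; lra).
  assert (HB : forall t, (XI t + ETA t) / 2 = B t) by (intros t; unfold ETA, XI; field).
  set (k1 := fun t => eigen_field mu (- mu) g1 g2 t (XI t) (ETA t)).
  set (k2 := fun t => eigen_field mu mu g1 g2 t (XI t) (ETA t)).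
  set (E0 := (1 + mu) * Rabs K0).
  assert (HE0 : 0 <= E0) by nonneg.
  assert (Hev : Rbar_locally p_infty (fun t => (0 < t /\ 0 < tau q t < 1) /\
    (is_derive XI t (k1 t) /\ is_derive ETA t (k2 t)) /\
    (Rabs (XI t) <= E0 * tau q t ^ p /\ Rabs (ETA t) <= E0 * tau q t ^ p) /\
    Rabs (k1 t + mu * XI t) <= K * (tau q t * (Rabs (XI t) + Rabs (ETA t)) + tau q t ^ S M) /\
    Rabs (k2 t - mu * ETA t) <= K * (tau q t * (Rabs (XI t) + Rabs (ETA t)) + tau q t ^ S M))).
  { assert (Hdd : 0 < Rmin 1 (d / (E0 + 1))).
    { apply Rmin_glb_lt; [lra|]. apply Rdiv_lt_0_compat; lra. }
    generalize (filter_and _ _ (filter_and _ _ (eventually_gt 0) (eventually_tau_lt q _ Hq Hdd))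
      (filter_and _ _ Horb Hsplit)).
    apply filter_imp. intros t [[Ht [Ht1 Ht2]] [[[D1 D2] [B1 B2]] HS]].
    generalize (Rmin_l 1 (d / (E0 + 1))) (Rmin_r 1 (d / (E0 + 1))). intros M1 M2.
    assert (Hk0 : K0 * tau q t ^ p <= Rabs K0 * tau q t ^ p).
    { apply Rmult_le_compat_r; [apply Rlt_le, Hpos|apply Rle_abs]. }
    assert (HmA : mu * Rabs (A t) <= mu * (Rabs K0 * tau q t ^ p)) by nra.
    assert (HX : Rabs (XI t) <= E0 * tau q t ^ p).
    { unfold XI. apply Rle_trans with (1 := Rabs_triang _ _).
      rewrite Rabs_mult, Rabs_Ropp, (Rabs_pos_eq mu) by lra. unfold E0. lra. }
    assert (HE : Rabs (ETA t) <= E0 * tau q t ^ p).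
    { unfold ETA. apply Rle_trans with (1 := Rabs_triang _ _).
      rewrite Rabs_mult, (Rabs_pos_eq mu) by lra. unfold E0. lra. }
    assert (Hin : E0 * tau q t ^ p <= d * tau q t ^ S q).
    { apply Rle_trans with (E0 * tau q t ^ (1 + S q)).
      - apply Rmult_le_compat_l; [exact HE0|]. apply pow_le_pow_lt1; [lra|lia].
      - rewrite pow_add, pow_1, <- Rmult_assoc. apply Rmult_le_compat_r; [apply Rlt_le, Hpos|].
        assert ((E0 + 1) * tau q t <= (E0 + 1) * (d / (E0 + 1))) by nra.
        replace ((E0 + 1) * (d / (E0 + 1))) with d in H by (field; lra). lra. }
    split; [split; [exact Ht|lra]|]. split; [|split; [split; assumption|]].
    - split.
      + unfold k1, eigen_field. rewrite HA, HB. apply @is_derive_plus; [exact D2|].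
        apply is_derive_scal. exact D1.
      + unfold k2, eigen_field. rewrite HA, HB. apply @is_derive_plus; [exact D2|].
        apply is_derive_scal. exact D1.
    - apply HS; lra. }
  assert (Hboot : forall n, (n <= S M)%nat -> exists Kn, 0 <= Kn /\ Rbar_locally p_infty (fun t =>
    Rabs (XI t) <= Kn * tau q t ^ n /\ Rabs (ETA t) <= Kn * tau q t ^ n)).
  { induction n as [|n IH]; intros HnM.
    - exists E0. split; [exact HE0|]. revert Hev. apply filter_imp.
      intros t [[_ Ht] [_ [[H1 H2] _]]]. simpl.
      assert (tau q t ^ p <= 1). { rewrite <- (pow_O (tau q t)). apply pow_le_pow_lt1; [lra|lia]. }
      assert (E0 * tau q t ^ p <= E0 * 1) by nonneg. lra.
    - destruct (IH ltac:(lia)) as [Kn [HKn Hn]].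
      set (L := K * (2 * Kn + 1)).
      assert (HL : 0 <= L) by nonneg.
      set (rate := INR (S n) / INR q).
      assert (Hdd : 0 < mu / 2 / (rate + 1)).
      { apply Rdiv_lt_0_compat; [lra|]. assert (0 <= rate); [|lra].
        apply Rmult_le_pos; [apply pos_INR|apply Rlt_le, Rinv_0_lt_compat, Hq0]. }
      assert (Hrate : 0 <= rate) by nonneg.
      destruct (filter_and _ _ Hev (filter_and _ _ Hn (eventually_tau_lt q _ Hq Hdd))) as [T HT].
      set (t1 := Rmax T 0 + 1).
      assert (Ht1 : 0 < t1) by (unfold t1; generalize (Rmax_r T 0); lra).
      assert (Ht1T : T < t1) by (unfold t1; generalize (Rmax_l T 0); lra).
      clearbody t1.
      assert (Herr : forall t, t1 <= t ->
        Rabs (k1 t + mu * XI t) <= L * tau q t ^ S n /\ Rabs (k2 t - mu * ETA t) <= L * tau q t ^ S n).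
      { intros t Ht. destruct (HT t ltac:(lra)) as [[[_ Htau] [_ [_ [H1 H2]]]] [[H3 H4] _]].
        assert (HX : K * (tau q t * (Rabs (XI t) + Rabs (ETA t)) + tau q t ^ S M) <= L * tau q t ^ S n).
        { unfold L. rewrite Rmult_assoc. apply Rmult_le_compat_l; [exact HK|].
          rewrite Rmult_plus_distr_r, Rmult_1_l. apply Rplus_le_compat.
          - replace (2 * Kn * tau q t ^ S n) with (tau q t * (2 * (Kn * tau q t ^ n))) by (simpl; ring).
            apply Rmult_le_compat_l; lra.
          - apply pow_le_pow_lt1; [lra|lia]. }
        lra. }
      assert (Hlate : forall t, t1 <= t -> INR (S n) / INR q * tau q t ^ q <= mu / 2).
      { intros t Ht. destruct (HT t ltac:(lra)) as [[[_ Htau] _] [_ [_ H]]]. fold rate.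
        assert (tau q t ^ q <= tau q t).
        { rewrite <- (pow_1 (tau q t)) at 2. apply pow_le_pow_lt1; [lra|lia]. }
        apply Rle_trans with (rate * tau q t); [apply Rmult_le_compat_l; assumption|].
        assert ((rate + 1) * tau q t <= (rate + 1) * (mu / 2 / (rate + 1))) by nonneg.
        replace ((rate + 1) * (mu / 2 / (rate + 1))) with (mu / 2) in H1 by (field; lra). lra. }
      assert (Hder : forall t, t1 <= t -> is_derive XI t (k1 t) /\ is_derive ETA t (k2 t)).
      { intros t Ht. apply (HT t). lra. }
      assert (Hsmall : forall t, t1 <= t -> Rabs (ETA t) <= E0 * tau q t).
      { intros t Ht. destruct (HT t ltac:(lra)) as [[[_ Htau] [_ [[_ H] _]]] _].
        apply Rle_trans with (1 := H). apply Rmult_le_compat_l; [exact HE0|].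
        rewrite <- (pow_1 (tau q t)) at 2. apply pow_le_pow_lt1; [lra|lia]. }
      assert (Hopp : forall t, t1 <= t ->
        is_derive (fun t => - XI t) t (- k1 t) /\ is_derive (fun t => - ETA t) t (- k2 t)).
      { intros t Ht. split; apply @is_derive_opp; apply Hder, Ht. }
      assert (U1 : forall t, t1 <= t -> ETA t <= L / mu * tau q t ^ S n).
      { apply (unstable_component q (S n) mu ETA k2 L E0 t1); try assumption.
        - intros t Ht. apply Hder, Ht.
        - intros t Ht. destruct (Herr t Ht) as [_ H]. apply Rabs_le_between in H. lra.
        - intros t Ht. specialize (Hsmall t Ht). apply Rabs_le_between in Hsmall. lra. }
      assert (U2 : forall t, t1 <= t -> - ETA t <= L / mu * tau q t ^ S n).
      { apply (unstable_component q (S n) mu (fun t => - ETA t) (fun t => - k2 t) L E0 t1); try assumption.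
        - intros t Ht. apply Hopp, Ht.
        - intros t Ht. destruct (Herr t Ht) as [_ H]. apply Rabs_le_between in H. lra.
        - intros t Ht. specialize (Hsmall t Ht). apply Rabs_le_between in Hsmall. lra. }
      destruct (stable_component q (S n) mu XI k1 L t1) as [C1 V1]; try assumption.
      { intros t Ht. apply Hder, Ht. }
      { intros t Ht. destruct (Herr t Ht) as [H _]. apply Rabs_le_between in H. lra. }
      destruct (stable_component q (S n) mu (fun t => - XI t) (fun t => - k1 t) L t1) as [C2 V2]; try assumption.
      { intros t Ht. apply Hopp, Ht. }
      { intros t Ht. destruct (Herr t Ht) as [H _]. apply Rabs_le_between in H. lra. }
      assert (HLm : 0 <= L / mu) by nonneg.
      exists (L / mu + Rabs C1 + Rabs C2).
      split; [generalize (Rabs_pos C1) (Rabs_pos C2); lra|].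
      exists t1. intros t Ht.
      specialize (U1 t ltac:(lra)). specialize (U2 t ltac:(lra)).
      specialize (V1 t ltac:(lra)). specialize (V2 t ltac:(lra)).
      assert (P := Hpos (S n) t).
      assert (F1 : C1 * tau q t ^ S n <= Rabs C1 * tau q t ^ S n)
        by (apply Rmult_le_compat_r; [lra|apply Rle_abs]).
      assert (F2 : C2 * tau q t ^ S n <= Rabs C2 * tau q t ^ S n)
        by (apply Rmult_le_compat_r; [lra|apply Rle_abs]).
      assert (G1 : 0 <= Rabs C1 * tau q t ^ S n) by nonneg.
      assert (G2 : 0 <= Rabs C2 * tau q t ^ S n) by nonneg.
      rewrite !Rmult_plus_distr_r. split; apply Rabs_le; lra. }
  intros n HnM. destruct (Hboot n HnM) as [Kn [HKn H]].
  assert (Hi : 0 < / (2 * mu)) by (apply Rinv_0_lt_compat; lra).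
  exists (2 * Kn * / (2 * mu) + Kn). revert H. apply filter_imp. intros t [H1 H2].
  assert (P := Hpos n t).
  assert (Q0 : 0 <= Kn * tau q t ^ n) by nonneg.
  assert (Q1 : 0 <= / (2 * mu) * (Kn * tau q t ^ n)) by nonneg.
  rewrite <- (HA t), <- (HB t). split.
  - unfold Rdiv. rewrite Rabs_mult, (Rabs_pos_eq (/ (2 * mu))) by lra.
    assert (Rabs (ETA t - XI t) <= 2 * (Kn * tau q t ^ n)).
    { unfold Rminus. apply Rle_trans with (1 := Rabs_triang _ _). rewrite Rabs_Ropp. lra. }
    assert (Rabs (ETA t - XI t) * / (2 * mu) <= 2 * (Kn * tau q t ^ n) * / (2 * mu))
      by (apply Rmult_le_compat_r; lra). lra.
  - unfold Rdiv. rewrite Rabs_mult, (Rabs_pos_eq (/ 2)) by lra.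
    generalize (Rabs_triang (XI t) (ETA t)). lra.
Qed.

(** * From the remainder to the solution *)


(** The two local phase portraits behind one interface. *)
Lemma trapped_and_decay (q : nat) (kappa : R) (l11 l12 l21 l22 : list R) :
  (0 < q)%nat -> kappa <> 0 ->
  horner l11 0 = 0 -> horner l12 0 = 1 -> horner l21 0 = - kappa -> horner l22 0 = 0 ->
  exists p,
    (forall g1 g2, regular g1 -> regular g2 -> quasi_linear q l11 l12 l21 l22 (p + 1 + q) g1 g2 ->
      exists t0 A B K, 0 < t0 /\ forall t, t0 <= t -> derivatives g1 g2 A B t /\
        Rabs (A t) <= K * tau q t ^ p /\ Rabs (B t) <= K * tau q t ^ p) /\
    (forall M g1 g2 A B K, quasi_linear q l11 l12 l21 l22 M g1 g2 ->
      Rbar_locally p_infty (fun t => derivatives g1 g2 A B t /\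
        Rabs (A t) <= K * tau q t ^ p /\ Rabs (B t) <= K * tau q t ^ p) ->
      forall n, (2 * n + q <= S M)%nat -> exists K', Rbar_locally p_infty (fun t =>
        Rabs (A t) <= K' * tau q t ^ n /\ Rabs (B t) <= K' * tau q t ^ n)).
Proof.
  intros Hq Hk Z11 Z12 Z21 Z22. destruct (Rtotal_order kappa 0) as [Hneg|[Hz|Hpos]].
  - set (mu := sqrt (- kappa)).
    assert (Hmu : 0 < mu) by (apply sqrt_lt_R0; lra).
    assert (Hmu2 : mu ^ 2 = - kappa) by (apply pow2_sqrt; lra).
    rewrite <- Hmu2 in Z21. exists (q + 2)%nat. split.
    + intros g1 g2 R1 R2 HQL.
      apply (saddle_trapped q mu l11 l12 l21 l22 Hq Hmu Z11 Z12 Z21 Z22 (q + 2) (q + 2 + 1 + q) g1 g2);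
        try assumption; lia.
    + intros M g1 g2 A B K HQL Horb n Hn.
      apply (saddle_decay q mu l11 l12 l21 l22 Hq Hmu Z11 Z12 Z21 Z22 (q + 2) M g1 g2 A B K);
        try assumption; lia.
  - contradiction.
  - destruct (center_trapped q kappa l11 l12 l21 l22) as [p1 H1]; try assumption; try lra.
    destruct (center_decay q kappa l11 l12 l21 l22) as [p2 H2]; try assumption; try lra.
    exists (p1 + p2)%nat. split.
    + intros g1 g2 R1 R2 HQL.
      destruct (H1 (p1 + p2)%nat (p1 + p2 + 1 + q)%nat g1 g2) as [t0 [A [B [Ht0 H]]]];
        try assumption; try lia.
      exists t0, A, B, 1. split; [exact Ht0|]. intros t Ht. rewrite Rmult_1_l. apply H, Ht.
    + intros M g1 g2 A B K HQL Horb n Hn.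
      apply (H2 (p1 + p2)%nat M g1 g2 A B K); try assumption; lia.
Qed.

Lemma is_derive_psum_tau (q : nat) (a : nat -> R) (M : nat) (t : R) :
  (0 < q)%nat -> 0 < t ->
  is_derive (fun t => psum a M (tau q t)) t (dsum q a M (tau q t)).
Proof.
  intros Hq Ht. unfold psum, dsum. induction M as [|M IH].
  - rewrite sum_n_m_1_0. apply is_derive_ext with (fun _ => 0).
    + intros s. rewrite sum_n_m_1_0. reflexivity.
    + apply @is_derive_const.
  - rewrite sum_n_m_1_S.
    apply is_derive_ext with (fun t => plus (sum_n_m (fun k => tau q t ^ k * a k) 1 M)
      (a (S M) * tau q t ^ S M)).
    + intros s. rewrite sum_n_m_1_S. rewrite (Rmult_comm (tau q s ^ S M)). reflexivity.
    + apply @is_derive_plus; [exact IH|]. rewrite (Rmult_comm _ (a (S M))).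
      apply is_derive_scal. apply is_derive_tau_pow; assumption.
Qed.

Lemma continuous_dsum_tau (q : nat) (a : nat -> R) (M : nat) (t : R) :
  (0 < q)%nat -> 0 < t -> continuous (fun t => dsum q a M (tau q t)) t.
Proof.
  intros Hq Ht. unfold dsum. induction M as [|M IH].
  - apply continuous_ext with (fun _ => 0).
    + intros s. rewrite sum_n_m_1_0. reflexivity.
    + apply continuous_const.
  - apply continuous_ext with (fun t =>
      plus (sum_n_m (fun k => - (INR k / INR q) * tau q t ^ (k + q) * a k) 1 M)
      ((- (INR (S M) / INR q) * a (S M)) * tau q t ^ (S M + q))).
    + intros s. rewrite sum_n_m_1_S. unfold plus; simpl. ring.
    + apply @continuous_plus; [exact IH|].
      apply (continuous_mult (fun _ => - (INR (S M) / INR q) * a (S M))); [apply continuous_const|].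
      apply continuous_tau_pow; assumption.
Qed.

Definition remainder_field (q : nat) (f : R -> R -> R -> R) (sg : R) (a b c : nat -> R) (M : nat)
    (t u v : R) : R :=
  f (sg + psum a M (tau q t) + u) (psum b M (tau q t) + v) t - dsum q c M (tau q t).

Lemma bounded_on_segment (f : R -> R) (a b : R) :
  (forall t, a <= t <= b -> continuous f t) ->
  exists K, 0 <= K /\ forall t, a <= t <= b -> Rabs (f t) <= K.
Proof.
  intros Hf. destruct (Rle_lt_dec a b) as [Hab|Hab].
  - destruct (continuity_ab_maj (fun t => Rabs (f t)) a b Hab) as [m [Hm _]].
    + intros c Hc. apply continuity_pt_filterlim. apply continuous_Rabs_comp, Hf, Hc.
    + exists (Rabs (f m)). split; [apply Rabs_pos|exact Hm].
  - exists 0. split; [lra|]. intros t Ht. lra.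
Qed.

Lemma regular_remainder (q : nat) (f : R -> R -> R -> R) (sg : R) (a b c : nat -> R) (M : nat) :
  (0 < q)%nat -> regular (fun t x y => f x y t) -> regular (remainder_field q f sg a b c M).
Proof.
  intros Hq [Hc Hl].
  assert (Hcp : forall e t, 0 < t -> continuous (fun t => psum e M (tau q t)) t).
  { intros e t Ht. eapply is_derive_continuous. apply is_derive_psum_tau; assumption. }
  split.
  - intros th A B t Ht Hth HA HB. unfold remainder_field.
    assert (Hcc : forall (h : R -> R), continuous h (th t) -> continuous (fun s => h (th s)) t).
    { intros h Hh. apply (continuous_comp th h); assumption. }
    apply (continuous_minus (fun s => f (sg + psum a M (tau q (th s)) + A s)
      (psum b M (tau q (th s)) + B s) (th s)) (fun s => dsum q c M (tau q (th s)))).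
    + apply (Hc th (fun s => sg + psum a M (tau q (th s)) + A s)
        (fun s => psum b M (tau q (th s)) + B s)); try assumption.
      * apply (continuous_plus (fun s => sg + psum a M (tau q (th s))) A); [|exact HA].
        apply (continuous_plus (fun _ => sg)); [apply continuous_const|].
        apply (Hcc (fun t => psum a M (tau q t))), Hcp, Ht.
      * apply (continuous_plus (fun s => psum b M (tau q (th s))) B); [|exact HB].
        apply (Hcc (fun t => psum b M (tau q t))), Hcp, Ht.
    + apply (Hcc (fun t => dsum q c M (tau q t))). apply continuous_dsum_tau; assumption.
  - intros T1 T2 r HT1.
    destruct (bounded_on_segment (fun t => psum a M (tau q t)) T1 T2) as [Ka [HKa HA]].
    { intros t Ht. apply Hcp. lra. }
    destruct (bounded_on_segment (fun t => psum b M (tau q t)) T1 T2) as [Kb [HKb HB]].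
    { intros t Ht. apply Hcp. lra. }
    destruct (Hl T1 T2 (Rabs sg + Ka + Kb + r) HT1) as [L [HL H]].
    exists L. split; [exact HL|]. intros t u v u' v' Ht Hu Hv Hu' Hv'. unfold remainder_field.
    specialize (HA t Ht). specialize (HB t Ht). simpl in HA, HB.
    assert (Hx : forall w, Rabs w <= r -> Rabs (sg + psum a M (tau q t) + w) <= Rabs sg + Ka + Kb + r).
    { intros w Hw. apply Rle_trans with (1 := Rabs_triang3 _ _ _). lra. }
    assert (Hy : forall w, Rabs w <= r -> Rabs (psum b M (tau q t) + w) <= Rabs sg + Ka + Kb + r).
    { intros w Hw. apply Rle_trans with (1 := Rabs_triang _ _). generalize (Rabs_pos sg). lra. }
    specialize (H t _ _ _ _ Ht (Hx u Hu) (Hy v Hv) (Hx u' Hu') (Hy v' Hv')). simpl in H.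
    replace (sg + psum a M (tau q t) + u' - (sg + psum a M (tau q t) + u)) with (u' - u) in H by ring.
    replace (psum b M (tau q t) + v' - (psum b M (tau q t) + v)) with (v' - v) in H by ring.
    match goal with |- Rabs ?x <= _ => match type of H with Rabs ?y <= _ => replace x with y by ring end end.
    exact H.
Qed.

Lemma is_domin_of_bound (q N : nat) (h : R -> R) (K : R) :
  (0 < q)%nat -> Rbar_locally p_infty (fun t => Rabs (h t) <= K * tau q t ^ S N) ->
  is_domin (Rbar_locally p_infty) (tpow q N) h.
Proof.
  intros Hq H eps.
  assert (Hd : 0 < eps / (Rabs K + 1)).
  { apply Rdiv_lt_0_compat; [apply cond_pos|]. generalize (Rabs_pos K). lra. }
  generalize (filter_and _ _ H (eventually_tau_lt q _ Hq Hd)). apply filter_imp.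
  intros t [H1 [H2 H3]]. change (Rabs (h t) <= eps * Rabs (tpow q N t)).
  rewrite tpow_tau, (Rabs_pos_eq (tau q t ^ N)) by (apply pow_le; lra).
  apply Rle_trans with (1 := H1). simpl. rewrite <- Rmult_assoc.
  apply Rmult_le_compat_r; [apply pow_le; lra|].
  assert ((Rabs K + 1) * tau q t <= (Rabs K + 1) * (eps / (Rabs K + 1))).
  { apply Rmult_le_compat_l; [|lra]. generalize (Rabs_pos K). lra. }
  replace ((Rabs K + 1) * (eps / (Rabs K + 1))) with (pos eps) in H0
    by (field; generalize (Rabs_pos K); lra).
  apply Rle_trans with (2 := H0). apply Rmult_le_compat_r; [lra|].
  generalize (Rle_abs K). lra.
Qed.

(** One orbit serves all orders: it is trapped around one partial sum, hence, up to
    a term of the same size, around all the later ones, and then follows each of them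
    to the order that its residual allows. *)
Lemma equilibrium_solution (q : nat) (f1 f2 : R -> R -> R -> R) (Phi Gam : nat -> R -> R -> R)
    (sg kappa : R) :
  (0 < q)%nat ->
  regular (fun t x y => f1 x y t) -> regular (fun t x y => f2 x y t) ->
  (forall k, smooth2 (Phi k)) -> (forall k, smooth2 (Gam k)) ->
  local_expansion (fun x y s => f1 x y (/ s ^ q)) Phi sg 0 ->
  local_expansion (fun x y s => f2 x y (/ s ^ q)) Gam sg 0 ->
  Phi O sg 0 = 0 -> Gam O sg 0 = 0 ->
  pd1 (Phi O) sg 0 = 0 -> pd2 (Phi O) sg 0 = 1 ->
  pd1 (Gam O) sg 0 = - kappa -> pd2 (Gam O) sg 0 = 0 -> kappa <> 0 ->
  exists t0 x y a b, 0 < t0 /\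
    (forall t, t0 < t -> is_derive x t (f1 (x t) (y t) t) /\ is_derive y t (f2 (x t) (y t) t)) /\
    expansion q (fun t => x t - sg) a /\ expansion q y b.
Proof.
  intros Hq R1 R2 HPhi HGam E1 E2 Z1 Z2 J11 J12 J21 J22 Hk.
  destruct (formal_solution q Phi Gam sg kappa) as [a [b Hres]]; try assumption.
  destruct (remainder_equation q (fun x y s => f1 x y (/ s ^ q)) Phi sg a b a HPhi E1)
    as [l11 [l12 [Z11 [Z12 H1]]]]; [intros M; apply Hres|].
  destruct (remainder_equation q (fun x y s => f2 x y (/ s ^ q)) Gam sg a b b HGam E2)
    as [l21 [l22 [Z21 [Z22 H2]]]]; [intros M; apply Hres|].
  rewrite J11 in Z11. rewrite J12 in Z12. rewrite J21 in Z21. rewrite J22 in Z22.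
  set (g1 := remainder_field q f1 sg a b a). set (g2 := remainder_field q f2 sg a b b).
  assert (HQL : forall M, (q <= M)%nat -> quasi_linear q l11 l12 l21 l22 M (g1 M) (g2 M)).
  { intros M HM. destruct (H1 M HM) as [K1 [HK1 B1]], (H2 M HM) as [K2 [HK2 B2]].
    exists (K1 + K2). split; [lra|].
    generalize (filter_and _ _ (eventually_gt 0) (filter_and _ _
      (eventually_time_tau q _ Hq B1) (eventually_time_tau q _ Hq B2))).
    apply filter_imp. intros t [Ht [F1 F2]] u v Hu Hv.
    specialize (F1 u v Hu Hv). specialize (F2 u v Hu Hv). cbv beta in F1, F2.
    rewrite tau_pow_q, Rinv_inv in F1, F2 by assumption.
    assert (P : 0 <= tau q t ^ S q * (Rabs u + Rabs v) + tau q t ^ S M) by nonneg.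
    unfold g1, g2, remainder_field. rewrite Rmult_plus_distr_r.
    set (X := tau q t ^ S q * (Rabs u + Rabs v) + tau q t ^ S M) in *.
    assert (0 <= K1 * X) by nonneg.
    assert (0 <= K2 * X) by nonneg.
    split; lra. }
  destruct (trapped_and_decay q kappa l11 l12 l21 l22) as [p [Hex Hdec]]; try assumption.
  set (M0 := (p + 1 + q)%nat).
  destruct (Hex (g1 M0) (g2 M0)) as [t0 [A [B [K [Ht0 HAB]]]]].
  { apply regular_remainder; assumption. } { apply regular_remainder; assumption. }
  { apply HQL. unfold M0. lia. }
  set (x := fun t => sg + psum a M0 (tau q t) + A t). set (y := fun t => psum b M0 (tau q t) + B t).
  assert (Hsol : forall t, t0 <= t -> is_derive x t (f1 (x t) (y t) t) /\ is_derive y t (f2 (x t) (y t) t)).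
  { intros t Ht. destruct (HAB t Ht) as [[D1 D2] _].
    assert (Ht' : 0 < t) by lra.
    assert (P1 := is_derive_psum_tau q a M0 t Hq Ht').
    assert (P2 := is_derive_psum_tau q b M0 t Hq Ht').
    unfold g1, remainder_field in D1. unfold g2, remainder_field in D2.
    fold (x t) (y t) in D1, D2.
    split.
    - replace (f1 (x t) (y t) t) with
        (plus (plus zero (dsum q a M0 (tau q t))) (f1 (x t) (y t) t - dsum q a M0 (tau q t)))
        by (unfold plus, zero; simpl; ring).
      apply @is_derive_plus; [|exact D1]. apply @is_derive_plus; [apply @is_derive_const|exact P1].
    - replace (f2 (x t) (y t) t) with
        (plus (dsum q b M0 (tau q t)) (f2 (x t) (y t) t - dsum q b M0 (tau q t)))
        by (unfold plus; simpl; ring).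
      apply @is_derive_plus; [exact P2|exact D2]. }
  assert (Hexp : forall N, exists K', Rbar_locally p_infty (fun t =>
    Rabs (x t - sg - psum a N (tau q t)) <= K' * tau q t ^ S N /\
    Rabs (y t - psum b N (tau q t)) <= K' * tau q t ^ S N)).
  { intros N.
    (* The term [2 * S N]: half of the order is lost in passing from the energy to its root. *)
    set (M := (2 * S N + q + p + M0)%nat).
    assert (Htail : forall (e : nat -> R) m n, (m <= n)%nat -> exists C, 0 <= C /\
      Rbar_locally p_infty (fun t => Rabs (psum e n (tau q t) - psum e m (tau q t)) <= C * tau q t ^ S m)).
    { intros e m n Hmn. destruct (psum_tail e m n Hmn) as [C [HC H]]. exists C. split; [exact HC|].
      exact (eventually_time_tau q (fun s => Rabs (psum e n s - psum e m s) <= C * s ^ S m) Hq H). }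
    destruct (Htail a M0 M ltac:(unfold M; lia)) as [C1 [HC1 T1]].
    destruct (Htail b M0 M ltac:(unfold M; lia)) as [C2 [HC2 T2]].
    destruct (Htail a N M ltac:(unfold M; lia)) as [C3 [HC3 T3]].
    destruct (Htail b N M ltac:(unfold M; lia)) as [C4 [HC4 T4]].
    destruct (Hdec M (g1 M) (g2 M) (fun t => x t - sg - psum a M (tau q t))
      (fun t => y t - psum b M (tau q t)) (Rabs K + C1 + C2)) with (n := S N) as [K' HK'].
    - apply HQL. unfold M. lia.
    - generalize (filter_and _ _ (filter_and _ _ (eventually_gt t0) (eventually_tau_lt q 1 Hq Rlt_0_1))
        (filter_and _ _ T1 T2)).
      apply filter_imp. intros t [[Ht Htau] [B1 B2]].
      destruct (HAB t ltac:(lra)) as [_ [BA BB]]. destruct (Hsol t ltac:(lra)) as [D1 D2].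
      assert (Ht' : 0 < t) by lra.
      assert (Hp : 0 < tau q t ^ p) by apply pow_lt, tau_pos.
      assert (HM0 : tau q t ^ S M0 <= tau q t ^ p).
      { apply pow_le_pow_lt1; [lra|unfold M0; lia]. }
      assert (HKp : K * tau q t ^ p <= Rabs K * tau q t ^ p).
      { apply Rmult_le_compat_r; [lra|apply Rle_abs]. }
      assert (HC1p : C1 * tau q t ^ S M0 <= C1 * tau q t ^ p) by nonneg.
      assert (HC2p : C2 * tau q t ^ S M0 <= C2 * tau q t ^ p) by nonneg.
      assert (0 <= C1 * tau q t ^ p) by nonneg.
      assert (0 <= C2 * tau q t ^ p) by nonneg.
      rewrite !Rmult_plus_distr_r.
      split; [split|split].
      + unfold g1, remainder_field.
        replace (sg + psum a M (tau q t) + (x t - sg - psum a M (tau q t))) with (x t) by ring.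
        replace (psum b M (tau q t) + (y t - psum b M (tau q t))) with (y t) by ring.
        apply is_derive_ext with (fun t => minus (minus (x t) sg) (psum a M (tau q t))); [reflexivity|].
        apply @is_derive_minus; [|apply is_derive_psum_tau; assumption].
        replace (f1 (x t) (y t) t) with (minus (f1 (x t) (y t) t) zero)
          by (unfold minus, plus, opp, zero; simpl; ring).
        apply @is_derive_minus; [exact D1|apply @is_derive_const].
      + unfold g2, remainder_field.
        replace (sg + psum a M (tau q t) + (x t - sg - psum a M (tau q t))) with (x t) by ring.
        replace (psum b M (tau q t) + (y t - psum b M (tau q t))) with (y t) by ring.
        apply @is_derive_minus; [exact D2|apply is_derive_psum_tau; assumption].
      + unfold x. replace (sg + psum a M0 (tau q t) + A t - sg - psum a M (tau q t)) with
          (A t - (psum a M (tau q t) - psum a M0 (tau q t))) by ring.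
        unfold Rminus at 1. apply Rle_trans with (1 := Rabs_triang _ _). rewrite Rabs_Ropp. lra.
      + unfold y. replace (psum b M0 (tau q t) + B t - psum b M (tau q t)) with
          (B t - (psum b M (tau q t) - psum b M0 (tau q t))) by ring.
        unfold Rminus at 1. apply Rle_trans with (1 := Rabs_triang _ _). rewrite Rabs_Ropp. lra.
    - unfold M. lia.
    - exists (K' + C3 + C4). generalize (filter_and _ _ HK' (filter_and _ _ T3 T4)).
      apply filter_imp. intros t [[B1 B2] [B3 B4]].
      assert (Hp : 0 < tau q t ^ S N) by apply pow_lt, tau_pos.
      assert (0 <= C3 * tau q t ^ S N) by nonneg.
      assert (0 <= C4 * tau q t ^ S N) by nonneg.
      rewrite !Rmult_plus_distr_r. split.
      + replace (x t - sg - psum a N (tau q t)) with ((x t - sg - psum a M (tau q t)) +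
          (psum a M (tau q t) - psum a N (tau q t))) by ring.
        apply Rle_trans with (1 := Rabs_triang _ _). lra.
      + replace (y t - psum b N (tau q t)) with ((y t - psum b M (tau q t)) +
          (psum b M (tau q t) - psum b N (tau q t))) by ring.
        apply Rle_trans with (1 := Rabs_triang _ _). lra. }
  assert (Hsum : forall (e : nat -> R) N t,
    sum_n_m (fun k => tpow q k t * e k) 1 N = psum e N (tau q t)).
  { intros e N t. apply sum_n_m_1_ext. intros k _. rewrite tpow_tau. reflexivity. }
  exists t0, x, y, a, b. split; [exact Ht0|]. split; [intros t Ht; apply Hsol; lra|].
  split; intros N; destruct (Hexp N) as [K' HK']; apply (is_domin_of_bound q N _ K' Hq);
    revert HK'; apply filter_imp; intros t [B1 B2]; rewrite Hsum; assumption.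
Qed.

(** * Fields with power-law asymptotics *)


Lemma open_ball_2d (U : R * R -> Prop) (x y : R) :
  open U -> U (x, y) -> exists d : posreal, forall x' y',
    Rabs (x' - x) < d -> Rabs (y' - y) < d -> U (x', y').
Proof.
  intros HU Hxy. destruct (HU _ Hxy) as [d Hd]. exists d. intros x' y' Hx Hy.
  apply Hd. split; [exact Hx|exact Hy].
Qed.

Definition box (a b r : R) (p : R * R) : Prop := Rabs (fst p - a) <= r /\ Rabs (snd p - b) <= r.

(** The choice of a member of the cover around each point turns a finite list of
    centers into a finite list of indices. *)
Lemma compact_box (a b r : R) : 0 <= r -> compact_set (box a b r).
Proof.
  intros Hr I U HU Hcov.
  assert (Hcenter : box a b r (a, b)).
  { split; simpl; rewrite Rminus_diag, Rabs_R0; exact Hr. }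
  destruct (Hcov _ Hcenter) as [i0 _].
  assert (Hchoice : forall x y, exists s : I * posreal, box a b r (x, y) ->
    forall x' y', Rabs (x' - x) < snd s -> Rabs (y' - y) < snd s -> U (fst s) (x', y')).
  { intros x y. destruct (classic (box a b r (x, y))) as [H|H].
    - destruct (Hcov _ H) as [i Hi]. destruct (open_ball_2d _ _ _ (HU i) Hi) as [d Hd].
      exists (i, d). intros _. exact Hd.
    - exists (i0, mkposreal 1 Rlt_0_1). intros H1. contradiction. }
  set (ch := fun x y => proj1_sig (constructive_indefinite_description _ (Hchoice x y))).
  assert (Hch : forall x y, box a b r (x, y) ->
    forall x' y', Rabs (x' - x) < snd (ch x y) -> Rabs (y' - y) < snd (ch x y) -> U (fst (ch x y)) (x', y')).
  { intros x y. exact (proj2_sig (constructive_indefinite_description _ (Hchoice x y))). }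
  apply NNPP. intros Hno.
  apply (compactness_list 2 (a - r, (b - r, tt)) (a + r, (b + r, tt))
    (fun p => snd (ch (fst p) (fst (snd p))))).
  intros [l Hl]. apply Hno. exists (map (fun p => fst (ch (fst p) (fst (snd p)))) l).
  intros [x y] [Hx Hy]. simpl in Hx, Hy.
  destruct (Hl (x, (y, tt))) as [[u [v []]] [Hin [Hb Hclose]]].
  { simpl. apply Rabs_le_between in Hx. apply Rabs_le_between in Hy. lra. }
  exists (fst (ch u v)). split.
  - exact (in_map (fun p => fst (ch (fst p) (fst (snd p)))) l (u, (v, tt)) Hin).
  - simpl in Hb, Hclose. apply Hch; [|apply Hclose|apply Hclose].
    split; simpl; apply Rabs_le; lra.
Qed.

Lemma bounded_on_box (h : R -> R -> R -> R) (a1 b1 a2 b2 a3 b3 : R) :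
  (forall x y z, a1 <= x <= b1 -> a2 <= y <= b2 -> a3 <= z <= b3 ->
    continuous (fun p : R * R * R => h (fst (fst p)) (snd (fst p)) (snd p)) (x, y, z)) ->
  exists K, 0 <= K /\ forall x y z, a1 <= x <= b1 -> a2 <= y <= b2 -> a3 <= z <= b3 ->
    Rabs (h x y z) <= K.
Proof.
  intros Hc.
  assert (Hchoice : forall x y z, exists d : posreal,
    a1 <= x <= b1 -> a2 <= y <= b2 -> a3 <= z <= b3 ->
    forall x' y' z', Rabs (x' - x) < d -> Rabs (y' - y) < d -> Rabs (z' - z) < d ->
    Rabs (h x' y' z') <= Rabs (h x y z) + 1).
  { intros x y z. destruct (classic (a1 <= x <= b1 /\ a2 <= y <= b2 /\ a3 <= z <= b3)) as [[Hx [Hy Hz]]|H].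
    - destruct (proj1 (filterlim_locally _ _) (Hc x y z Hx Hy Hz) (mkposreal 1 Rlt_0_1)) as [d Hd].
      exists d. intros _ _ _ x' y' z' Hx' Hy' Hz'.
      assert (Hb : Rabs (h x' y' z' - h x y z) < 1).
      { apply (Hd (x', y', z')). split; [split|]; assumption. }
      replace (h x' y' z') with (h x y z + (h x' y' z' - h x y z)) by ring.
      apply Rle_trans with (1 := Rabs_triang _ _). lra.
    - exists (mkposreal 1 Rlt_0_1). intros H1 H2 H3. exfalso. apply H. auto. }
  set (ch := fun x y z => proj1_sig (constructive_indefinite_description _ (Hchoice x y z))).
  assert (Hch : forall x y z, a1 <= x <= b1 -> a2 <= y <= b2 -> a3 <= z <= b3 ->
    forall x' y' z', Rabs (x' - x) < ch x y z -> Rabs (y' - y) < ch x y z -> Rabs (z' - z) < ch x y z ->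
    Rabs (h x' y' z') <= Rabs (h x y z) + 1).
  { intros x y z. exact (proj2_sig (constructive_indefinite_description _ (Hchoice x y z))). }
  apply NNPP. intros Hno.
  apply (compactness_list 3 (a1, (a2, (a3, tt))) (b1, (b2, (b3, tt)))
    (fun p => ch (fst p) (fst (snd p)) (fst (snd (snd p))))).
  intros [l Hl]. apply Hno.
  assert (Hmax : exists K, 0 <= K /\ forall p, In p l ->
    Rabs (h (fst p) (fst (snd p)) (fst (snd (snd p)))) <= K).
  { clear. induction l as [|p l [K [HK IH]]].
    - exists 0. split; [lra|]. intros p [].
    - exists (K + Rabs (h (fst p) (fst (snd p)) (fst (snd (snd p))))).
      split; [generalize (Rabs_pos (h (fst p) (fst (snd p)) (fst (snd (snd p))))); lra|].
      intros p' [<-|Hin]; [lra|]. specialize (IH p' Hin).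
      generalize (Rabs_pos (h (fst p) (fst (snd p)) (fst (snd (snd p))))). lra. }
  destruct Hmax as [K [HK Hmax]]. exists (K + 1). split; [lra|].
  intros x y z Hx Hy Hz.
  destruct (Hl (x, (y, (z, tt)))) as [[u [v [w []]]] [Hin [Hb Hclose]]].
  { simpl. auto. }
  simpl in Hb, Hclose. destruct Hb as [Hu [Hv [Hw _]]], Hclose as [C1 [C2 [C3 _]]].
  specialize (Hmax _ Hin). simpl in Hmax.
  generalize (Hch u v w Hu Hv Hw x y z C1 C2 C3). lra.
Qed.

Lemma continuous_pair {U V W : UniformSpace} (f : U -> V) (g : U -> W) (x : U) :
  continuous f x -> continuous g x -> continuous (fun s => (f s, g s)) x.
Proof.
  intros Hf Hg. apply filterlim_locally. intros eps.
  generalize (filter_and _ _ (proj1 (filterlim_locally _ _) Hf eps)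
    (proj1 (filterlim_locally _ _) Hg eps)).
  apply filter_imp. intros s [H1 H2]. split; assumption.
Qed.

Lemma smooth3_regular (F : R -> R -> R -> R) :
  smooth3 (fun _ _ t => 0 < t) F -> regular (fun t x y => F x y t).
Proof.
  intros HF. split.
  - intros th A B t Ht Hth HA HB. destruct (HF O) as [Hc _].
    apply (continuous_comp (fun s => (A s, B s, th s))
      (fun p : R * R * R => F (fst (fst p)) (snd (fst p)) (snd p))); [|apply Hc, Ht].
    apply (continuous_pair (fun s => (A s, B s)) th); [apply continuous_pair|]; assumption.
  - intros T1 T2 r HT1. destruct (HF 1%nat) as [_ [Hex [[H1 _] [[H2 _] _]]]].
    destruct (bounded_on_box (fun x y z => Derive (fun u => F u y z) x) (- r) r (- r) r T1 T2)
      as [K1 [HK1 B1]]; [intros x y z _ _ Hz; apply H1; lra|].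
    destruct (bounded_on_box (fun x y z => Derive (fun u => F x u z) y) (- r) r (- r) r T1 T2)
      as [K2 [HK2 B2]]; [intros x y z _ _ Hz; apply H2; lra|].
    exists (K1 + K2). split; [lra|]. intros t a b a' b' Ht Ha Hb Ha' Hb'.
    destruct (mean_value_2d (fun x y => F x y t) a b a' b') as [c1 [c2 [C1 [C2 E]]]].
    { intros x y. apply (Hex x y t). lra. } { intros x y. apply (Hex x y t). lra. }
    rewrite E. apply Rle_trans with (1 := Rabs_triang _ _). rewrite !Rabs_mult.
    apply Rabs_le_between in Ha. apply Rabs_le_between in Hb.
    assert (Ha2 := Ha'). apply Rabs_le_between in Ha2.
    assert (Hb2 := Hb'). apply Rabs_le_between in Hb2.
    assert (Hc1 : - r <= c1 <= r).
    { revert C1. unfold Rmin, Rmax. destruct (Rle_dec a a'); lra. }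
    assert (Hc2 : - r <= c2 <= r).
    { revert C2. unfold Rmin, Rmax. destruct (Rle_dec b b'); lra. }
    assert (D1 := B1 c1 b t Hc1 ltac:(lra) Ht). assert (D2 := B2 a' c2 t ltac:(lra) Hc2 Ht).
    simpl in D1, D2.
    assert (P1 := Rabs_pos (a' - a)). assert (P2 := Rabs_pos (b' - b)).
    assert (G1 := Rmult_le_compat_r _ _ _ P1 D1). assert (G2 := Rmult_le_compat_r _ _ _ P2 D2).
    assert (0 <= K2 * Rabs (a' - a)) by nonneg.
    assert (0 <= K1 * Rabs (b' - b)) by nonneg.
    rewrite Rmult_plus_distr_r, !Rmult_plus_distr_l. lra.
Qed.

Lemma regular_plus (f g : R -> R -> R -> R) :
  regular f -> regular g -> regular (fun t x y => f t x y + g t x y).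
Proof.
  intros [C1 L1] [C2 L2]. split.
  - intros th A B t Ht Hth HA HB.
    apply (continuous_plus (fun s => f (th s) (A s) (B s)) (fun s => g (th s) (A s) (B s)));
      [apply C1|apply C2]; assumption.
  - intros T1 T2 r HT1. destruct (L1 T1 T2 r HT1) as [K1 [HK1 H1]], (L2 T1 T2 r HT1) as [K2 [HK2 H2]].
    exists (K1 + K2). split; [lra|]. intros t a b a' b' Ht Ha Hb Ha' Hb'.
    specialize (H1 t a b a' b' Ht Ha Hb Ha' Hb'). specialize (H2 t a b a' b' Ht Ha Hb Ha' Hb').
    replace (f t a' b' + g t a' b' - (f t a b + g t a b)) with
      ((f t a' b' - f t a b) + (g t a' b' - g t a b)) by ring.
    apply Rle_trans with (1 := Rabs_triang _ _). lra.
Qed.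

Lemma regular_autonomous (h : R -> R) :
  (forall x, ex_derive h x) -> (forall x, continuous (Derive h) x) ->
  regular (fun _ x _ => h x) /\ regular (fun _ _ y => h y).
Proof.
  intros Hex Hcd.
  assert (Hlip : forall r, exists L, 0 <= L /\ forall x x', Rabs x <= r -> Rabs x' <= r ->
    Rabs (h x' - h x) <= L * Rabs (x' - x)).
  { intros r. destruct (bounded_on_segment (Derive h) (- r) r) as [L [HL H]]; [intros; apply Hcd|].
    exists L. split; [exact HL|]. intros x x' Hx Hx'.
    destruct (mean_value h (Derive h) x x') as [c [Hc E]]; [intros; apply Derive_correct, Hex|].
    rewrite E, Rabs_mult. apply Rmult_le_compat_r; [apply Rabs_pos|]. apply H.
    apply Rabs_le_between in Hx. apply Rabs_le_between in Hx'.
    revert Hc. unfold Rmin, Rmax. destruct (Rle_dec x x'); lra. }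
  assert (Hcont : forall (A : R -> R) t, continuous A t -> continuous (fun s => h (A s)) t).
  { intros A t HA. apply (continuous_comp A h); [exact HA|]. apply (ex_derive_continuous h), Hex. }
  split; (split; [intros th A B t _ _ HA HB; apply Hcont; assumption|]);
    intros T1 T2 r _; destruct (Hlip r) as [L [HL H]]; exists L; (split; [exact HL|]);
    intros t a b a' b' _ Ha Hb Ha' Hb';
    assert (0 <= L * Rabs (a' - a)) by (apply Rmult_le_pos; [exact HL|apply Rabs_pos]);
    assert (0 <= L * Rabs (b' - b)) by (apply Rmult_le_pos; [exact HL|apply Rabs_pos]);
    rewrite Rmult_plus_distr_l.
  - specialize (H a a' Ha Ha'). lra.
  - specialize (H b b' Hb Hb'). lra.
Qed.

Lemma eventually_inv_pow (q : nat) (P : R -> Prop) :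
  (0 < q)%nat -> Rbar_locally p_infty P -> at_right 0 (fun s => P (/ s ^ q)).
Proof.
  intros Hq [T HT]. apply at_right0_iff.
  exists (Rmin 1 (/ (Rabs T + 1))). assert (HT0 := Rabs_pos T).
  split; [apply Rmin_glb_lt; [lra|apply Rinv_0_lt_compat; lra]|].
  intros s [Hs1 Hs2]. apply HT.
  assert (H1 : s < 1) by (apply Rlt_le_trans with (1 := Hs2), Rmin_l).
  assert (H2 : s < / (Rabs T + 1)) by (apply Rlt_le_trans with (1 := Hs2), Rmin_r).
  assert (H3 : s ^ q <= s). { rewrite <- (pow_1 s) at 2. apply pow_le_pow_lt1; [lra|lia]. }
  apply Rle_lt_trans with (Rabs T); [apply Rle_abs|].
  apply Rlt_le_trans with (Rabs T + 1); [lra|].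
  rewrite <- (Rinv_inv (Rabs T + 1)). apply Rinv_le_contravar; [apply pow_lt, Hs1|].
  apply Rle_trans with (1 := H3), Rlt_le, H2.
Qed.

Lemma tau_inv_pow (q : nat) (s : R) : (0 < q)%nat -> 0 < s -> tau q (/ s ^ q) = s.
Proof.
  intros Hq Hs. unfold tau. rewrite <- Rpower_pow by exact Hs.
  rewrite <- Rpower_Ropp, Rpower_mult.
  replace (- INR q * - / INR q) with 1; [apply Rpower_1, Hs|].
  field. apply not_0_INR. lia.
Qed.

Definition with_leading (h : R -> R -> R) (c : nat -> R -> R -> R) (k : nat) : R -> R -> R :=
  match k with O => h | S _ => c k end.

(** The [o]-estimate after [M + 1] terms is traded for an [O]-estimate after [M] terms. *)
Lemma local_expansion_of_compacts (q : nat) (F : R -> R -> R -> R) (c : nat -> R -> R -> R)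
    (h : R -> R -> R) (a b : R) :
  (0 < q)%nat -> (forall k, (1 <= k)%nat -> smooth2 (c k)) -> expansion_on_compacts q F c ->
  local_expansion (fun x y s => h x y + F x y (/ s ^ q)) (with_leading h c) a b.
Proof.
  intros Hq Hc HF M.
  destruct (smooth2_bounded (c (S M)) a b (Hc (S M) ltac:(lia))) as [r [K [Hr [HK HB]]]].
  exists (Rmin r 1), (1 + K). split; [apply Rmin_glb_lt; lra|]. split; [lra|].
  generalize (filter_and _ _ (at_right0_lt 1 Rlt_0_1) (eventually_inv_pow q _ Hq
    (HF (box a b 1) (compact_box a b 1 Rle_0_1) (S M) (mkposreal 1 Rlt_0_1)))).
  apply filter_imp. intros s [Hs H] x y [Hx Hy].
  assert (M1 := Rmin_l r 1). assert (M2 := Rmin_r r 1).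
  assert (Hbox : box a b 1 (x, y)) by (split; simpl; lra).
  specialize (H x y Hbox). simpl pos in H. rewrite tpow_tau, tau_inv_pow, Rmult_1_l in H by (assumption || lra).
  rewrite (sum_n_m_1_ext _ (fun k => s ^ k * c k x y)) in H.
  2:{ intros k _. rewrite tpow_tau, tau_inv_pow by (assumption || lra). reflexivity. }
  rewrite sum_n_m_1_S in H.
  assert (Htr : truncation (with_leading h c) M x y s =
    h x y + sum_n_m (fun k => s ^ k * c k x y) 1 M).
  { unfold truncation. clear. induction M as [|M IH].
    - rewrite sum_n_m_1_0. simpl. ring.
    - rewrite tech5, IH, sum_n_m_1_S. simpl. ring. }
  rewrite Htr.
  replace (h x y + F x y (/ s ^ q) - (h x y + sum_n_m (fun k => s ^ k * c k x y) 1 M)) with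
    ((F x y (/ s ^ q) - (sum_n_m (fun k => s ^ k * c k x y) 1 M + s ^ S M * c (S M) x y)) +
     s ^ S M * c (S M) x y) by ring.
  apply Rle_trans with (1 := Rabs_triang _ _). rewrite Rmult_plus_distr_r, Rmult_1_l.
  apply Rplus_le_compat; [exact H|].
  assert (P : 0 < s ^ S M) by (apply pow_lt; lra).
  rewrite Rabs_mult, Rabs_pos_eq, Rmult_comm by lra.
  apply Rmult_le_compat_r; [lra|]. apply HB. split; lra.
Qed.

Lemma smooth3_ex_derive_n (f : R -> R -> R -> R) :
  smooth3 (fun _ _ _ => True) f -> forall n x y z, ex_derive_n (fun u => f u y z) n x.
Proof.
  intros Hf n. revert f Hf. induction n as [|n IH]; intros f Hf x y z; [exact I|].
  destruct n as [|n].
  - destruct (Hf 1%nat) as [_ [Hex _]]. exact (proj1 (Hex x y z I)).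
  - assert (Hf' : smooth3 (fun _ _ _ => True) (fun x y z => Derive (fun u => f u y z) x)).
    { intros m. destruct (Hf (S m)) as [_ [_ [H _]]]. exact H. }
    generalize (IH _ Hf' x y z). apply ex_derive_ext. intros t.
    change (Derive_n (Derive_n (fun u => f u y z) 1) n t = Derive_n (fun u => f u y z) (S n) t).
    rewrite Derive_n_comp, Nat.add_1_r. reflexivity.
Qed.

(** * The perturbed Hamiltonian system *)

Lemma force_smooth (H : R -> R -> R -> R) (V : R -> R -> R) (w : R -> R) (l : R) :
  smooth3 (fun _ _ _ => True) H ->
  (forall x y l, H x y l = y ^ 2 / 2 + V x l) ->
  (forall x l, is_derive (fun u => V u l) x ((x ^ 2 - l) * w x)) ->
  forall n x, ex_derive_n (fun x => (x ^ 2 - l) * w x) n x.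
Proof.
  intros HH HV Hw n x. destruct n as [|n]; [exact I|].
  generalize (smooth3_ex_derive_n H HH (S (S n)) x 0 l). apply ex_derive_ext. intros t.
  change (Derive_n (fun u => H u 0 l) (S n) t = Derive_n (fun x => (x ^ 2 - l) * w x) n t).
  rewrite <- (Nat.add_1_r n), <- Derive_n_comp. apply Derive_n_ext. intros u.
  apply is_derive_unique.
  apply is_derive_ext with (fun u => plus (0 ^ 2 / 2) (V u l)); [intros s; symmetry; apply HV|].
  replace ((u ^ 2 - l) * w u) with (plus zero ((u ^ 2 - l) * w u)) by apply plus_zero_l.
  apply @is_derive_plus; [apply @is_derive_const|apply Hw].
Qed.

(** [w] is the difference of the derivatives of [V] at the parameters [0] and [1]. *)
Lemma weight_derivable (H : R -> R -> R -> R) (V : R -> R -> R) (w : R -> R) :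
  smooth3 (fun _ _ _ => True) H ->
  (forall x y l, H x y l = y ^ 2 / 2 + V x l) ->
  (forall x l, is_derive (fun u => V u l) x ((x ^ 2 - l) * w x)) ->
  forall x, ex_derive w x.
Proof.
  intros HH HV Hw x.
  apply ex_derive_ext with (fun x => minus ((x ^ 2 - 0) * w x) ((x ^ 2 - 1) * w x)).
  { intros t. unfold minus, plus, opp; simpl. ring. }
  apply @ex_derive_minus.
  - exact (force_smooth H V w 0 HH HV Hw 1 x).
  - exact (force_smooth H V w 1 HH HV Hw 1 x).
Qed.

Lemma solution_near (H : R -> R -> R -> R) (V : R -> R -> R) (w : R -> R)
    (F G : R -> R -> R -> R) (q : nat) (Fk Gk : nat -> R -> R -> R) (lambda sg : R) :
  smooth3 (fun _ _ _ => True) H ->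
  (forall x y l, H x y l = y ^ 2 / 2 + V x l) ->
  (forall x l, is_derive (fun u => V u l) x ((x ^ 2 - l) * w x)) ->
  smooth3 (fun _ _ t => 0 < t) F -> smooth3 (fun _ _ t => 0 < t) G ->
  (0 < q)%nat ->
  (forall k, (1 <= k)%nat -> smooth2 (Fk k)) -> (forall k, (1 <= k)%nat -> smooth2 (Gk k)) ->
  expansion_on_compacts q F Fk -> expansion_on_compacts q G Gk ->
  sg ^ 2 = lambda -> sg <> 0 -> w sg <> 0 ->
  exists t0 x y a b, 0 < t0 /\ is_solution H F G lambda t0 x y /\
    expansion q (fun t => x t - sg) a /\ expansion q y b.
Proof.
  intros HH HV Hw HF HG Hq HFk HGk EF EG Hsg Hsg0 Hwsg.
  set (W := fun x => - ((x ^ 2 - lambda) * w x)).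
  assert (HWn : forall n x, ex_derive_n W n x).
  { intros n x. apply ex_derive_n_opp. exact (force_smooth H V w lambda HH HV Hw n x). }
  assert (HWc : forall x, continuous (Derive W) x).
  { intros x. apply (ex_derive_continuous (Derive W)). exact (HWn 2%nat x). }
  assert (HW1 : Derive W sg = - (2 * sg * w sg)).
  { apply is_derive_unique. unfold W. auto_derive.
    - apply (weight_derivable H V w HH HV Hw).
    - rewrite <- Hsg. ring. }
  assert (HidD : forall x, Derive (fun y => y) x = 1) by (intros x; apply Derive_id).
  destruct (equilibrium_solution q (fun x y t => y + F x y t) (fun x y t => W x + G x y t)
    (with_leading (fun _ y => y) Fk) (with_leading (fun x _ => W x) Gk) sg (2 * sg * w sg))
    as [t0 [x [y [a [b [Ht0 [Hsol [Ea Eb]]]]]]]]; try assumption.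
  - apply (regular_plus (fun _ _ y => y) (fun t x y => F x y t)); [|apply smooth3_regular, HF].
    apply (regular_autonomous (fun y => y)).
    + intros; apply ex_derive_id.
    + intros z. apply continuous_ext with (fun _ => 1); [intros; symmetry; apply HidD|].
      apply continuous_const.
  - apply (regular_plus (fun _ x _ => W x) (fun t x y => G x y t)); [|apply smooth3_regular, HG].
    apply (regular_autonomous W); [intros z; exact (HWn 1%nat z)|exact HWc].
  - intros [|k]; [exact smooth2_snd|apply HFk; lia].
  - intros [|k]; [exact (smooth2_of_fun1 W HWn)|apply HGk; lia].
  - apply (local_expansion_of_compacts q F Fk (fun _ y => y)); assumption.
  - apply (local_expansion_of_compacts q G Gk (fun x _ => W x)); assumption.
  - reflexivity.
  - simpl. unfold W. rewrite Hsg. ring.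
  - unfold pd1. simpl. apply Derive_const.
  - unfold pd2. simpl. apply Derive_id.
  - unfold pd2. simpl. apply Derive_const.
  - intros Hz. apply Hwsg. apply Rmult_eq_reg_l with (2 * sg); [rewrite Hz; ring|].
    intros Hz2. apply Hsg0. lra.
  - exists t0, x, y, a, b. split; [exact Ht0|]. split; [|split; assumption].
    intros t Ht. destruct (Hsol t Ht) as [D1 D2].
    assert (E1 : Derive (fun v => H (x t) v lambda) (y t) = y t).
    { apply is_derive_unique. apply is_derive_ext with (fun v => v ^ 2 / 2 + V (x t) lambda).
      - intros v. symmetry. apply HV.
      - auto_derive; [exact I|field]. }
    assert (E2 : Derive (fun u => H u (y t) lambda) (x t) = (x t ^ 2 - lambda) * w (x t)).
    { apply is_derive_unique.
      apply is_derive_ext with (fun u => plus (y t ^ 2 / 2) (V u lambda)).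
      - intros u. symmetry. apply HV.
      - replace ((x t ^ 2 - lambda) * w (x t)) with (plus zero ((x t ^ 2 - lambda) * w (x t)))
          by apply plus_zero_l.
        apply @is_derive_plus; [apply @is_derive_const|apply Hw]. }
    rewrite E1, E2. split; assumption.
Qed.

Theorem theorem1 :
  forall (H : R -> R -> R -> R) (V : R -> R -> R) (w : R -> R) (d0 : R)
         (F G : R -> R -> R -> R) (q : nat) (Fk Gk : nat -> R -> R -> R)
         (lambda : R),
    smooth3 (fun _ _ _ => True) H ->
    (forall x y l, H x y l = y ^ 2 / 2 + V x l) ->
    (forall x l, is_derive (fun u => V u l) x ((x ^ 2 - l) * w x)) ->
    0 < d0 ->
    (forall x l,
        (0 <= l /\ Rabs x < sqrt l + d0) \/ (l < 0 /\ Rabs x < d0) ->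
        0 < w x) ->
    smooth3 (fun _ _ t => 0 < t) F ->
    smooth3 (fun _ _ t => 0 < t) G ->
    vanishes_on_compacts F ->
    vanishes_on_compacts G ->
    (0 < q)%nat ->
    (forall k, (1 <= k)%nat -> smooth2 (Fk k)) ->
    (forall k, (1 <= k)%nat -> smooth2 (Gk k)) ->
    expansion_on_compacts q F Fk ->
    expansion_on_compacts q G Gk ->
    0 < lambda ->
    exists (t0 : R) (x1 y1 x2 y2 : R -> R) (a1 b1 a2 b2 : nat -> R),
      0 < t0 /\
      is_solution H F G lambda t0 x1 y1 /\
      is_solution H F G lambda t0 x2 y2 /\
      expansion q (fun t => x1 t - sqrt lambda) a1 /\
      expansion q y1 b1 /\
      expansion q (fun t => x2 t - - sqrt lambda) a2 /\
      expansion q y2 b2 /\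
      (exists t, t0 < t /\ (x1 t, y1 t) <> (x2 t, y2 t)).
Proof.
  intros H V w d0 F G q Fk Gk lambda HH HV Hw Hd0 Hpos HF HG _ _ Hq HFk HGk EF EG Hl.
  assert (Hs : 0 < sqrt lambda) by (apply sqrt_lt_R0, Hl).
  assert (Hs2 : sqrt lambda ^ 2 = lambda) by (apply pow2_sqrt; lra).
  assert (Hw1 : 0 < w (sqrt lambda)).
  { apply Hpos with lambda. left. rewrite Rabs_pos_eq; lra. }
  assert (Hw2 : 0 < w (- sqrt lambda)).
  { apply Hpos with lambda. left. rewrite Rabs_Ropp, Rabs_pos_eq; lra. }
  destruct (solution_near H V w F G q Fk Gk lambda (sqrt lambda))
    as [t1 [x1 [y1 [a1 [b1 [Ht1 [S1 [Ea1 Eb1]]]]]]]]; try assumption; try lra.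
  destruct (solution_near H V w F G q Fk Gk lambda (- sqrt lambda))
    as [t2 [x2 [y2 [a2 [b2 [Ht2 [S2 [Ea2 Eb2]]]]]]]]; try assumption; try lra; try nra.
  assert (M1 := Rmax_l t1 t2). assert (M2 := Rmax_r t1 t2).
  exists (Rmax t1 t2), x1, y1, x2, y2, a1, b1, a2, b2.
  split; [lra|]. split; [intros t Ht; apply S1; lra|]. split; [intros t Ht; apply S2; lra|].
  split; [exact Ea1|]. split; [exact Eb1|]. split; [exact Ea2|]. split; [exact Eb2|].
  assert (Heps : 0 < sqrt lambda / 2) by lra.
  destruct (filter_and _ _ (Ea1 O (mkposreal _ Heps)) (Ea2 O (mkposreal _ Heps))) as [T HT].
  set (t := Rmax T (Rmax t1 t2) + 1).
  assert (N1 := Rmax_l T (Rmax t1 t2)). assert (N2 := Rmax_r T (Rmax t1 t2)).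
  exists t. split; [unfold t; lra|]. intros Heq. injection Heq as Hx _.
  destruct (HT t ltac:(unfold t; lra)) as [B1 B2].
  change (Rabs (x1 t - sqrt lambda - sum_n_m (fun k => tpow q k t * a1 k) 1 0) <=
    sqrt lambda / 2 * Rabs (tpow q 0 t)) in B1.
  change (Rabs (x2 t - - sqrt lambda - sum_n_m (fun k => tpow q k t * a2 k) 1 0) <=
    sqrt lambda / 2 * Rabs (tpow q 0 t)) in B2.
  rewrite sum_n_m_1_0, tpow_tau, pow_O, Rabs_R1, Rmult_1_r in B1, B2.
  apply Rabs_le_between in B1. apply Rabs_le_between in B2. lra.
Qed.
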